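(* For every $n\in\mathbb N$ let $\{Y(u,n):u\in\mathcal U\}$ be a family of independent strictly upper triangular $n\times n$ Gaussian random matrices. Then for all $m\in\mathbb N$, $\epsilon_1,\dots,\epsilon_m\in\{1,*\}$ and $u_1,\dots,u_m\in\mathcal U$, $$\lim_{n\to\infty}\tau(n)\big(Y^{\epsilon_1}(u_1,n)\cdots Y^{\epsilon_m}(u_m,n)\big)=\varphi\big(\eta^{\epsilon_1}(u_1)\cdots\eta^{\epsilon_m}(u_m)\big),$$ where $\eta(u)=\wp(\chi_\Delta,u')+\wp^*(\chi_\Delta^t,u'')$, $\chi_\Delta$ is the characteristic function of the triangle $\Delta=\{(x,y)\in[0,1]^2:x<y\}$, and $\chi_\Delta^t(x,y)=\chi_\Delta(y,x)$.
   Context: $\mathcal U$ is a countable set; $\mathcal U'=\{u':u\in\mathcal U\}$ and $\mathcal U''=\{u'':u\in\mathcal U\}$ are two disjoint copies of it. A family of independent strictly upper triangular Gaussian random matrices is a family of complex $n\times n$ matrices $Y(u,n)$, $u\in\mathcal U$, whose entries on and below the main diagonal are zero and whose entries above the main diagonal are complex Gaussian variables such that, for each $u$, their real and imaginary parts form a family of $n(n-1)$ i.i.d. real Gaussian variables of mean zero and variance $1/(2n)$, these families being independent for different $u$. $\tau(n)=\mathbb E\circ\mathrm{tr}(n)$, with $\mathrm{tr}(n)$ the normalized trace. $A^1=A$, and $A^*$ is the adjoint. Fock space: $I=[0,1]$ and $\Gamma_n=I^{n+1}$ with Lebesgue measure. $\mathcal G$ is a separable Hilbert space with orthonormal basis $\{e(v):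 v\in\mathcal U'\cup\mathcal U''\}$, and $$\mathcal H=L^2(I)\oplus\bigoplus_{n\ge1}L^2(\Gamma_n,\mathcal G^{\otimes n}).$$ For $h\in L^\infty(\Gamma_1)$ and $v\in\mathcal U'\cup\mathcal U''$, $\wp(h,v)$ is the bounded operator on $\mathcal H$ given by $(\wp(h,v)F_0)(x,x_1)=h(x,x_1)F_0(x_1)\,e(v)$ for $F_0\in L^2(I)$, and $(\wp(h,v)F_n)(x,x_1,\dots,x_{n+1})=h(x,x_1)\,e(v)\otimes F_n(x_1,\dots,x_{n+1})$ for $F_n\in L^2(\Gamma_n,\mathcal G^{\otimes n})$, $n\ge1$. Its adjoint is denoted $\wp^*(h,v)$. The state is $\varphi(F)=\langle F\mathbf 1,\mathbf 1\rangle$, where $\mathbf 1\in L^2(I)\subset\mathcal H$ is the constant function $1$ (for operators decomposable over the last coordinate $x\in I$ this is $\int_I\langle F(x)\Omega(x),\Omega(x)\rangle dx$, with $\Omega(x)$ the vacuum unit vector at $x$). *)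

(* Defs.v *)
From HB Require Import structures.
From mathcomp Require Import all_boot all_order all_algebra.
From mathcomp Require Import all_classical all_reals all_analysis.
From mathcomp Require Import measurable_realfun.
From mathcomp Require Import complex spectral ring lra.

Set Implicit Arguments.
Unset Strict Implicit.
Unset Printing Implicit Defensive.

Import Order.TTheory GRing.Theory Num.Theory.
Import numFieldNormedType.Exports.

Local Open Scope classical_set_scope.
Local Open Scope ring_scope.
Local Open Scope complex_scope.

(* [Re] and [Im] are the R-valued projections, not ssrnum's 'Re and 'Im. *)
Local Notation Re := complex.Re.
Local Notation Im := complex.Im.

Section ComplexIntegral.
Context {R : realType}.

Definition cmeasurable d (T : measurableType d) (f : T -> R[i]) : Prop :=
  measurable_fun setT (fun x => Re (f x)) /\
  measurable_fun setT (fun x => Im (f x)).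

Definition cintegral d (T : measurableType d) (mu : {measure set T -> \bar R})
    (f : T -> R[i]) : R[i] :=
  (\int[mu]_x Re (f x)) +i* (\int[mu]_x Im (f x)).

(* Unconditional sum of an absolutely summable family. *)
Definition rsum (T : choiceType) (f : T -> R) : R :=
  fine (\esum_(t in setT) (EFin \o f)^\+ t)%E -
  fine (\esum_(t in setT) (EFin \o f)^\- t)%E.

Definition csum (T : choiceType) (f : T -> R[i]) : R[i] :=
  rsum (fun t => Re (f t)) +i* rsum (fun t => Im (f t)).

Definition sqmod (z : R[i]) : R := Re (`|z| ^+ 2).

End ComplexIntegral.

Section Cube.
Context (R : realType).

(* Points of I = [0, 1] are represented by reals; the functions on I^k are the
   functions on R^k modulo equality a.e. for the measure [cube k] below. *)
Local Notation pt := (measurableTypeR R).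

Lemma measurable_I : measurable (`[0, 1] : set pt).
Proof. exact: measurable_itv. Qed.

Lemma lebesgue_I_fin : (lebesgue_measure (`[0%R, 1%R] : set pt) < +oo)%E.
Proof. by rewrite lebesgue_measure_itv/= lte_fin ltr01 oppr0 adde0 ltry. Qed.

Definition lebI : set pt -> \bar R := mfrestr measurable_I lebesgue_I_fin.

HB.instance Definition _ := Measure.on lebI.

Lemma lebI_setT : lebI setT = 1%E.
Proof.
rewrite /lebI /mfrestr /mrestr setTI lebesgue_measure_itv/= lte_fin ltr01.
by rewrite oppr0 adde0.
Qed.

HB.instance Definition _ := Measure_isProbability.Build _ _ _ lebI lebI_setT.

Definition cons_pt n (p : pt * n.-tuple pt) : n.+1.-tuple pt :=
  [tuple of p.1 :: p.2].

Lemma measurable_cons_pt n : measurable_fun setT (@cons_pt n).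
Proof. exact: measurable_cons. Qed.

HB.instance Definition _ n :=
  isMeasurableFun.Build _ _ _ _ (@cons_pt n) (@measurable_cons_pt n).

Fixpoint cube n : probability (n.-tuple pt) R :=
  match n with
  | 0 => \d_ [tuple]
  | n'.+1 => distribution (lebI \x cube n')%E (@cons_pt n')
  end.

End Cube.

Section SqMod.
Context {R : realType}.
Implicit Types a b z : R[i].

Lemma sqmodE z : sqmod z = Re z ^+ 2 + Im z ^+ 2.
Proof.
rewrite /sqmod normc_def -rmorphXn/= sqr_sqrtr// addr_ge0// sqr_ge0//.
Qed.

Lemma sqmod_ge0 z : 0 <= sqmod z.
Proof. by rewrite sqmodE addr_ge0// sqr_ge0. Qed.

Lemma sqmodM a b : sqmod (a * b) = sqmod a * sqmod b.
Proof. by case: a b => a1 a2 [b1 b2]; rewrite !sqmodE/=; ring. Qed.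

Lemma sqmodD a b : sqmod (a + b) <= sqmod a + sqmod b + (sqmod a + sqmod b).
Proof.
case: a b => a1 a2 [b1 b2]; rewrite !sqmodE/=.
have := sqr_ge0 (a1 - b1); have := sqr_ge0 (a2 - b2); nra.
Qed.

Lemma sqmod0 : sqmod (0 : R[i]) = 0.
Proof. by rewrite sqmodE/= expr0n addr0. Qed.

Lemma cmeasurableD d (T : measurableType d) (f g : T -> R[i]) :
  cmeasurable f -> cmeasurable g -> cmeasurable (fun x => f x + g x).
Proof.
move=> [f1 f2] [g1 g2]; split.
- rewrite [X in measurable_fun _ X](_ : _ = (fun x => Re (f x)) \+ (fun x => Re (g x))).
    exact: measurable_funD.
  by apply/funext => x /=; rewrite raddfD.
- rewrite [X in measurable_fun _ X](_ : _ = (fun x => Im (f x)) \+ (fun x => Im (g x))).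
    exact: measurable_funD.
  by apply/funext => x /=; rewrite raddfD.
Qed.

Lemma cmeasurableM d (T : measurableType d) (f g : T -> R[i]) :
  cmeasurable f -> cmeasurable g -> cmeasurable (fun x => f x * g x).
Proof.
move=> [f1 f2] [g1 g2]; split.
- rewrite [X in measurable_fun _ X](_ : _ =
    (fun x => Re (f x) * Re (g x)) \- (fun x => Im (f x) * Im (g x))).
    by apply: measurable_funB; exact: measurable_funM.
  by apply/funext => x /=; case: (f x) (g x) => ? ? [].
- rewrite [X in measurable_fun _ X](_ : _ =
    (fun x => Re (f x) * Im (g x)) \+ (fun x => Im (f x) * Re (g x))).
    by apply: measurable_funD; exact: measurable_funM.
  by apply/funext => x /=; case: (f x) (g x) => ? ? [].
Qed.

Lemma cmeasurable_cst d (T : measurableType d) z :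
  cmeasurable (fun _ : T => z).
Proof. by split; exact: measurable_cst. Qed.

Lemma cmeasurable_comp d d' (T : measurableType d) (T' : measurableType d')
    (f : T' -> R[i]) (g : T -> T') : measurable_fun setT g ->
  cmeasurable f -> cmeasurable (fun x => f (g x)).
Proof. by move=> mg [f1 f2]; split; [exact: (measurableT_comp f1)|exact: (measurableT_comp f2)]. Qed.

Lemma measurable_sqmod d (T : measurableType d) (f : T -> R[i]) :
  cmeasurable f -> measurable_fun setT (fun x => sqmod (f x)).
Proof.
move=> [f1 f2]; rewrite (_ : (fun x => sqmod (f x)) =
  (fun x => Re (f x) ^+ 2) \+ (fun x => Im (f x) ^+ 2)); last first.
  by apply/funext => x; rewrite sqmodE.
by apply: measurable_funD; exact: measurable_funX.
Qed.

End SqMod.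

Section EsumCountable.
Context {R : realType} {W : countType}.
Local Open Scope ereal_scope.

Lemma esum_countable (a : W -> \bar R) : (forall w, 0 <= a w) ->
  \esum_(w in setT) a w = \sum_(k <oo) oapp a 0 (pickle_inv k).
Proof.
move=> a0; rewrite nneseries_esumT; last by move=> k; case: pickle_inv => /=.
transitivity (\esum_(k in range (@pickle W)) oapp a 0 (pickle_inv k)).
  rewrite (reindex_esum setT _ (@pickle W)).
    by apply: eq_esum => w _; rewrite pickleK_inv.
  by split=> // x y _ _; exact: (pcan_inj pickleK_inv).
rewrite esum_mkcond; apply: eq_esum => k _; case: ifPn => //.
rewrite notin_setE => nk; case E: (pickle_inv k) => [w|]//=.
by exfalso; apply: nk; exists w => //; have := @pickle_invK W k; rewrite /ocancel E.
Qed.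

Lemma measurable_esum d (T : measurableType d) (f : T -> W -> \bar R) :
  (forall x w, 0 <= f x w) -> (forall w, measurable_fun setT (f ^~ w)) ->
  measurable_fun setT (fun x => \esum_(w in setT) f x w).
Proof.
move=> f0 mf; under eq_fun => x do rewrite esum_countable//.
apply: ge0_emeasurable_sum => [k x _ _|k _]; first by case: pickle_inv => /=.
by case: pickle_inv => [w|] //=.
Qed.

Lemma esumZl (c : R) (a : W -> \bar R) : (0 <= c)%R -> (forall w, 0 <= a w) ->
  \esum_(w in setT) (c%:E * a w) = c%:E * \esum_(w in setT) a w.
Proof.
move=> c0 a0; rewrite !esum_countable//; last by move=> w; rewrite mule_ge0.
rewrite -nneseriesZl//; last by move=> k _; case: pickle_inv => /=.
by apply: eq_eseriesr => k _; case: pickle_inv => //=; rewrite mule0.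
Qed.

End EsumCountable.

Section SquareIntegrable.
Context (R : realType) (U : countType).
Local Notation pt := (measurableTypeR R).
Local Notation letter := (U + U)%type.

(* The copy u' of u is [inl u] and u'' is [inr u].  The Hilbert space G is
   l^2(letter), so that G^{(x) n} is l^2(letter^n); [F n x w] is the coordinate
   of F_n(x) on e(w_1) (x) ... (x) e(w_n), for x in I^{n+1}.  The component of
   index 0 has a single coordinate and is an element of L^2(I). *)
Definition fock_field : Type :=
  forall n, n.+1.-tuple pt -> n.-tuple letter -> R[i].

Definition fibre_sqnorm (F : fock_field) n (x : n.+1.-tuple pt) : \bar R :=
  \esum_(w in [set: n.-tuple letter]) (sqmod (F n x w))%:E.

Definition fock_sqnorm (F : fock_field) : \bar R :=
  (\sum_(n <oo) \int[cube R n.+1]_x fibre_sqnorm F x)%E.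

(* As G^{(x) n} is separable, strong measurability is measurability of every
   coordinate. *)
Definition square_integrable (F : fock_field) : Prop :=
  (forall n w, cmeasurable (fun x : n.+1.-tuple pt => F n x w)) /\
  (fock_sqnorm F < +oo)%E.

Lemma fibre_sqnorm_ge0 F n (x : n.+1.-tuple pt) : (0 <= fibre_sqnorm F x)%E.
Proof. by apply: esum_ge0 => w _; rewrite lee_fin sqmod_ge0. Qed.

Lemma measurable_fibre_sqnorm F n :
  (forall w, cmeasurable (fun x : n.+1.-tuple pt => F n x w)) ->
  measurable_fun setT (fun x : n.+1.-tuple pt => fibre_sqnorm F x).
Proof.
move=> mF; apply: measurable_esum => [x w|w]; first by rewrite lee_fin sqmod_ge0.
by apply/measurable_EFinP; exact: measurable_sqmod.
Qed.

Definition field0 : fock_field := fun _ _ _ => 0.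
Definition fieldD (F G : fock_field) : fock_field :=
  fun n x w => F n x w + G n x w.
Definition fieldZ (c : R[i]) (F : fock_field) : fock_field :=
  fun n x w => c * F n x w.

Lemma square_integrable0 : square_integrable field0.
Proof.
split=> [n w|]; first exact: cmeasurable_cst.
rewrite /fock_sqnorm eseries0 ?ltry// => n _ _.
rewrite (eq_integral (cst 0%E)) ?integral0// => x _.
by rewrite /fibre_sqnorm esum1// => w _; rewrite sqmod0.
Qed.

Lemma square_integrableD F G :
  square_integrable F -> square_integrable G -> square_integrable (fieldD F G).
Proof.
move=> [mF F2] [mG G2]; split=> [n w|]; first exact: cmeasurableD.
pose S n x := (fibre_sqnorm F x + @fibre_sqnorm G n x)%E.
have S0 n x : (0 <= S n x)%E by rewrite adde_ge0// fibre_sqnorm_ge0.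
have mS n : measurable_fun setT (S n).
  by apply: emeasurable_funD; exact: measurable_fibre_sqnorm.
have IS n : (\int[cube R n.+1]_x S n x = \int[cube R n.+1]_x fibre_sqnorm F x +
    \int[cube R n.+1]_x fibre_sqnorm G x)%E.
  apply: ge0_integralD => //.
  - by move=> x _; exact: fibre_sqnorm_ge0.
  - exact: measurable_fibre_sqnorm.
  - by move=> x _; exact: fibre_sqnorm_ge0.
  - exact: measurable_fibre_sqnorm.
have ISS n : (\int[cube R n.+1]_x (S n x + S n x) =
    \int[cube R n.+1]_x S n x + \int[cube R n.+1]_x S n x)%E.
  by apply: ge0_integralD => //; exact: mS.
apply: (@le_lt_trans _ _ (\sum_(n <oo) \int[cube R n.+1]_x (S n x + S n x))%E).
  apply: lee_nneseries => n; first by move=> _ _; apply: integral_ge0 => x _; exact: fibre_sqnorm_ge0.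
  move=> _; apply: ge0_le_integral => //=.
  - by move=> x _; exact: fibre_sqnorm_ge0.
  - by apply: measurable_fibre_sqnorm => w; exact: cmeasurableD.
  - by apply: emeasurable_funD; exact: mS.
  - move=> x _; rewrite /S /fibre_sqnorm.
    rewrite -!esumD => [|w _|w _|w _|w _]; rewrite ?adde_ge0 ?lee_fin ?sqmod_ge0//.
    by apply: le_esum => w _; rewrite -!EFinD lee_fin sqmodD.
have -> : (\sum_(n <oo) \int[cube R n.+1]_x (S n x + S n x) =
    (fock_sqnorm F + fock_sqnorm G) + (fock_sqnorm F + fock_sqnorm G))%E.
  rewrite /fock_sqnorm -!nneseriesD => [|n _ _|n _ _|n _ _|n _ _]; last 4 first.
  - by apply: adde_ge0; apply: integral_ge0 => x _; exact: fibre_sqnorm_ge0.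
  - by apply: adde_ge0; apply: integral_ge0 => x _; exact: fibre_sqnorm_ge0.
  - by apply: integral_ge0 => x _; exact: fibre_sqnorm_ge0.
  - by apply: integral_ge0 => x _; exact: fibre_sqnorm_ge0.
  by apply: eq_eseriesr => n _; rewrite ISS IS.
have FG := lte_add_pinfty F2 G2.
exact: (lte_add_pinfty FG FG).
Qed.

Lemma square_integrableZ c F :
  square_integrable F -> square_integrable (fieldZ c F).
Proof.
move=> [mF F2]; split=> [n w|].
  by apply: cmeasurableM => //; exact: cmeasurable_cst.
rewrite (_ : fock_sqnorm _ = (sqmod c)%:E * fock_sqnorm F)%E.
  by rewrite lte_mul_pinfty// ?lee_fin ?sqmod_ge0.
rewrite /fock_sqnorm -nneseriesZl; last first.
  by move=> n _; apply: integral_ge0 => x _; exact: fibre_sqnorm_ge0.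
apply: eq_eseriesr => n _; rewrite -ge0_integralZl//=.
- apply: eq_integral => x _; rewrite /fibre_sqnorm -esumZl ?sqmod_ge0//.
    by apply: eq_esum => w _; rewrite -EFinM sqmodM.
  by move=> w; rewrite lee_fin sqmod_ge0.
- exact: measurable_fibre_sqnorm.
- by move=> x _; exact: fibre_sqnorm_ge0.
- by rewrite lee_fin sqmod_ge0.
Qed.


Record l2_field : Type := L2Field {
  l2_val :> forall n, n.+1.-tuple pt -> n.-tuple letter -> R[i];
  l2P : square_integrable l2_val }.

HB.instance Definition _ := gen_eqMixin l2_field.
HB.instance Definition _ := gen_choiceMixin l2_field.

Definition l2_eq (F G : l2_field) : bool :=
  `[< forall n, ae_eq (cube R n.+1) setT (F n) (G n) >].

Lemma l2_eq_refl : reflexive l2_eq.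
Proof. by move=> F; apply/asboolP => n; exact: ae_eq_refl. Qed.

Lemma l2_eq_sym : symmetric l2_eq.
Proof.
by move=> F G; apply/idP/idP => /asboolP FG; apply/asboolP => n; exact: ae_eq_sym.
Qed.

Lemma l2_eq_trans : transitive l2_eq.
Proof.
move=> G F H /asboolP FG /asboolP GH; apply/asboolP => n.
exact: (ae_eq_trans (FG n) (GH n)).
Qed.

Canonical l2_eq_equiv := EquivRel l2_eq l2_eq_refl l2_eq_sym l2_eq_trans.

Local Open Scope quotient_scope.

Definition fock : Type := {eq_quot l2_eq}.
HB.instance Definition _ := Choice.on fock.
HB.instance Definition _ := EqQuotient.on fock.

Definition l2_0 := L2Field square_integrable0.
Definition l2_add (F G : l2_field) := L2Field (square_integrableD (l2P F) (l2P G)).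
Definition l2_scale (c : R[i]) (F : l2_field) := L2Field (square_integrableZ c (l2P F)).

Lemma l2_addE F G n x w : l2_add F G n x w = F n x w + G n x w.
Proof. by []. Qed.

Lemma l2_scaleE c F n x w : l2_scale c F n x w = c * F n x w.
Proof. by []. Qed.

Definition fock_zero : fock := \pi_fock l2_0.
Definition fock_add (a b : fock) : fock := \pi_fock (l2_add (repr a) (repr b)).
Definition fock_scale (c : R[i]) (a : fock) : fock := \pi_fock (l2_scale c (repr a)).
Definition fock_opp : fock -> fock := fock_scale (-1).

Lemma l2_eqP (F G : l2_field) :
  (forall n, ae_eq (cube R n.+1) setT (F n) (G n)) <-> F = G %[mod fock].
Proof.
split=> [FG|/eqP]; first by apply/eqmodP/asboolP.
by rewrite eqmodE => /asboolP.
Qed.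

Lemma l2_repr (F : l2_field) n :
  ae_eq (cube R n.+1) setT ((repr (\pi_fock F) : l2_field) n) (F n).
Proof. by move: n; apply/l2_eqP; rewrite reprK. Qed.

Lemma fock_addE (F G : l2_field) :
  fock_add (\pi_fock F) (\pi_fock G) = \pi_fock (l2_add F G).
Proof.
apply/l2_eqP => n; have := l2_repr F n; have := l2_repr G n.
by apply: filterS2 => x hG hF xT /=; rewrite /fieldD hF// hG.
Qed.

Lemma fock_scaleE c (F : l2_field) :
  fock_scale c (\pi_fock F) = \pi_fock (l2_scale c F).
Proof.
apply/l2_eqP => n; have := l2_repr F n.
by apply: filterS => x hF xT /=; rewrite /fieldZ hF.
Qed.

Lemma l2_ext (F G : l2_field) : (forall n x w, F n x w = G n x w) ->
  \pi_fock F = \pi_fock G.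
Proof.
move=> FG; apply/l2_eqP => n; apply: aeW => x _.
by apply/funext => w; exact: FG.
Qed.

Lemma fock_addA : associative fock_add.
Proof.
elim/quotW => F; elim/quotW => G; elim/quotW => H.
rewrite (fock_addE G H) (fock_addE F) (fock_addE F G) (fock_addE _ H).
by apply: l2_ext => n x w; rewrite !(l2_addE, l2_scaleE) addrA.
Qed.

Lemma fock_addC : commutative fock_add.
Proof.
elim/quotW => F; elim/quotW => G.
rewrite (fock_addE F G) (fock_addE G F).
by apply: l2_ext => n x w; rewrite !(l2_addE, l2_scaleE) addrC.
Qed.

Lemma fock_add0 : left_id fock_zero fock_add.
Proof.
elim/quotW => F; rewrite (fock_addE l2_0 F).
by apply: l2_ext => n x w; rewrite !(l2_addE, l2_scaleE) add0r.
Qed.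

Lemma fock_addN : left_inverse fock_zero fock_opp fock_add.
Proof.
elim/quotW => F; rewrite /fock_opp (fock_scaleE _ F) (fock_addE _ F).
by apply: l2_ext => n x w; rewrite l2_addE l2_scaleE mulN1r addNr.
Qed.

HB.instance Definition _ := GRing.isZmodule.Build fock
  fock_addA fock_addC fock_add0 fock_addN.

Lemma fock_scaleA c d a : fock_scale c (fock_scale d a) = fock_scale (c * d) a.
Proof.
elim/quotW: a => F.
rewrite (fock_scaleE d F) (fock_scaleE c) (fock_scaleE _ F).
by apply: l2_ext => n x w; rewrite !(l2_addE, l2_scaleE) mulrA.
Qed.

Lemma fock_scale1 : left_id 1 fock_scale.
Proof.
elim/quotW => F; rewrite (fock_scaleE _ F).
by apply: l2_ext => n x w; rewrite !(l2_addE, l2_scaleE) mul1r.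
Qed.

Lemma fock_scaleDr : right_distributive fock_scale +%R.
Proof.
move=> c; elim/quotW => F; elim/quotW => G.
rewrite /GRing.add/= (fock_addE F G) (fock_scaleE c) (fock_scaleE c F).
rewrite (fock_scaleE c G) fock_addE.
by apply: l2_ext => n x w; rewrite !(l2_addE, l2_scaleE) mulrDr.
Qed.

Lemma fock_scaleDl a : {morph fock_scale^~ a : c d / c + d}.
Proof.
move=> c d; elim/quotW: a => F.
rewrite [RHS]/GRing.add/= !(fock_scaleE _ F) fock_addE.
by apply: l2_ext => n x w; rewrite !(l2_addE, l2_scaleE) mulrDl.
Qed.

HB.instance Definition _ := GRing.Zmodule_isLmodule.Build R[i] fock
  fock_scaleA fock_scale1 fock_scaleDr fock_scaleDl.

(* Inner product, linear in the first variable; it does not depend on the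
   representatives. *)
Definition inner (a b : fock) : R[i] :=
  csum (fun n => cintegral (cube R n.+1) (fun x =>
    csum (fun w : n.-tuple letter =>
      (repr a : l2_field) n x w * ((repr b : l2_field) n x w)^*))).

(* The adjoint of an everywhere defined operator on H, that is, the unique T^*
   with <T a, b> = <a, T^* b> (and 0 if there is none). *)
Definition adjoint (T : fock -> fock) : fock -> fock :=
  xget (fun=> 0) [set S | forall a b, inner (T a) b = inner a (S b)].

End SquareIntegrable.

(* Bounded measurable representatives of the elements of L^oo(I^2). *)
Record linfty (R : realType) : Type := Linfty {
  linf_val :> measurableTypeR R -> measurableTypeR R -> R[i];
  linf_measurable : cmeasurable
    (fun p : measurableTypeR R * measurableTypeR R => linf_val p.1 p.2);
  linf_bounded : exists M : R, forall x y, `|linf_val x y| <= M%:C }.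

Section Operators.
Context (R : realType) (U : countType).
Local Notation pt := (measurableTypeR R).
Local Notation letter := (U + U)%type.
Local Notation field := (fock_field R U).
Local Notation l2 := (l2_field R U).
Local Notation H := (fock R U).
Local Open Scope quotient_scope.

Definition wp_field (h : linfty R) (v : letter) (F : field) : field := fun n =>
  match n return n.+1.-tuple pt -> n.-tuple letter -> R[i] with
  | 0 => fun _ _ => 0
  | m.+1 => fun x w =>
      if thead w == v then
        h (thead x) (thead (behead_tuple x)) *
          F m (behead_tuple x) (behead_tuple w)
      else 0
  end.

Lemma sqmod_le (z : R[i]) (M : R) : `|z| <= M%:C -> sqmod z <= M ^+ 2.
Proof.
rewrite normc_def lecR sqmodE => zM.
have s0 : 0 <= Re z ^+ 2 + Im z ^+ 2 by rewrite addr_ge0// sqr_ge0.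
by rewrite -[leLHS]sqr_sqrtr// lerXn2r// nnegrE ?sqrtr_ge0// (le_trans _ zM)// sqrtr_ge0.
Qed.

Lemma measurable_thead n : measurable_fun setT (fun x : n.+1.-tuple pt => thead x).
Proof. exact: measurable_tnth. Qed.

Lemma measurable_behead_tuple n :
  measurable_fun setT (fun x : n.+1.-tuple pt => behead_tuple x).
Proof. exact: measurable_behead. Qed.

Lemma cmeasurable_wp_field h v (F : field) :
  (forall n w, cmeasurable (fun x : n.+1.-tuple pt => F n x w)) ->
  forall n w, cmeasurable (fun x : n.+1.-tuple pt => wp_field h v F x w).
Proof.
move=> mF [|n] w; rewrite /wp_field; first exact: cmeasurable_cst.
case: (thead w == v); last exact: cmeasurable_cst.
apply: cmeasurableM; last first.
  exact: (cmeasurable_comp (@measurable_behead_tuple _) (mF n _)).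
apply: (cmeasurable_comp
  (g := fun x : n.+2.-tuple pt => (thead x, thead (behead_tuple x)))
  _ (linf_measurable h)).
apply/measurable_fun_pair; first exact: measurable_thead.
apply: (measurableT_comp (@measurable_thead n)).
exact: measurable_behead_tuple.
Qed.

Lemma integral_cube_behead n (f : n.+1.-tuple pt -> \bar R) :
  (forall x, 0 <= f x)%E -> measurable_fun setT f ->
  (\int[cube R n.+2]_x f (behead_tuple x) = \int[cube R n.+1]_x f x)%E.
Proof.
move=> f0 mf; rewrite [LHS]ge0_integral_distribution//; last first.
  exact: (measurableT_comp mf (@measurable_behead_tuple _)).
transitivity (\int[@lebI R \x cube R n.+1]_p f p.2)%E.
  by apply: eq_integral => p _ /=; congr f; apply/val_inj.
rewrite fubini_tonelli2//=; last exact: (measurableT_comp mf measurable_snd).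
apply: eq_integral => y _; rewrite /fubini_G/=.
by rewrite integral_cst//= lebI_setT mule1.
Qed.

Lemma fibre_sqnorm_wp (h : linfty R) v (M : R) (F : field) n (x : n.+2.-tuple pt) :
  (forall x y, `|h x y| <= M%:C) ->
  (fibre_sqnorm (wp_field h v F) x <=
    (M ^+ 2)%:E * fibre_sqnorm F (behead_tuple x))%E.
Proof.
move=> hM; rewrite /fibre_sqnorm.
pose A := range (fun w : n.-tuple letter => cons_tuple v w).
rewrite [leLHS](_ : _ = \esum_(w in A) (sqmod (wp_field h v F x w))%:E)%E.
  rewrite (reindex_esum setT _ (fun w : n.-tuple letter => cons_tuple v w)).
    rewrite -esumZl ?sqr_ge0//; last by move=> w; rewrite lee_fin sqmod_ge0.
    apply: le_esum => w _; rewrite /= theadE eqxx sqmodM -EFinM lee_fin.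
    rewrite (_ : behead_tuple (cons_tuple v w) = w); last exact/val_inj.
    by rewrite ler_wpM2r ?sqmod_ge0//; exact: sqmod_le.
  split=> [w _|w w' _ _ /(congr1 val)/= [] /val_inj//|//]; by exists w.
rewrite [RHS]esum_mkcond; apply: eq_esum => w _; case: ifPn => //.
rewrite notin_setE /= => nA; case: eqP => [vw|_]; last by rewrite sqmod0.
exfalso; apply: nA; exists (behead_tuple w) => //.
by apply/val_inj; rewrite [in RHS](tuple_eta w) vw.
Qed.

Lemma square_integrable_wp h v (F : field) :
  square_integrable F -> square_integrable (wp_field h v F).
Proof.
move=> [mF F2]; split; first exact: cmeasurable_wp_field.
have [M hM] := linf_bounded h.
have mwp n : measurable_fun setT
    (fun x : n.+1.-tuple pt => fibre_sqnorm (wp_field h v F) x).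
  by apply: measurable_fibre_sqnorm => w; exact: cmeasurable_wp_field.
have E0 (G : field) n : (0 <= \int[cube R n.+1]_x fibre_sqnorm G x)%E.
  by apply: integral_ge0 => x _; exact: fibre_sqnorm_ge0.
apply: (@le_lt_trans _ _ ((M ^+ 2)%:E * fock_sqnorm F)%E); last first.
  by apply: lte_mul_pinfty => //; rewrite lee_fin sqr_ge0.
rewrite /fock_sqnorm.
pose a n := (\int[cube R n.+1]_x fibre_sqnorm (wp_field h v F) x)%E.
have a0 n : (0 <= a n)%E by exact: E0.
rewrite [leLHS](@nneseries_recl _ xpredT a (fun n _ => a0 n) isT).
rewrite [X in (X + _)%E](_ : _ = 0%E) ?add0e; last first.
  rewrite /a (eq_integral (cst 0%E)) ?integral0// => x _.
  by rewrite /fibre_sqnorm esum1// => w _; rewrite sqmod0.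
rewrite -[leLHS](nneseries_addn 1 a0) -[leRHS]nneseriesZl; last by move=> n _; exact: E0.
apply: lee_nneseries => n; first by move=> _ _; exact: E0.
move=> _; rewrite addn1 /a.
rewrite -(@integral_cube_behead _ (fun x => fibre_sqnorm F x)); last 2 first.
- by move=> x; exact: fibre_sqnorm_ge0.
- by apply: measurable_fibre_sqnorm => w; exact: mF.
have mb : measurable_fun setT
    (fun x : n.+2.-tuple pt => fibre_sqnorm F (behead_tuple x)).
  apply: (measurableT_comp _ (@measurable_behead_tuple _)).
  exact: measurable_fibre_sqnorm.
rewrite -ge0_integralZl//; last 2 first.
- by move=> x _; exact: fibre_sqnorm_ge0.
- by rewrite lee_fin sqr_ge0.
apply: ge0_le_integral => //.
- by move=> x _; exact: fibre_sqnorm_ge0.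
- exact: mwp.
- by apply: emeasurable_funM => //; exact: measurable_cst.
- by move=> x _; exact: fibre_sqnorm_wp.
Qed.

Definition l2_wp h v (F : l2) : l2 := L2Field (square_integrable_wp h v (l2P F)).

Definition wp (h : linfty R) (v : letter) (a : H) : H :=
  \pi_(fock R U) (l2_wp h v (repr a)).

Lemma cube_behead n (A : set (n.+1.-tuple pt)) : measurable A ->
  cube R n.+2 (@behead_tuple n.+2 pt @^-1` A) = cube R n.+1 A.
Proof.
move=> mA; have mB : measurable (@behead_tuple n.+2 pt @^-1` A).
  by rewrite -[X in measurable X]setTI; exact: measurable_behead_tuple.
transitivity (\int[cube R n.+2]_x (\1_(@behead_tuple n.+2 pt @^-1` A) x)%:E)%E.
  by rewrite (integral_indic _ measurableT mB) setIT.
transitivity (\int[cube R n.+1]_x (\1_A x)%:E)%E; last first.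
  by rewrite (integral_indic _ measurableT mA) setIT.
rewrite -(@integral_cube_behead n (fun x => (\1_A x)%:E)); last 2 first.
- by move=> x; rewrite lee_fin indicE.
- by apply/measurable_EFinP; exact: measurable_indic.
by apply: eq_integral => x _; rewrite !indicE.
Qed.

Lemma wpE h v (F : l2) : wp h v (\pi_(fock R U) F) = \pi_(fock R U) (l2_wp h v F).
Proof.
apply/l2_eqP => -[|n]; first exact: aeW.
have [A [mA A0 FA]] := l2_repr F n.
exists (@behead_tuple n.+2 pt @^-1` A); split.
- by rewrite -[X in measurable X]setTI; exact: measurable_behead_tuple.
- exact: (etrans (cube_behead mA) A0).
- move=> x /= nx; apply: FA => /= Fx; apply: nx => _.
  by apply/funext => w /=; rewrite Fx.
Qed.

Definition vac_field : field := fun n _ _ => (n == 0)%:R.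

Lemma square_integrable_vac : square_integrable vac_field.
Proof.
split=> [n w|]; first exact: cmeasurable_cst.
have a0 n : (0 <= \int[cube R n.+1]_x fibre_sqnorm vac_field x)%E.
  by apply: integral_ge0 => x _; exact: fibre_sqnorm_ge0.
rewrite /fock_sqnorm (@nneseries_recl _ xpredT _ (fun n _ => a0 n) isT).
rewrite eseries0 ?adde0; last first.
  case=> // n _ _; rewrite (eq_integral (cst 0%E)) ?integral0// => x _.
  by rewrite /fibre_sqnorm esum1// => w _; rewrite sqmod0.
rewrite (eq_integral (cst 1%E)) => [|x _].
  by rewrite integral_cst// mul1e (le_lt_trans (probability_le1 _ _))// ltry.
rewrite /fibre_sqnorm (_ : [set: _] = [set [tuple]]).
  by rewrite esum_set1 ?lee_fin ?sqmod_ge0// sqmodE/= expr1n expr0n addr0.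
by apply/seteqP; split=> // w _; exact: tuple0.
Qed.

(* The constant function 1, as an element of L^2(I). *)
Definition vac : H := \pi_(fock R U) (L2Field square_integrable_vac).

Definition vac_state (T : H -> H) : R[i] := inner (T vac) vac.

End Operators.

Section Eta.
Context (R : realType) (U : countType).
Local Notation pt := (measurableTypeR R).
Local Notation H := (fock R U).

Definition Delta : set (pt * pt) :=
  [set p | [/\ 0 <= p.1, p.1 < p.2 & p.2 <= 1]].

Lemma measurable_Delta : measurable Delta.
Proof.
have -> : Delta = (fst @^-1` `[0, +oo[) `&`
    [set p : pt * pt | (p.1 : R) < p.2] `&` (snd @^-1` `]-oo, 1]).
  apply/seteqP; split=> [p [p0 p12 p1]|p [[+ p12] +]] /=.
    by rewrite !in_itv/= andbT; split => //; split.
  by rewrite /= !in_itv/= andbT.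
apply: measurableI; first apply: measurableI.
- rewrite -[X in measurable X]setTI.
  by apply: (@measurable_fst _ _ pt pt) => //; exact: measurable_itv.
- rewrite (_ : [set _ | _] = setT `&` [set p : pt * pt | (p.1 : R) < p.2]); last first.
    by rewrite setTI.
  apply: (measurable_fun_ltr _ _ measurableT (Y := [set true])) => //.
- rewrite -[X in measurable X]setTI.
  by apply: (@measurable_snd _ _ pt pt) => //; exact: measurable_itv.
Qed.

Lemma cmeasurable_chi :
  cmeasurable (fun p : pt * pt => (\1_Delta (p.1, p.2) : R)%:C).
Proof.
split=> /=; last exact: measurable_cst.
under eq_fun do rewrite -surjective_pairing.
exact: measurable_indic measurable_Delta.
Qed.

Lemma chi_bounded :
  exists M : R, forall x y : pt, `|(\1_Delta (x, y) : R)%:C| <= M%:C.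
Proof.
exists 1 => x y; rewrite normc_def/= expr0n addr0 sqrtr_sqr lecR.
by rewrite indicE; case: (_ \in _); rewrite ?normr1 ?normr0.
Qed.

Definition chi_Delta : linfty R :=
  Linfty (linf_val := fun x y => (\1_Delta (x, y) : R)%:C)
    cmeasurable_chi chi_bounded.

Lemma cmeasurable_transpose (h : linfty R) :
  cmeasurable (fun p : pt * pt => h p.2 p.1).
Proof.
apply: (cmeasurable_comp (g := fun p : pt * pt => (p.2, p.1)) _ (linf_measurable h)).
exact: measurable_swap.
Qed.

Lemma transpose_bounded (h : linfty R) :
  exists M : R, forall x y : pt, `|h y x| <= M%:C.
Proof. by have [M hM] := linf_bounded h; exists M => x y. Qed.

Definition linf_transpose (h : linfty R) : linfty R :=
  Linfty (linf_val := fun x y => h y x)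
    (cmeasurable_transpose h) (transpose_bounded h).

Definition eta_op (u : U) : H -> H := fun a =>
  wp chi_Delta (inl u) a + adjoint (wp (linf_transpose chi_Delta) (inr u)) a.

(* T^e, where e = true stands for the exponent * and e = false for 1. *)
Definition op_exp (e : bool) (T : H -> H) : H -> H :=
  if e then adjoint T else T.

End Eta.

Section RandomMatrices.
Context {R : realType} {d : measure_display} {T : measurableType d}.
Variable P : probability T R.
Local Open Scope sesquilinear_scope.

Definition mutually_independent (I : choiceType) (G : I -> set (set T)) : Prop :=
  forall (s : seq I) (A : I -> set T), uniq s ->
    (forall i, i \in s -> G i (A i)) ->
    P (\bigcap_(i in [set` s]) A i) = (\prod_(i <- s) P (A i))%E.

Definition sigma_of (K : Type) (X : K -> T -> R) : set (set T) :=
  <<s \bigcup_(k in [set: K]) preimage_set_system setT (X k) measurable >>.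

Definition gaussian_rv (m v : R) (X : T -> R) : Prop :=
  measurable_fun setT X /\
  forall A : set R, measurable A -> P (X @^-1` A) = normal_prob m (Num.sqrt v) A.

(* The n(n-1) indices of the real (false) and imaginary (true) parts of the
   entries above the diagonal. *)
Definition entry_index (n : nat) : Type :=
  ({p : 'I_n * 'I_n | (p.1 < p.2)%N} * bool)%type.
HB.instance Definition _ n := Choice.on (entry_index n).

Definition entry n (Y : T -> 'M[R[i]]_n) (k : entry_index n) (t : T) : R :=
  let: (i, j) := val k.1 in if k.2 then Im (Y t i j) else Re (Y t i j).

Definition independent_sut_gaussian (U : countType) n
    (Y : U -> T -> 'M[R[i]]_n) : Prop :=
  [/\ forall u t (i j : 'I_n), (j <= i)%N -> Y u t i j = 0,
      forall u k, gaussian_rv 0 (2 * n)%:R^-1 (entry (Y u) k),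
      forall u, mutually_independent
        (fun k => sigma_of (fun _ : unit => entry (Y u) k)) &
      mutually_independent (fun u => sigma_of (entry (Y u)))].

Definition cexpectation (X : T -> R[i]) : R[i] :=
  fine 'E_P[fun t => Re (X t)] +i* fine 'E_P[fun t => Im (X t)].

Definition tau n (M : T -> 'M[R[i]]_n) : R[i] :=
  cexpectation (fun t => n%:R^-1 * \tr (M t)).

(* A^e, where e = true stands for the exponent * and e = false for 1. *)
Definition mx_exp n (e : bool) (A : 'M[R[i]]_n) : 'M[R[i]]_n :=
  if e then A ^t* else A.

End RandomMatrices.

(* Main.v *)
(** Fock side: the adjoint of [wp h v] annihilates the first letter, by integrating
   over the first coordinate.  Hence a word in the [eta_op (u k)] and their adjoints,
   applied to the vacuum, has an explicit coordinate recursion [psi]: each factor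
   either removes the first letter, moving back to the previous point, or adds a
   letter, integrating over a new point.

   Matrix side: the normalized trace is a sum over closed walks i, y_1, ..., y_m of
   expectations of products of entries.  An expectation vanishes unless every edge is
   used at least twice, and is O(n^(-m/2)) in any case, so only walks with m/2 + 1
   distinct vertices survive in the limit.  These traverse every edge of a tree exactly
   twice, in opposite directions and with dual letters; they are the walks accepted by a
   pushdown automaton, each contributing exactly n^(-m/2).  The normalized count of
   accepted walks obeys, up to O(1/n), the recursion of [psi] with the integral over
   [0,1] replaced by the mean over n points, and dominated convergence identifies the
   limit. *)
Require Import Defs.
From HB Require Import structures.
From mathcomp Require Import all_boot all_order all_algebra.
From mathcomp Require Import all_classical all_reals all_analysis.
From mathcomp Require Import measurable_realfun.
From mathcomp Require Import complex spectral ring lra zify.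
Set Implicit Arguments.
Unset Strict Implicit.
Unset Printing Implicit Defensive.
Import Order.TTheory GRing.Theory Num.Theory.
Import numFieldNormedType.Exports.
Local Open Scope classical_set_scope.
Local Open Scope ring_scope.
Local Open Scope complex_scope.
Local Notation Re := complex.Re.
Local Notation Im := complex.Im.

(** * The inner product of the Fock space *)

(** Both sides are read from the outermost factor, and both run the same stack. In a Fock
    coordinate, creation pops the top point and its letter, while annihilation pushes a point that
    is integrated over; along a walk, a step to an old vertex pops and a step to a new one pushes.
    Strict triangularity ties the exponent of an entry to the direction in which its edge is
    crossed, so an edge crossed back carries the dual letter, and the pair yields E|a|^2 = 1/n.

    Two obstacles shape the analysis. [adjoint] is a choice among arbitrary maps on classes of
    functions, and [inner] is assembled from real and imaginary parts with [fine]; so biadditivity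
    and definiteness of [inner] come first, and adjoints are identified by uniqueness. Moreover the
    summands over vertices depend on n and on the earlier vertices, and the indicator of the
    triangle jumps on the diagonal. Convergence is therefore proved at distinct points of [0,1) and
    then integrated, under a bound by 2 to the length of the word. *)

Section Real.
Context {R : realType}.

(** [rsum] is fixed by positive and negative parts; any other splitting into nonnegative summable
    families gives the same value. Additivity of [inner] rests on this. *)
Lemma rsumB (T : choiceType) (a b : T -> R) :
  (forall t, 0 <= a t) -> (forall t, 0 <= b t) ->
  (\esum_(t in setT) (a t)%:E < +oo)%E -> (\esum_(t in setT) (b t)%:E < +oo)%E ->
  rsum (fun t => a t - b t) =
  fine (\esum_(t in setT) (a t)%:E)%E - fine (\esum_(t in setT) (b t)%:E)%E.
Proof.
move=> a0 b0 aoo boo.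
have sa : summable setT (EFin \o a).
  by rewrite /summable (eq_esum (b := fun t => (a t)%:E))// => t _ /=; rewrite ger0_norm.
have sb : summable setT (EFin \o b).
  by rewrite /summable (eq_esum (b := fun t => (b t)%:E))// => t _ /=; rewrite ger0_norm.
have fa : (\esum_(t in setT) (a t)%:E)%E \is a fin_num.
  by rewrite ge0_fin_numE// esum_ge0// => t _; rewrite lee_fin.
have fb : (\esum_(t in setT) (b t)%:E)%E \is a fin_num.
  by rewrite ge0_fin_numE// esum_ge0// => t _; rewrite lee_fin.
have a0' t : [set: T] t -> (0 <= (EFin \o a) t)%E by rewrite lee_fin.
have b0' t : [set: T] t -> (0 <= (EFin \o b) t)%E by rewrite lee_fin.
have := esumB sa sb a0' b0'.
pose c t := a t - b t.
have -> : ((EFin \o a) \- (EFin \o b))%E = EFin \o c by [].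
have sab := summableB sa sb.
have fp : (\esum_(t in setT) (EFin \o c)^\+ t)%E \is a fin_num.
  have := summable_funepos sab; rewrite summableE; congr (_ \is a fin_num).
  by apply: eq_esum => t _; rewrite gee0_abs.
have fm : (\esum_(t in setT) (EFin \o c)^\- t)%E \is a fin_num.
  have := summable_funeneg sab; rewrite summableE; congr (_ \is a fin_num).
  by apply: eq_esum => t _; rewrite gee0_abs.
move=> /(congr1 (@fine R)); rewrite fineB// fineB//.
Qed.

Lemma complexD (a b c d : R) : (a + b) +i* (c + d) = a +i* c + b +i* d.
Proof. by []. Qed.

Lemma complexNr (a b : R) : a +i* (- b) = (a +i* b)^*.
Proof. by []. Qed.

Lemma sqmod_eq0 (z : R[i]) : sqmod z = 0 -> z = 0.
Proof.
rewrite sqmodE => /eqP; rewrite paddr_eq0 ?sqr_ge0// !sqrf_eq0 => /andP[a b].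
by apply/eqP; rewrite eq_complex a b.
Qed.

End Real.

(** * Total sums and integrals of families of real functions on the cubes *)

Section FockFunctional.
Context {R : realType} {U : countType}.
Local Notation pt := (measurableTypeR R).
Local Notation letter := (U + U)%type.
Implicit Types f g p q : forall n, n.+1.-tuple pt -> n.-tuple letter -> R.

Lemma fext (V : Type) (f g : forall n, n.+1.-tuple pt -> n.-tuple letter -> V) :
  (forall n x w, f n x w = g n x w) -> f = g.
Proof.
move=> fg; apply: functional_extensionality_dep => n.
by apply/funext => x; apply/funext => w.
Qed.

Definition fmeas f := forall n w, measurable_fun setT (fun x : n.+1.-tuple pt => f n x w).

Definition fsum f n (x : n.+1.-tuple pt) : \bar R :=
  (\esum_(w in [set: n.-tuple letter]) (f n x w)%:E)%E.

(** Two totals are kept: [ftot] in the extended reals, for nonnegative families, where monotonicity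
    and Tonelli need no integrability, and [fint], the signed real number that occurs in [inner]. *)
Definition ftot f : \bar R := locked (\sum_(n <oo) \int[cube R n.+1]_x fsum f x)%E.

Lemma ftotU f : ftot f = (\sum_(n <oo) \int[cube R n.+1]_x fsum f x)%E.
Proof. by rewrite /ftot -lock. Qed.

Definition fint f : R := locked
  (rsum (fun n => \int[cube R n.+1]_x rsum (fun w : n.-tuple letter => f n x w))).

Lemma fintU f : fint f =
  rsum (fun n => \int[cube R n.+1]_x rsum (fun w : n.-tuple letter => f n x w)).
Proof. by rewrite /fint -lock. Qed.

Definition fge0 f := forall n x w, 0 <= f n x w.

Definition fpos f : Prop := [/\ fmeas f, fge0 f & (ftot f < +oo)%E].

Lemma fsum_ge0 f n (x : n.+1.-tuple pt) : fge0 f -> (0 <= fsum f x)%E.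
Proof. by move=> f0; apply: esum_ge0 => w _; rewrite lee_fin. Qed.

Lemma le_fsum f n (x : n.+1.-tuple pt) w : fge0 f -> ((f n x w)%:E <= fsum f x)%E.
Proof.
move=> f0; rewrite -(esum_set1 (a := fun w => (f n x w)%:E)) ?lee_fin//.
rewrite /fsum [leRHS](esumID [set w]) => [|v _]; last by rewrite lee_fin.
by rewrite setTI leeDl// esum_ge0// => v _; rewrite lee_fin.
Qed.

Lemma measurable_fsum f n : fge0 f -> fmeas f -> measurable_fun setT (@fsum f n).
Proof.
move=> f0 mf; apply: measurable_esum => [x w|w]; first by rewrite lee_fin.
by apply/measurable_EFinP; exact: mf.
Qed.

Lemma ftot_ge0 f : fge0 f -> (0 <= ftot f)%E.
Proof.
by move=> f0; rewrite ftotU; apply: nneseries_ge0 => n _ _; apply: integral_ge0 => x _; exact: fsum_ge0.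
Qed.

Lemma fpos_fin_num f : fpos f -> ftot f \is a fin_num.
Proof. by move=> [_ f0 ?]; rewrite ge0_fin_numE// ftot_ge0. Qed.

Lemma fpos_int f n : fpos f -> (\int[cube R n.+1]_x fsum f x < +oo)%E.
Proof.
move=> [mf f0 fo]; apply: le_lt_trans fo.
have a0 k : (0 <= \int[cube R k.+1]_x fsum f x)%E.
  by apply: integral_ge0 => x _; exact: fsum_ge0.
rewrite !ftotU (@nneseriesD1 _ _ n)//; first by rewrite leeDl// nneseries_ge0.
Qed.

Lemma fpos_integrable f n : fpos f -> (cube R n.+1).-integrable setT (@fsum f n).
Proof.
move=> pf; have [mf f0 fo] := pf; apply/integrableP; split; first exact: measurable_fsum.
under eq_integral do rewrite gee0_abs ?fsum_ge0//.
exact: fpos_int.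
Qed.

Lemma measurable_rsum f n : fmeas f ->
  measurable_fun setT (fun x : n.+1.-tuple pt => rsum (fun w : n.-tuple letter => f n x w)).
Proof.
move=> mf.
have mE w : measurable_fun setT (fun x : n.+1.-tuple pt => (f n x w)%:E).
  by apply/measurable_EFinP; exact: mf.
apply: measurable_funB; apply: measurableT_comp => //.
- apply: measurable_esum => [x w|w]; first by [].
  rewrite (_ : (fun x => _) = ((fun x : n.+1.-tuple pt => (f n x w)%:E)^\+)%E).
    exact: measurable_funepos (mE w).
  by apply/funext => x; rewrite !funeposE.
- apply: measurable_esum => [x w|w]; first by [].
  rewrite (_ : (fun x => _) = ((fun x : n.+1.-tuple pt => (f n x w)%:E)^\-)%E).
    exact: measurable_funeneg (mE w).
  by apply/funext => x; rewrite !funenegE.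
Qed.

(** The bridge between the two totals: [rsumB] is applied on the fibres and again over the levels.
    Signed totals are reduced through it to nonnegative ones. *)
Lemma fintB p q : fpos p -> fpos q ->
  fint (fun n x w => p n x w - q n x w) = fine (ftot p) - fine (ftot q).
Proof.
move=> pp pq; have [mp p0 po] := pp; have [mq q0 qo] := pq.
have I n : \int[cube R n.+1]_x rsum (fun w => p n x w - q n x w) =
   fine (\int[cube R n.+1]_x fsum p x)%E - fine (\int[cube R n.+1]_x fsum q x)%E.
  rewrite -fineB; last 2 first.
  - by rewrite ge0_fin_numE ?fpos_int// integral_ge0// => x _; exact: fsum_ge0.
  - by rewrite ge0_fin_numE ?fpos_int// integral_ge0// => x _; exact: fsum_ge0.
  rewrite -integralB//; [|exact: fpos_integrable|exact: fpos_integrable].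
  rewrite /Rintegral; congr fine; apply: ae_eq_integral => //.
  - apply/measurable_EFinP; apply: (measurable_rsum (f := fun n x w => p n x w - q n x w)).
    by move=> k w; apply: measurable_funB; [exact: mp|exact: mq].
  - by apply: emeasurable_funB; exact: measurable_fsum.
  (* The fibre sums are finite only for almost every x, so the inner [rsum] splits only almost
     everywhere. *)
  have ip := integrable_ae measurableT (fpos_integrable n pp).
  have iq := integrable_ae measurableT (fpos_integrable n pq).
  apply: filterS2 ip iq => x /(_ Logic.I) fp /(_ Logic.I) fq _.
  rewrite rsumB//; first by rewrite EFinB !fineK.
  - by move: fp; rewrite ge0_fin_numE// fsum_ge0.
  - by move: fq; rewrite ge0_fin_numE// fsum_ge0.
have E (h : forall n, n.+1.-tuple pt -> n.-tuple letter -> R) : fpos h ->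
   (\esum_(n in [set: nat]) (fine (\int[cube R n.+1]_x fsum h x))%:E = ftot h)%E.
  move=> ph; have [mh h0 ho] := ph.
  have a0 n : (0 <= \int[cube R n.+1]_x fsum h x)%E.
    by apply: integral_ge0 => x _; exact: fsum_ge0.
  rewrite -nneseries_esumT; last by move=> n; rewrite lee_fin fine_ge0.
  by rewrite ftotU; apply: eq_eseriesr => n _; rewrite fineK// ge0_fin_numE// fpos_int.
rewrite !fintU (_ : (fun n => _) = (fun n => fine (\int[cube R n.+1]_x fsum p x)%E -
     fine (\int[cube R n.+1]_x fsum q x)%E)); last by apply/funext => n; exact: I.
have I0 (h : forall n, n.+1.-tuple pt -> n.-tuple letter -> R) n : fge0 h ->
    0 <= fine (\int[cube R n.+1]_x fsum h x)%E.
  by move=> h0; apply: fine_ge0; apply: integral_ge0 => x _; exact: fsum_ge0.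
rewrite rsumB => [|n|n||].
- by rewrite (E p pp) (E q pq).
- exact: I0.
- exact: I0.
- rewrite (E p pp).
  exact po.
- rewrite (E q pq).
  exact qo.
Qed.

Lemma ftotD p q : fmeas p -> fge0 p -> fmeas q -> fge0 q ->
  ftot (fun n x w => p n x w + q n x w) = (ftot p + ftot q)%E.
Proof.
move=> mp p0 mq q0.
have i0 (h : forall n, n.+1.-tuple pt -> n.-tuple letter -> R) n : fge0 h ->
    (0 <= \int[cube R n.+1]_x fsum h x)%E.
  by move=> h0; apply: integral_ge0 => x _; exact: fsum_ge0.
rewrite !ftotU -nneseriesD => [|n _ _|n _ _]; [|exact: i0|exact: i0].
apply: eq_eseriesr => n _; rewrite -ge0_integralD//=.
- apply: eq_integral => x _; rewrite /fsum -esumD => [|w _|w _].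
  + by apply: eq_esum => w _; rewrite EFinD.
  + by rewrite lee_fin.
  + by rewrite lee_fin.
- by move=> x _; exact: fsum_ge0.
- exact: measurable_fsum.
- by move=> x _; exact: fsum_ge0.
- exact: measurable_fsum.
Qed.

Lemma le_ftot p q : fmeas p -> fge0 p -> fmeas q ->
  (forall n x w, p n x w <= q n x w) -> (ftot p <= ftot q)%E.
Proof.
move=> mp p0 mq pq; have q0 : fge0 q by move=> n x w; exact: le_trans (p0 n x w) _.
rewrite !ftotU; apply: lee_nneseries => n; first by move=> _ _; apply: integral_ge0 => x _; exact: fsum_ge0.
move=> _; apply: ge0_le_integral => //.
- by move=> x _; exact: fsum_ge0.
- exact: measurable_fsum.
- exact: measurable_fsum.
- by move=> x _; apply: le_esum => w _; rewrite lee_fin.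
Qed.

Lemma ftot0 : ftot (fun _ _ _ => 0) = 0%E.
Proof.
rewrite !ftotU eseries0// => n _ _; apply: integral0_eq => x _.
by rewrite /fsum esum1.
Qed.

Lemma fpos0 : fpos (fun _ _ _ => 0).
Proof.
split; [by move=> n w; exact: measurable_cst|by move=> n x w|].
by rewrite ftot0 ltry.
Qed.

Lemma fint_ae f g : fmeas f -> fmeas g ->
  (forall n, {ae cube R n.+1, forall x, forall w, f n x w = g n x w}) -> fint f = fint g.
Proof.
move=> mf mg fg; rewrite !fintU; congr rsum; apply/funext => n.
rewrite /Rintegral; congr fine; apply: ae_eq_integral => //.
- by apply/measurable_EFinP; exact: measurable_rsum.
- by apply/measurable_EFinP; exact: measurable_rsum.
apply: filterS (fg n) => x e _; congr (rsum _)%:E; apply/funext => w; exact: e.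
Qed.

Lemma le_ftot_ae p q : fmeas p -> fge0 p -> fmeas q -> fge0 q ->
  (forall n, {ae cube R n.+1, forall x, forall w, p n x w <= q n x w}) ->
  (ftot p <= ftot q)%E.
Proof.
move=> mp p0 mq q0 pq.
rewrite !ftotU; apply: lee_nneseries => n.
  by move=> _ _; apply: integral_ge0 => x _; exact: fsum_ge0.
move=> _; apply: ae_ge0_le_integral => //.
- by move=> x _; exact: fsum_ge0.
- exact: measurable_fsum.
- by move=> x _; exact: fsum_ge0.
- exact: measurable_fsum.
- by apply: filterS (pq n) => x h _; apply: le_esum => w _; rewrite lee_fin.
Qed.

Lemma fposD p q : fpos p -> fpos q -> fpos (fun n x w => p n x w + q n x w).
Proof.
move=> [mp p0 po] [mq q0 qo]; split.
- by move=> n w; apply: measurable_funD; [exact: mp|exact: mq].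
- by move=> n x w; rewrite addr_ge0.
- rewrite (ftotD mp p0 mq q0); exact: lte_add_pinfty po qo.
Qed.

Lemma le_fpos p q : fmeas p -> fge0 p -> (forall n x w, p n x w <= q n x w) ->
  fpos q -> fpos p.
Proof.
move=> mp p0 pq [mq q0 qo]; split; [exact: mp|exact: p0|].
exact: le_lt_trans (le_ftot mp p0 mq pq) qo.
Qed.

Lemma fint_ge0 p : fpos p -> fint p = fine (ftot p).
Proof.
move=> pp; have p0 := fpos0; have := fintB pp p0.
rewrite (_ : (fun n x w => _) = p); last first.
  by apply: fext => n x w; rewrite subr0.
by move=> ->; rewrite ftot0 subr0.
Qed.

Definition fsummable f := fmeas f /\ fpos (fun n x w => `|f n x w|).

Lemma le_fsummable f q : fmeas f -> (forall n x w, `|f n x w| <= q n x w) ->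
  fpos q -> fsummable f.
Proof.
move=> mf fq pq; split; first exact: mf.
apply: le_fpos fq pq; last by move=> n x w; exact: normr_ge0.
by move=> n w; apply: measurableT_comp => //; exact: mf.
Qed.

Lemma fpos_maxr f : fsummable f -> fpos (fun n x w => Num.max (f n x w) 0).
Proof.
move=> [mf pf]; apply: le_fpos pf.
- by move=> n w; apply: measurable_maxr; [exact: mf|exact: measurable_cst].
- by move=> n x w; rewrite le_max lexx orbT.
- by move=> n x w; rewrite ge_max normr_ge0 ler_norm.
Qed.

Lemma fsummableN f : fsummable f -> fsummable (fun n x w => - f n x w).
Proof.
move=> [mf pf]; split.
- by move=> n w; apply: measurableT_comp => //; exact: mf.
- by rewrite (_ : (fun n x w => _) = (fun n x w => `|f n x w|))//;
  apply: fext => n x w; rewrite normrN.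
Qed.

Lemma fintE f : fsummable f -> fint f =
  fine (ftot (fun n x w => Num.max (f n x w) 0)) -
  fine (ftot (fun n x w => Num.max (- f n x w) 0)).
Proof.
move=> sf; rewrite -(fintB (fpos_maxr sf) (fpos_maxr (fsummableN sf))).
congr fint; apply: fext => n x w.
by rewrite -[in X in _ - X]oppr0 -oppr_min opprK addr_max_min addr0.
Qed.

Lemma fintN f : fsummable f -> fint (fun n x w => - f n x w) = - fint f.
Proof.
move=> sf; rewrite (fintE sf) (fintE (fsummableN sf)) opprB; congr (_ - fine (ftot _)).
by apply: fext => n x w; rewrite opprK.
Qed.

Lemma fintD f g : fsummable f -> fsummable g ->
  fint (fun n x w => f n x w + g n x w) = fint f + fint g.
Proof.
move=> sf sg; have [fp fm] := (fpos_maxr sf, fpos_maxr (fsummableN sf)).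
have [gp gm] := (fpos_maxr sg, fpos_maxr (fsummableN sg)).
have := fintB (fposD fp gp) (fposD fm gm).
rewrite (_ : (fun n x w => _) = (fun n x w => f n x w + g n x w)); last first.
  apply: fext => n x w.
  rewrite opprD addrACA -[in X in _ - X]oppr0 -oppr_min opprK addr_max_min addr0.
  by rewrite -[in X in _ - X]oppr0 -oppr_min opprK addr_max_min addr0.
move=> ->; rewrite (fintE sf) (fintE sg).
have [m1 o1 _] := fp; have [m2 o2 _] := fm; have [m3 o3 _] := gp; have [m4 o4 _] := gm.
rewrite (ftotD m1 o1 m3 o3) (ftotD m2 o2 m4 o4).
move: (fpos_fin_num fp) (fpos_fin_num fm) (fpos_fin_num gp) (fpos_fin_num gm).
move: (ftot (fun n x w => Num.max (f n x w) 0)) (ftot (fun n x w => Num.max (g n x w) 0)).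
move: (ftot (fun n x w => Num.max (- f n x w) 0)) (ftot (fun n x w => Num.max (- g n x w) 0)).
by move=> a b c d *; rewrite !fineD//; ring.
Qed.

End FockFunctional.

Section Inner.
Context {R : realType} {U : countType}.
Local Notation pt := (measurableTypeR R).
Local Notation letter := (U + U)%type.
Local Notation l2 := (l2_field R U).
Local Notation H := (fock R U).
Local Open Scope quotient_scope.
Implicit Types F G : l2.

Definition redot F G : forall n, n.+1.-tuple pt -> n.-tuple letter -> R :=
  fun n x w => Re (F n x w * (G n x w)^*).
Definition imdot F G : forall n, n.+1.-tuple pt -> n.-tuple letter -> R :=
  fun n x w => Im (F n x w * (G n x w)^*).

Lemma redotE F G n x w : redot F G x w =
  Re (F n x w) * Re (G n x w) + Im (F n x w) * Im (G n x w).
Proof. by rewrite /redot; case: (F n x w) (G n x w) => a b [c d] /=; ring. Qed.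

Lemma imdotE F G n x w : imdot F G x w =
  Im (F n x w) * Re (G n x w) - Re (F n x w) * Im (G n x w).
Proof. by rewrite /imdot; case: (F n x w) (G n x w) => a b [c d] /=; ring. Qed.

Lemma fpos_sqmod F : fpos (fun n x w => sqmod (F n x w)).
Proof.
have [mF F2] := l2P F; split.
- by move=> n w; exact: measurable_sqmod.
- by move=> n x w; exact: sqmod_ge0.
- by rewrite ftotU; exact: F2.
Qed.

(** By 2|st| <= s^2 + t^2 the product is dominated by |F|^2 + |G|^2 in each coordinate, and that
    total is finite. *)
Lemma fsummable_redot F G : fsummable (redot F G).
Proof.
apply: le_fsummable (fposD (fpos_sqmod F) (fpos_sqmod G)).
  move=> n w; have [mF _] := l2P F; have [mG _] := l2P G.
  rewrite (_ : (fun x => _) = (fun x => Re (F n x w)) \* (fun x => Re (G n x w)) \+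
    (fun x => Im (F n x w)) \* (fun x => Im (G n x w))); last first.
    by apply/funext => x; rewrite redotE.
  have [[? ?] [? ?]] := (mF n w, mG n w).
  by apply: measurable_funD; exact: measurable_funM.
move=> n x w; rewrite redotE !sqmodE ler_norml.
move: (Re _) (Im _) (Re _) (Im _) => a b c d.
have := sqr_ge0 (a - c); have := sqr_ge0 (a + c).
have := sqr_ge0 (b - d); have := sqr_ge0 (b + d); nra.
Qed.

Lemma fsummable_imdot F G : fsummable (imdot F G).
Proof.
apply: le_fsummable (fposD (fpos_sqmod F) (fpos_sqmod G)).
  move=> n w; have [mF _] := l2P F; have [mG _] := l2P G.
  rewrite (_ : (fun x => _) = (fun x => Im (F n x w)) \* (fun x => Re (G n x w)) \-
    (fun x => Re (F n x w)) \* (fun x => Im (G n x w))); last first.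
    by apply/funext => x; rewrite imdotE.
  have [[? ?] [? ?]] := (mF n w, mG n w).
  by apply: measurable_funB; exact: measurable_funM.
move=> n x w; rewrite imdotE !sqmodE ler_norml.
move: (Re _) (Im _) (Re _) (Im _) => a b c d.
have := sqr_ge0 (a - d); have := sqr_ge0 (a + d).
have := sqr_ge0 (b - c); have := sqr_ge0 (b + c); nra.
Qed.

Lemma fint_redot_ae F F' G G' :
  (forall n, ae_eq (cube R n.+1) setT (F n) (F' n)) ->
  (forall n, ae_eq (cube R n.+1) setT (G n) (G' n)) ->
  fint (redot F G) = fint (redot F' G').
Proof.
move=> FF GG; have [m1 _] := fsummable_redot F G; have [m2 _] := fsummable_redot F' G'.
apply: (fint_ae m1 m2) => n; apply: filterS2 (FF n) (GG n) => x h1 h2 w.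
by rewrite /redot h1// h2.
Qed.

Lemma fint_imdot_ae F F' G G' :
  (forall n, ae_eq (cube R n.+1) setT (F n) (F' n)) ->
  (forall n, ae_eq (cube R n.+1) setT (G n) (G' n)) ->
  fint (imdot F G) = fint (imdot F' G').
Proof.
move=> FF GG; have [m1 _] := fsummable_imdot F G; have [m2 _] := fsummable_imdot F' G'.
apply: (fint_ae m1 m2) => n; apply: filterS2 (FF n) (GG n) => x h1 h2 w.
by rewrite /imdot h1// h2.
Qed.

(** [inner] is computed on the chosen representatives of the classes; they agree almost everywhere
    with [F] and [G], so any representatives will do. *)
Lemma inner_pi F G : inner (\pi_H F) (\pi_H G) = fint (redot F G) +i* fint (imdot F G).
Proof.
rewrite -(fint_redot_ae (l2_repr F) (l2_repr G)) -(fint_imdot_ae (l2_repr F) (l2_repr G)).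
by rewrite !fintU.
Qed.

Lemma fint_redotDr F G K :
  fint (redot F (l2_add G K)) = fint (redot F G) + fint (redot F K).
Proof.
rewrite -(fintD (fsummable_redot F G) (fsummable_redot F K)); congr fint.
by apply: fext => n x w; rewrite !redotE l2_addE !raddfD /=; ring.
Qed.

Lemma fint_imdotDr F G K :
  fint (imdot F (l2_add G K)) = fint (imdot F G) + fint (imdot F K).
Proof.
rewrite -(fintD (fsummable_imdot F G) (fsummable_imdot F K)); congr fint.
by apply: fext => n x w; rewrite !imdotE l2_addE !raddfD /=; ring.
Qed.

Lemma innerDr (a b c : H) : inner a (b + c) = inner a b + inner a c.
Proof.
elim/quotW: a => F; elim/quotW: b => G; elim/quotW: c => K.
rewrite [_ + _](fock_addE G K) !inner_pi fint_redotDr fint_imdotDr.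
exact: complexD.
Qed.

Lemma fint_redotC F G : fint (redot F G) = fint (redot G F).
Proof. by congr fint; apply: fext => n x w; rewrite !redotE; ring. Qed.

Lemma fint_imdotC F G : fint (imdot F G) = - fint (imdot G F).
Proof.
rewrite -(fintN (fsummable_imdot G F)); congr fint.
by apply: fext => n x w; rewrite !imdotE; ring.
Qed.

Lemma inner_conj (a b : H) : inner a b = (inner b a)^*.
Proof.
elim/quotW: a => F; elim/quotW: b => G; rewrite !inner_pi.
rewrite fint_redotC fint_imdotC.
exact: complexNr.
Qed.

Lemma innerDl (a b c : H) : inner (a + b) c = inner a c + inner b c.
Proof. by rewrite inner_conj innerDr rmorphD /= (inner_conj a) (inner_conj b). Qed.

Lemma innerN (a b : H) : inner a (- b) = - inner a b.
Proof.
have i0 : inner a 0 = 0 by apply: (@addrI _ (inner a 0)); rewrite -innerDr !addr0.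
by apply/eqP; rewrite -addr_eq0 -innerDr addNr i0.
Qed.

(** A vanishing nonnegative total makes every fibre sum vanish almost everywhere, and a fibre sum
    bounds each of its terms. Definiteness is what makes an adjoint unique. *)
Lemma inner_eq0 (a : H) : inner a a = 0 -> a = 0.
Proof.
elim/quotW: a => F; rewrite inner_pi => -[+ _].
rewrite (_ : redot F F = fun n x w => sqmod (F n x w)); last first.
  by apply: fext => n x w; rewrite redotE sqmodE !expr2.
rewrite (fint_ge0 (fpos_sqmod F)) => F0.
have [mF s0 _] := fpos_sqmod F.
have t0 : ftot (fun n x w => sqmod (F n x w)) = 0%E.
  by rewrite -[LHS](fineK (fpos_fin_num (fpos_sqmod F))) F0.
apply/l2_eqP => n.
have i0 : (\int[cube R n.+1]_x fsum (fun n x w => sqmod (F n x w)) x = 0)%E.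
  apply/eqP; rewrite eq_le; apply/andP; split.
    rewrite -t0 !ftotU (@nneseriesD1 _ _ n)//.
    + by rewrite leeDl// nneseries_ge0// => k _ _; apply: integral_ge0 => x _; exact: fsum_ge0.
    + by move=> k _; apply: integral_ge0 => x _; exact: fsum_ge0.
  by apply: integral_ge0 => x _; exact: fsum_ge0.
have /ae_eq_integral_abs : (\int[cube R n.+1]_x `|fsum (fun n x w => sqmod (F n x w)) x| = 0)%E.
  by under eq_integral do rewrite gee0_abs ?fsum_ge0//.
move=> /(_ measurableT (measurable_fsum s0 mF)); apply: filterS => x /(_ Logic.I) /= e _.
apply/funext => w /=; apply: sqmod_eq0; apply/eqP; rewrite eq_le sqmod_ge0 andbT.
by have := le_fsum x w s0; rewrite e lee_fin.
Qed.
End Inner.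

(** * Annihilation operators *)

Section Annihilation.
Context {R : realType} {U : countType}.
Local Notation pt := (measurableTypeR R).
Local Notation letter := (U + U)%type.
Implicit Types f g p q : forall n, n.+1.-tuple pt -> n.-tuple letter -> R.
Implicit Types v : letter.

Lemma integral_esum (W : countType) d (T : measurableType d)
    (mu : {measure set T -> \bar R}) (f : T -> W -> \bar R) :
  (forall x w, 0 <= f x w)%E -> (forall w, measurable_fun setT (f ^~ w)) ->
  (\int[mu]_x (\esum_(w in setT) f x w) = \esum_(w in setT) (\int[mu]_x f x w))%E.
Proof.
move=> f0 mf.
rewrite esum_countable; last by move=> w; apply: integral_ge0.
transitivity (\int[mu]_x (\sum_(k <oo) oapp (f x) 0 (pickle_inv k)))%E.
  by apply: eq_integral => x _; rewrite esum_countable.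
rewrite integral_nneseries//.
- by apply: eq_eseriesr => k _; case: pickle_inv => //=; rewrite integral0.
- by move=> k; case: pickle_inv => [w|] //=.
- by move=> k x _; case: pickle_inv => /=.
Qed.

Lemma ge0_integral_cubeS n (f : n.+1.-tuple pt -> \bar R) :
  (forall x, 0 <= f x)%E -> measurable_fun setT f ->
  (\int[cube R n.+1]_x f x = \int[cube R n]_x \int[@lebI R]_y f (cons_pt (y, x)))%E.
Proof.
move=> f0 mf; rewrite [LHS]ge0_integral_distribution// fubini_tonelli2//.
  exact: (measurableT_comp mf (@measurable_cons_pt R n)).
by move=> x; exact: f0.
Qed.

Lemma measurable_integral_cons n (f : n.+1.-tuple pt -> \bar R) :
  (forall x, 0 <= f x)%E -> measurable_fun setT f ->
  measurable_fun setT (fun x : n.-tuple pt => \int[@lebI R]_y f (cons_pt (y, x)))%E.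
Proof.
move=> f0 mf.
apply: (@measurable_fun_fubini_tonelli_G _ _ _ _ _ (@lebI R) (fun z => f (cons_pt z))) => //.
exact: (measurableT_comp mf (@measurable_cons_pt R n)).
Qed.

(* Tonelli makes [fann v] preserve the total integral of the part [frestr v f] of [f]
   supported on words with first letter [v]: this is what turns creation into
   annihilation under the inner product. *)
Definition frestr v f : forall n, n.+1.-tuple pt -> n.-tuple letter -> R := fun n =>
  match n return n.+1.-tuple pt -> n.-tuple letter -> R with
  | 0 => fun _ _ => 0
  | m.+1 => fun x w => if thead w == v then f m.+1 x w else 0
  end.

Definition fann v f : forall n, n.+1.-tuple pt -> n.-tuple letter -> R :=
  fun n x w => \int[@lebI R]_y f n.+1 (cons_pt (y, x)) (cons_tuple v w).

Lemma measurable_cons_section n (x : n.-tuple pt) :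
  measurable_fun setT (fun y : pt => cons_pt (y, x)).
Proof. exact: (measurableT_comp (@measurable_cons_pt R n) (measurable_pair2 x)). Qed.

Lemma fmeas_cons v f n (x : n.+1.-tuple pt) w : fmeas f ->
  measurable_fun setT (fun y : pt => f n.+1 (cons_pt (y, x)) (cons_tuple v w)).
Proof. by move=> mf; exact: (measurableT_comp (mf n.+1 _) (measurable_cons_section x)). Qed.

Lemma fmeas_frestr v f : fmeas f -> fmeas (frestr v f).
Proof.
move=> mf [|n] w /=; first exact: measurable_cst.
by case: eqP => _; [exact: mf|exact: measurable_cst].
Qed.

Lemma fge0_frestr v f : fge0 f -> fge0 (frestr v f).
Proof. by move=> f0 [|n] x w //=; case: eqP. Qed.

Lemma fpos_frestr v f : fpos f -> fpos (frestr v f).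
Proof.
move=> pf; have [mf f0 _] := pf; apply: le_fpos pf.
- exact: fmeas_frestr.
- exact: fge0_frestr.
- by move=> [|n] x w /=; [exact: f0|case: eqP => // _; exact: f0].
Qed.

Lemma fsum_frestr v p n (x : n.+2.-tuple pt) : fge0 p ->
  fsum (frestr v p) x =
  (\esum_(w in [set: n.-tuple letter]) (p n.+1 x (cons_tuple v w))%:E)%E.
Proof.
move=> p0; rewrite /fsum.
pose A := range (fun w : n.-tuple letter => cons_tuple v w).
transitivity (\esum_(w in A) (frestr v p x w)%:E)%E.
  rewrite [RHS]esum_mkcond; apply: eq_esum => w _; case: ifPn => //.
  rewrite notin_setE /= => nA; case: eqP => [vw|_] //.
  exfalso; apply: nA; exists (behead_tuple w) => //.
  by apply/val_inj; rewrite [in RHS](tuple_eta w) vw.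
rewrite (reindex_esum setT _ (fun w : n.-tuple letter => cons_tuple v w)).
  by apply: eq_esum => w _ /=; rewrite theadE eqxx.
split=> [w _|w w' _ _ /(congr1 val)/= [] /val_inj//|//]; by exists w.
Qed.

Lemma int_fsum_frestr v p n : fmeas p -> fge0 p ->
  (\int[cube R n.+2]_x fsum (frestr v p) x = \int[cube R n.+1]_x
   \esum_(w in [set: n.-tuple letter])
     \int[@lebI R]_y (p n.+1 (cons_pt (y, x)) (cons_tuple v w))%:E)%E.
Proof.
move=> mp p0; rewrite ge0_integral_cubeS; last 2 first.
- by move=> x; apply: fsum_ge0; exact: fge0_frestr.
- by apply: measurable_fsum; [exact: fge0_frestr|exact: fmeas_frestr].
apply: eq_integral => x _; rewrite -integral_esum; last 2 first.
- by move=> y w; rewrite lee_fin.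
- by move=> w; apply/measurable_EFinP; exact: fmeas_cons.
by apply: eq_integral => y _; exact: fsum_frestr.
Qed.

(** By Tonelli these integrals, summed over w and integrated over x, give a finite number. [fann]
    takes [fine], which sends an infinite integral to 0, so its identities are available only where
    the integrals are finite. *)
Lemma ae_fann_fin v p n : fpos p ->
  {ae cube R n.+1, forall x, forall w : n.-tuple letter,
    \int[@lebI R]_y (p n.+1 (cons_pt (y, x)) (cons_tuple v w))%:E < +oo}%E.
Proof.
move=> pp; have [mp p0 _] := pp.
have := fpos_int n.+1 (fpos_frestr v pp); rewrite (int_fsum_frestr _ _ mp p0) => fo.
pose S (x : n.+1.-tuple pt) := (\esum_(w in [set: n.-tuple letter])
     \int[@lebI R]_y (p n.+1 (cons_pt (y, x)) (cons_tuple v w))%:E)%E.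
have i0 x w : (0 <= \int[@lebI R]_y (p n.+1 (cons_pt (y, x)) (cons_tuple v w))%:E)%E.
  by apply: integral_ge0 => y _; rewrite lee_fin.
have S0 x : (0 <= S x)%E by apply: esum_ge0.
have iS : (cube R n.+1).-integrable setT S.
  apply/integrableP; split; last by under eq_integral do rewrite gee0_abs//.
  apply: measurable_esum => // w.
  apply: (@measurable_integral_cons n.+1 (fun z => (p n.+1 z (cons_tuple v w))%:E)).
    by move=> z; rewrite lee_fin.
  by apply/measurable_EFinP; exact: mp.
apply: filterS (integrable_ae measurableT iS) => x /(_ Logic.I) Sx w.
apply: le_lt_trans (_ : S x < +oo)%E; last by rewrite -ge0_fin_numE.
rewrite /S (esumID [set w]) => [|v' _]; last exact: i0.
by rewrite setTI esum_set1// leeDl// esum_ge0.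
Qed.

Lemma fmeas_fann v f : fmeas f -> fmeas (fann v f).
Proof.
move=> mf n w.
pose k (z : n.+2.-tuple pt) := (f n.+1 z (cons_tuple v w))%:E.
have mk : measurable_fun setT k by apply/measurable_EFinP; exact: mf.
(* Tonelli makes parameter integrals measurable for nonnegative integrands, hence the split into
   positive and negative parts. *)
rewrite (_ : (fun x => _) = fun x : n.+1.-tuple pt =>
  fine (\int[@lebI R]_y k^\+ (cons_pt (y, x)) - \int[@lebI R]_y k^\- (cons_pt (y, x)))%E).
  apply: measurableT_comp => //; apply: emeasurable_funB; apply: measurable_integral_cons => //.
  - exact: measurable_funepos.
  - exact: measurable_funeneg.
apply/funext => x; rewrite /fann /Rintegral integralE; congr (fine (_ - _)%E);
  by apply: eq_integral => y _; rewrite ?funeposE ?funenegE.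
Qed.

Lemma fge0_fann v f : fge0 f -> fge0 (fann v f).
Proof. by move=> f0 n x w; apply: Rintegral_ge0 => y _; exact: f0. Qed.

Lemma ftot_fann v p : fpos p -> ftot (fann v p) = ftot (frestr v p).
Proof.
move=> pp; have [mp p0 _] := pp.
have r0 := fge0_frestr v p0.
have a0 n : (0 <= \int[cube R n.+1]_x fsum (frestr v p) x)%E.
  by apply: integral_ge0 => x _; exact: fsum_ge0.
rewrite !ftotU [RHS](@nneseries_recl _ xpredT _ (fun n _ => a0 n) isT).
rewrite [X in (X + _)%E](_ : _ = 0%E) ?add0e; last first.
  by apply: integral0_eq => x _; rewrite /fsum esum1.
rewrite -(nneseries_addn 1 a0); apply: eq_eseriesr => n _; rewrite addn1.
rewrite int_fsum_frestr//; apply: ae_eq_integral => //.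
- by apply: measurable_fsum; [exact: fge0_fann|exact: fmeas_fann].
- apply: measurable_esum => [x w|w].
    by apply: integral_ge0 => y _; rewrite lee_fin.
  apply: (@measurable_integral_cons n.+1 (fun z => (p n.+1 z (cons_tuple v w))%:E)).
    by move=> z; rewrite lee_fin.
  by apply/measurable_EFinP; exact: mp.
apply: filterS (ae_fann_fin v n pp) => x h _; apply: eq_esum => w _.
rewrite /fann /Rintegral fineK// ge0_fin_numE//.
by apply: integral_ge0 => y _; rewrite lee_fin.
Qed.

Lemma fpos_fann v p : fpos p -> fpos (fann v p).
Proof.
move=> pp; have [mp p0 _] := pp; split.
- exact: fmeas_fann.
- exact: fge0_fann.
- by rewrite ftot_fann//; have [] := fpos_frestr v pp.
Qed.

(** [ftot_fann] applied to the positive and negative parts. With [f] a product of two fields, this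
    is the adjoint relation between creation and annihilation. *)
Lemma fint_fann v f : fsummable f -> fint (frestr v f) = fint (fann v f).
Proof.
move=> sf; have [fp fm] := (fpos_maxr sf, fpos_maxr (fsummableN sf)).
transitivity (fine (ftot (fann v (fun n x w => Num.max (f n x w) 0))) -
              fine (ftot (fann v (fun n x w => Num.max (- f n x w) 0)))).
  rewrite !ftot_fann// -fintB; [|exact: fpos_frestr|exact: fpos_frestr].
  congr fint; apply: fext => -[|n] x w /=; first by rewrite subr0.
  case: eqP => _; last by rewrite subr0.
  by rewrite -[in X in _ - X]oppr0 -oppr_min opprK addr_max_min addr0.
have [mf _] := sf; have [m1 _ _] := fpos_fann v fp; have [m2 _ _] := fpos_fann v fm.
rewrite -fintB; [|exact: fpos_fann|exact: fpos_fann].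
apply: fint_ae.
- by move=> n w; apply: measurable_funB; [exact: m1|exact: m2].
- exact: fmeas_fann.
move=> n; apply: filterS2 (ae_fann_fin v n fp) (ae_fann_fin v n fm) => x h1 h2 w.
rewrite /fann /Rintegral [in RHS]integralE -fineB.
- congr (fine (_ - _)%E); apply: eq_integral => y _.
  + by rewrite funeposE /= -EFin_max.
  + by rewrite funenegE /= -EFin_max.
- by rewrite ge0_fin_numE ?h1// integral_ge0// => y _; rewrite lee_fin le_max lexx orbT.
- by rewrite ge0_fin_numE ?h2// integral_ge0// => y _; rewrite lee_fin le_max lexx orbT.
Qed.

(** Integrate 2 m g <= g^2 + m^2 with m the mean of g; if the right-hand side is infinite there is
    nothing to show. *)
Lemma sqr_Rintegral_le d (T : measurableType d) (mu : probability T R) (g : T -> R) :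
  measurable_fun setT g -> (((\int[mu]_x g x) ^+ 2)%:E <= \int[mu]_x (g x ^+ 2)%:E)%E.
Proof.
move=> mg; have [fo|] := ltP (\int[mu]_x (g x ^+ 2)%:E)%E +oo%E; last first.
  by rewrite leye_eq => /eqP ->; rewrite leey.
have ig2 : mu.-integrable setT (EFin \o (fun x => g x ^+ 2)).
  apply/integrableP; split; first by apply/measurable_EFinP; exact: measurable_funX.
  by under eq_integral do rewrite gee0_abs ?lee_fin ?sqr_ge0//.
have i1 c : mu.-integrable setT (EFin \o (fun=> c : R)).
  exact: finite_measure_integrable_cst.
have i2 c : mu.-integrable setT (EFin \o (fun x => g x ^+ 2 + c)).
  exact: (integrableD measurableT ig2 (i1 c)).
have ig : mu.-integrable setT (EFin \o g).
  apply: le_integrable (i2 1) => //; first by apply/measurable_EFinP.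
  move=> x _; rewrite /= lee_fin [leRHS]ger0_norm ?addr_ge0 ?sqr_ge0//.
  by rewrite ler_norml; apply/andP; split; have := sqr_ge0 (g x + 1); have := sqr_ge0 (g x - 1); nra.
set m := \int[mu]_x g x.
have : \int[mu]_x (2 * m * g x) <= \int[mu]_x (g x ^+ 2 + m ^+ 2).
  apply: le_Rintegral => //; last by move=> x _; have := sqr_ge0 (g x - m); nra.
  exact: (integrableZl measurableT (2 * m) ig).
rewrite RintegralZl// -/m RintegralD// Rintegral_cst//.
rewrite (congr1 (@fine R) (probability_setT mu)) mulr1.
rewrite -lerBlDr => h; rewrite -[leRHS]fineK; last first.
  by rewrite ge0_fin_numE// integral_ge0// => x _; rewrite lee_fin sqr_ge0.
by rewrite lee_fin; apply: le_trans h; rewrite /m; lra.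
Qed.

(** Jensen in the first variable, then [fpos_fann] for the squares: annihilation stays in L^2. *)
Lemma fpos_fann_sqr v f : fmeas f -> fpos (fun n x w => f n x w ^+ 2) ->
  fpos (fun n x w => fann v f x w ^+ 2).
Proof.
move=> mf pf; have m2 : fmeas (fun n x w => fann v f x w ^+ 2).
  by move=> n w; apply: measurable_funX; exact: fmeas_fann.
have s0 : fge0 (fun n x w => fann v f x w ^+ 2) by move=> n x w; exact: sqr_ge0.
split=> //; have [m3 p3 lt3] := fpos_fann v pf.
apply: le_lt_trans lt3; apply: le_ftot_ae => // n.
apply: filterS (ae_fann_fin v n pf) => x h w; rewrite -lee_fin.
apply: le_trans (sqr_Rintegral_le (@lebI R) (fmeas_cons v x w mf)) _.
rewrite /fann /Rintegral fineK// ge0_fin_numE//.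
by apply: integral_ge0 => y _; rewrite lee_fin sqr_ge0.
Qed.

End Annihilation.

(** * Annihilation as the adjoint of creation on the Fock space *)

Section AnnihilationOperator.
Context {R : realType} {U : countType}.
Local Notation pt := (measurableTypeR R).
Local Notation letter := (U + U)%type.
Local Notation l2 := (l2_field R U).
Local Notation H := (fock R U).
Local Open Scope quotient_scope.
Implicit Types f g p q : forall n, n.+1.-tuple pt -> n.-tuple letter -> R.
Implicit Types (v : letter) (h : linfty R) (F G : l2).

(** The kernels at hand are indicators of triangles. A real kernel lets annihilation act on real and
    imaginary parts separately, and values in [0,1] keep multiplication by it from increasing
    squares. *)
Definition real01 h := forall x y, Im (h x y) = 0 /\ 0 <= Re (h x y) <= 1.

Definition fmul h f : forall n, n.+1.-tuple pt -> n.-tuple letter -> R := fun n =>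
  match n return n.+1.-tuple pt -> n.-tuple letter -> R with
  | 0 => fun _ _ => 0
  | m.+1 => fun x w => Re (h (thead x) (thead (behead_tuple x))) * f m.+1 x w
  end.

Lemma measurable_kernel h n : measurable_fun setT
  (fun x : n.+2.-tuple pt => Re (h (thead x) (thead (behead_tuple x)))).
Proof.
apply: (measurableT_comp (proj1 (linf_measurable h))
  (g := fun x : n.+2.-tuple pt => (thead x, thead (behead_tuple x)))).
apply/measurable_fun_pair; first exact: measurable_thead.
apply: (measurableT_comp (@measurable_thead _ n)).
exact: measurable_behead_tuple.
Qed.

Lemma fmeas_fmul h f : fmeas f -> fmeas (fmul h f).
Proof.
move=> mf [|n] w /=; first exact: measurable_cst.
by apply: measurable_funM; [exact: measurable_kernel|exact: mf].
Qed.

Lemma fpos_fmul_sqr h f : real01 h -> fmeas f -> fpos (fun n x w => f n x w ^+ 2) ->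
  fpos (fun n x w => fmul h f x w ^+ 2).
Proof.
move=> h01 mf pf; apply: le_fpos pf.
- by move=> n w; apply: measurable_funX; exact: fmeas_fmul.
- by move=> n x w; exact: sqr_ge0.
move=> [|n] x w /=; first by rewrite expr0n sqr_ge0.
have [_ /andP[h0 h1]] := h01 (thead x) (thead (behead_tuple x)).
by rewrite exprMn -[leRHS]mul1r ler_wpM2r ?sqr_ge0// expr_le1.
Qed.

Lemma fpos_Re_sqr F : fpos (fun n x w => Re (F n x w) ^+ 2).
Proof.
have [mF _] := l2P F; apply: le_fpos (fpos_sqmod F).
- by move=> n w; apply: measurable_funX; have [] := mF n w.
- by move=> n x w; exact: sqr_ge0.
- by move=> n x w; rewrite sqmodE lerDl sqr_ge0.
Qed.

Lemma fpos_Im_sqr F : fpos (fun n x w => Im (F n x w) ^+ 2).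
Proof.
have [mF _] := l2P F; apply: le_fpos (fpos_sqmod F).
- by move=> n w; apply: measurable_funX; have [] := mF n w.
- by move=> n x w; exact: sqr_ge0.
- by move=> n x w; rewrite sqmodE lerDr sqr_ge0.
Qed.

Lemma fmeas_Re F : fmeas (fun n x w => Re (F n x w)).
Proof. by have [mF _] := l2P F; move=> n w; have [] := mF n w. Qed.

Lemma fmeas_Im F : fmeas (fun n x w => Im (F n x w)).
Proof. by have [mF _] := l2P F; move=> n w; have [] := mF n w. Qed.

Definition ann_field h v F : fock_field R U := fun n x w =>
  fann v (fmul h (fun n x w => Re (F n x w))) x w +i*
  fann v (fmul h (fun n x w => Im (F n x w))) x w.

Lemma square_integrable_ann h v F : real01 h -> square_integrable (ann_field h v F).
Proof.
move=> h01; split=> [n w|].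
  by split; apply: fmeas_fann; apply: fmeas_fmul; [exact: fmeas_Re|exact: fmeas_Im].
have p1 := fpos_fann_sqr v (fmeas_fmul h (@fmeas_Re F)) (fpos_fmul_sqr h01 (@fmeas_Re F) (fpos_Re_sqr F)).
have p2 := fpos_fann_sqr v (fmeas_fmul h (@fmeas_Im F)) (fpos_fmul_sqr h01 (@fmeas_Im F) (fpos_Im_sqr F)).
have [_ _] := fposD p1 p2; rewrite ftotU; apply: le_lt_trans.
rewrite le_eqVlt; apply/orP; left; apply/eqP.
apply: eq_eseriesr => n _; apply: eq_integral => x _.
by apply: eq_esum => w _; rewrite sqmodE.
Qed.

Definition l2_ann h v (h01 : real01 h) F : l2 := L2Field (square_integrable_ann v F h01).

Lemma l2_annE h v (h01 : real01 h) F n x w : l2_ann v h01 F n x w =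
  fann v (fmul h (fun n x w => Re (F n x w))) x w +i*
  fann v (fmul h (fun n x w => Im (F n x w))) x w.
Proof. by []. Qed.

(** Square integrability in the first variable holds at almost every x, and |a| <= a^2 + 1 turns it
    into integrability on a space of measure 1. *)
Lemma ae_integrable_fmul h v f n : real01 h -> fmeas f ->
  fpos (fun n x w => f n x w ^+ 2) ->
  {ae cube R n.+1, forall x, forall w : n.-tuple letter,
    (@lebI R).-integrable setT
      (EFin \o fun y => fmul h f (cons_pt (y, x)) (cons_tuple v w))}.
Proof.
move=> h01 mf pf; have mg := fmeas_fmul h mf; have pg := fpos_fmul_sqr h01 mf pf.
apply: filterS (ae_fann_fin v n pg) => x h1 w.
have m1 := fmeas_cons v x w mg.
have i2 : (@lebI R).-integrable setT
   (EFin \o (fun y => fmul h f (cons_pt (y, x)) (cons_tuple v w) ^+ 2)).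
  apply/integrableP; split; first by apply/measurable_EFinP; exact: measurable_funX.
  by apply: le_lt_trans (h1 w); rewrite le_eqVlt; apply/orP; left; apply/eqP;
    apply: eq_integral => y _; rewrite gee0_abs ?lee_fin ?sqr_ge0.
have i1 : (@lebI R).-integrable setT (EFin \o (fun=> 1 : R)).
  exact: finite_measure_integrable_cst.
apply: le_integrable (integrableD measurableT i2 i1) => //.
  by apply/measurable_EFinP.
move=> y _; rewrite [leRHS]gee0_abs ?lee_fin ?addr_ge0 ?sqr_ge0//=.
move: (_ * _) => a.
by rewrite ler_norml; apply/andP; split; have := sqr_ge0 (a + 1); have := sqr_ge0 (a - 1); nra.
Qed.

Lemma redot_wp h v F G : real01 h -> redot (l2_wp h v F) G = frestr v (redot (l2_wp h v F) G).
Proof.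
move=> h01; apply: fext => -[|n] x w; rewrite /redot /=; first by rewrite mul0r.
by case: eqP => // _; rewrite mul0r.
Qed.

Lemma imdot_wp h v F G : real01 h -> imdot (l2_wp h v F) G = frestr v (imdot (l2_wp h v F) G).
Proof.
move=> h01; apply: fext => -[|n] x w; rewrite /imdot /=; first by rewrite mul0r.
by case: eqP => // _; rewrite mul0r.
Qed.

Lemma l2_wp_cons h v F n y (x : n.+1.-tuple pt) w : real01 h ->
  l2_wp h v F n.+1 (cons_pt (y, x)) (cons_tuple v w) = (Re (h y (thead x)))%:C * F n x w.
Proof.
move=> h01 /=; rewrite theadE eqxx.
rewrite (_ : behead_tuple (cons_tuple v w) = w); last exact/val_inj.
rewrite (_ : behead_tuple (cons_pt (y, x)) = x); last exact/val_inj.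
rewrite (_ : thead _ = y)//; have [i0 _] := h01 y (thead x).
by congr (_ * _); apply/eqP; rewrite eq_complex /= i0 !eqxx.
Qed.

Lemma behead_cons_pt n y (x : n.-tuple pt) : behead_tuple (cons_pt (y, x)) = x.
Proof. exact/val_inj. Qed.

Lemma thead_cons_pt n y (x : n.-tuple pt) : thead (cons_pt (y, x)) = y.
Proof. by []. Qed.

Lemma fmul_cons h f v n y (x : n.+1.-tuple pt) w :
  fmul h f (cons_pt (y, x)) (cons_tuple v w) =
  Re (h y (thead x)) * f n.+1 (cons_pt (y, x)) (cons_tuple v w).
Proof. by rewrite /= (_ : behead_tuple (cons_pt (y, x)) = x)//; exact/val_inj. Qed.

(** The product of [l2_wp h v F] with [G] lives on words with first letter v, so [fint_fann]
    integrates out the first point. [F] is constant in that point and leaves the integral, and what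
    remains is the annihilation of [G]. *)
Lemma fint_redot_adj h v (h01 : real01 h) F G :
  fint (redot (l2_wp h v F) G) = fint (redot F (l2_ann v h01 G)).
Proof.
rewrite (redot_wp v F G h01) (fint_fann v (fsummable_redot (l2_wp h v F) G)).
have [m1 _] := fsummable_redot (l2_wp h v F) G.
have [m2 _] := fsummable_redot F (l2_ann v h01 G).
apply: (fint_ae (fmeas_fann v m1) m2) => n.
apply: filterS2 (ae_integrable_fmul v n h01 (@fmeas_Re G) (fpos_Re_sqr G))
  (ae_integrable_fmul v n h01 (@fmeas_Im G) (fpos_Im_sqr G)) => x i1 i2 w.
rewrite redotE l2_annE /= /fann -!RintegralZl// -RintegralD//=; last 2 first.
- exact: (integrableZl measurableT _ (i1 w)).
- exact: (integrableZl measurableT _ (i2 w)).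
apply: eq_Rintegral => y _; rewrite redotE l2_wp_cons// behead_cons_pt thead_cons_pt.
by case: (F n x w) => a b /=; ring.
Qed.

Lemma fint_imdot_adj h v (h01 : real01 h) F G :
  fint (imdot (l2_wp h v F) G) = fint (imdot F (l2_ann v h01 G)).
Proof.
rewrite (imdot_wp v F G h01) (fint_fann v (fsummable_imdot (l2_wp h v F) G)).
have [m1 _] := fsummable_imdot (l2_wp h v F) G.
have [m2 _] := fsummable_imdot F (l2_ann v h01 G).
apply: (fint_ae (fmeas_fann v m1) m2) => n.
apply: filterS2 (ae_integrable_fmul v n h01 (@fmeas_Re G) (fpos_Re_sqr G))
  (ae_integrable_fmul v n h01 (@fmeas_Im G) (fpos_Im_sqr G)) => x i1 i2 w.
rewrite imdotE l2_annE /= /fann -!RintegralZl// -RintegralB//=; last 2 first.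
- exact: (integrableZl measurableT _ (i1 w)).
- exact: (integrableZl measurableT _ (i2 w)).
apply: eq_Rintegral => y _; rewrite imdotE l2_wp_cons// behead_cons_pt thead_cons_pt.
by case: (F n x w) => a b /=; ring.
Qed.

Definition ann h v (h01 : real01 h) (a : H) : H := \pi_H (l2_ann v h01 (repr a)).

Lemma inner_wp h v (h01 : real01 h) (a : H) G :
  inner (wp h v a) (\pi_H G) = inner a (\pi_H (l2_ann v h01 G)).
Proof.
elim/quotW: a => F; rewrite (wpE h v F) !inner_pi.
by rewrite (fint_redot_adj v h01) (fint_imdot_adj v h01).
Qed.

Lemma inner_injr (b c : H) : (forall a, inner a b = inner a c) -> b = c.
Proof.
move=> bc; apply/eqP; rewrite -subr_eq0; apply/eqP/inner_eq0.
by rewrite innerDr innerN bc subrr.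
Qed.

(** Independence of the representative follows from the adjoint relation and the nondegeneracy of
    [inner]; no null sets have to be transported. *)
Lemma annE h v (h01 : real01 h) G : ann v h01 (\pi_H G) = \pi_H (l2_ann v h01 G).
Proof. by apply: inner_injr => a; rewrite /ann -!inner_wp reprK. Qed.

Lemma inner_ann h v (h01 : real01 h) (a b : H) : inner (wp h v a) b = inner a (ann v h01 b).
Proof. by elim/quotW: b => G; rewrite annE inner_wp. Qed.

Lemma inner_annl h v (h01 : real01 h) (a b : H) : inner (ann v h01 a) b = inner a (wp h v b).
Proof.
rewrite (inner_conj (ann v h01 a) b) -(inner_ann v h01 b a).
exact: esym (inner_conj a (wp h v b)).
Qed.

(** [adjoint] is a choice from a set: [S] shows that the set is inhabited, and [inner_injr] that it
    has only one element. *)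
Lemma adjointP (T S : H -> H) : (forall a b, inner (T a) b = inner a (S b)) -> adjoint T = S.
Proof.
move=> TS; apply/funext => b; apply: inner_injr => a; rewrite -TS.
have h : [set S | forall a b, inner (T a) b = inner a (S b)] (adjoint T).
  exact: (xgetI (fun=> 0) TS).
exact: (esym (h a b)).
Qed.

Lemma adjoint_wp h v (h01 : real01 h) : adjoint (wp h v) = ann v h01.
Proof. by apply: adjointP => a b; exact: inner_ann. Qed.

End AnnihilationOperator.

(** * Words in the operators eta(u) *)

Section Eta.
Context {R : realType} {U : countType}.
Local Notation pt := (measurableTypeR R).
Local Notation letter := (U + U)%type.
Local Notation l2 := (l2_field R U).
Local Notation H := (fock R U).
Local Open Scope quotient_scope.
Implicit Types (e : bool) (u : U).

Definition copy e u : letter := if e then inr u else inl u.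

Definition tri_linf e : linfty R := if e then linf_transpose (chi_Delta R) else chi_Delta R.

Definition tri e (x y : R) : R :=
  if e then (\1_(@Delta R) (y, x) : R) else \1_(@Delta R) (x, y).

Lemma tri_linfE e x y : tri_linf e x y = (tri e x y)%:C.
Proof. by case: e. Qed.

Lemma triC e x y : tri (~~ e) x y = tri e y x.
Proof. by case: e. Qed.

Lemma tri_ge0 e x y : 0 <= tri e x y.
Proof. by case: e; rewrite /tri indicE. Qed.

Lemma tri_le1 e x y : tri e x y <= 1.
Proof. by case: e; rewrite /tri indicE; case: (_ \in _). Qed.

Lemma tri_linf01 e : real01 (tri_linf e).
Proof. by move=> x y; rewrite tri_linfE /= tri_ge0 tri_le1. Qed.

(** The adjoint exchanges the creation and the annihilation part. With the exponent as a boolean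
    this flips [e] in the letter and in the kernel, so one formula serves both exponents. *)
Lemma op_expE e u : op_exp e (eta_op u) =
  (fun a : H => wp (tri_linf e) (copy e u) a + ann (copy (~~ e) u) (tri_linf01 (~~ e)) a).
Proof.
have eta_opE : eta_op u = fun a : H => wp (tri_linf false) (copy false u) a +
    ann (copy true u) (tri_linf01 true) a.
  apply/funext => a; rewrite /eta_op.
  by rewrite -(adjoint_wp (copy true u) (tri_linf01 true)).
case: e; last exact: eta_opE.
rewrite /op_exp eta_opE; apply: adjointP => a b.
have E1 := inner_ann (copy false u) (tri_linf01 false) a b.
have E2 : inner (ann (copy true u) (tri_linf01 true) a) b = inner a (wp (tri_linf true) (copy true u) b).
  exact: inner_annl.
rewrite innerDl innerDr E1 E2; exact: addrC.
Qed.

(** A concrete representative of the word applied to the vacuum, built on fields and not on classes,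
    so that [PhiE] can hold at every point. *)
Fixpoint Phi (l : seq (bool * U)) : l2 :=
  match l with
  | [::] => L2Field (@square_integrable_vac R U)
  | (e, u) :: l' => l2_add (l2_wp (tri_linf e) (copy e u) (Phi l'))
      (l2_ann (copy (~~ e) u) (tri_linf01 (~~ e)) (Phi l'))
  end.

Lemma word_vac m (eps : 'I_m -> bool) (u : 'I_m -> U) :
  (\big[(fun A B : H -> H => A \o B)/idfun]_(k < m) op_exp (eps k) (eta_op (u k)))
    (vac R U) = \pi_H (Phi [seq (eps k, u k) | k <- enum 'I_m]).
Proof.
elim: m eps u => [|m IH] eps u; first by rewrite big_ord0 enum_ord0.
rewrite big_ord_recl /= IH enum_ordSl /= op_expE.
rewrite (wpE _ _ (Phi _)) annE [_ + _]fock_addE.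
rewrite -[in RHS]map_comp; exact: erefl.
Qed.

Lemma rsum_supp1 (T : choiceType) (t0 : T) (f : T -> R) :
  (forall t, t <> t0 -> f t = 0) -> rsum f = f t0.
Proof.
move=> f0.
have E (g : T -> \bar R) : (forall t, 0 <= g t)%E -> (forall t, t <> t0 -> g t = 0%E) ->
    (\esum_(t in setT) g t = g t0)%E.
  move=> g0 gz; rewrite (esumID [set t0])// setTI esum_set1//.
  by rewrite esum1 ?adde0// => t [_ /= tt]; exact: gz.
rewrite /rsum !E//.
- by rewrite funeposE funenegE /= -!EFin_max /=
    -[in X in _ - X]oppr0 -oppr_min opprK addr_max_min addr0.
- by move=> t tt; rewrite funenegE /= f0// oppr0 maxxx.
- by move=> t tt; rewrite funeposE /= f0// maxxx.
Qed.

Lemma rsum0 (T : choiceType) (f : T -> R) : (forall t, f t = 0) -> rsum f = 0.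
Proof.
move=> f0; rewrite /rsum !esum1 ?subr0// => t _.
- by rewrite funenegE /= f0// oppr0 maxxx.
- by rewrite funeposE /= f0// maxxx.
Qed.

Lemma fint_supp0 (f : forall n, n.+1.-tuple pt -> n.-tuple letter -> R) :
  (forall n x w, f n.+1 x w = 0) -> fint f = \int[cube R 1]_x f 0%N x [tuple].
Proof.
move=> f0; rewrite fintU (rsum_supp1 (t0 := 0%N)).
  by congr Rintegral; apply/funext => x; rewrite (rsum_supp1 (t0 := [tuple]))// => t; rewrite tuple0.
case=> // n _; rewrite (_ : (fun x => _) = fun=> 0).
  by rewrite Rintegral_cst// mul0r.
by apply/funext => x; rewrite rsum0.
Qed.

(* The coordinate at the point [x :: xs], on e(w), of the word [l] applied to the vacuum;
   [size xs = size w] is the level. *)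
Fixpoint psi (l : seq (bool * U)) (x : R) (xs : seq R) (w : seq letter) : R :=
  match l with
  | [::] => (w == [::])%:R
  | (e, u) :: l' =>
      match xs, w with
      | y :: xs', v :: w' => if v == copy e u then tri e x y * psi l' y xs' w' else 0
      | _, _ => 0
      end + \int[@lebI R]_y (tri e x y * psi l' y (x :: xs) (copy (~~ e) u :: w))
  end.

Lemma PhiE l n (x : n.+1.-tuple pt) w :
  Phi l n x w = (psi l (thead x) (behead x) w)%:C.
Proof.
elim: l n x w => [|[e u] l IH] n x w.
  rewrite /= /vac_field; case: n x w => [|n] x w; first by rewrite tuple0.
  by case/tupleP: w.
rewrite /Phi -/Phi l2_addE.
have -> : l2_ann (copy (~~ e) u) (tri_linf01 (~~ e)) (Phi l) n x w =
    (\int[@lebI R]_y (tri e (thead x) y * psi l y x (copy (~~ e) u :: w)))%:C.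
  rewrite l2_annE /fann; apply/eqP; rewrite eq_complex; apply/andP; split; apply/eqP.
    (* The annihilator has the kernel [tri (~~ e) y x], which is [tri e x y]: both summands of [psi]
       share one kernel. *)
    apply: eq_Rintegral => y _; rewrite fmul_cons IH tri_linfE triC.
    by case/tupleP: x.
  (* Kernels and vacuum are real, so by induction all imaginary parts vanish. *)
  transitivity (\int[@lebI R]_y 0); last by rewrite Rintegral_cst// mul0r.
  by apply: eq_Rintegral => y _; rewrite fmul_cons IH mulr0.
rewrite [RHS]/=; rewrite (_ : thead x :: behead x = x :> seq R); last by case/tupleP: x.
rewrite rmorphD /=; congr (_ + _).
case: n x w => [|n] x w; first by case/tupleP: x => a x; rewrite tuple0.
case/tupleP: x => a x; case/tupleP: x => b x; case/tupleP: w => v w /=.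
rewrite !theadE; case: eqP => // _.
by rewrite tri_linfE IH -rmorphM.
Qed.

Lemma psi_ge0 l x xs w : 0 <= psi l x xs w.
Proof.
elim: l x xs w => [|[e u] l IH] x xs w /=; first exact: ler0n.
apply: addr_ge0.
  case: xs w => [|y xs] [|v w] //; case: eqP => // _.
  by rewrite mulr_ge0 ?tri_ge0.
by apply: Rintegral_ge0 => y _; rewrite mulr_ge0 ?tri_ge0.
Qed.

(** Read off from [Phi], whose coordinates are jointly measurable, by fixing all points but the
    first. *)
Lemma measurable_psi l n (x : n.-tuple pt) (w : n.-tuple letter) :
  measurable_fun setT (fun y : pt => psi l y x w).
Proof.
have [mF _] := l2P (Phi l); have [mR _] := mF _ w.
rewrite (_ : (fun y => _) = (fun y => Re (Phi l n (cons_pt (y, x)) w))).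
  exact: (measurableT_comp mR (measurable_cons_section x)).
by apply/funext => y; rewrite PhiE.
Qed.

Lemma Rintegral_cube1 (f : pt -> R) : (forall x, 0 <= f x) -> measurable_fun setT f ->
  \int[cube R 1]_x f (thead x) = \int[@lebI R]_x f x.
Proof.
move=> f0 mf; rewrite /Rintegral ge0_integral_cubeS.
- rewrite /= integral_dirac// ?diracT ?mul1e//.
  apply: (@measurable_integral_cons R 0 (fun z => (f (thead z))%:E)).
    by move=> x; rewrite lee_fin.
  by apply/measurable_EFinP; exact: (measurableT_comp mf (@measurable_thead R 0)).
- by move=> x; rewrite lee_fin.
- by apply/measurable_EFinP; exact: (measurableT_comp mf (@measurable_thead R 0)).
Qed.

(** Pairing with the vacuum keeps only level 0, where the single point x is integrated. *)
Lemma vac_state_word m (eps : 'I_m -> bool) (u : 'I_m -> U) :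
  vac_state (\big[(fun A B : H -> H => A \o B)/idfun]_(k < m) op_exp (eps k) (eta_op (u k))) =
  (\int[@lebI R]_x psi [seq (eps k, u k) | k <- enum 'I_m] x [::] [::])%:C.
Proof.
rewrite /vac_state word_vac inner_pi.
set l := [seq _ | _ <- _]; set V := L2Field _.
have E n x w : Phi l n x w * (V n x w)^* = (psi l (thead x) (behead x) w * (n == 0%N)%:R)%:C.
  by rewrite PhiE /= /vac_field; case: n x w => [|n] x w; rewrite ?mulr1 ?mulr0 /=;
    apply/eqP; rewrite eq_complex /= ?oppr0 ?mulr1 ?mulr0 ?mul0r ?subr0 ?addr0 !eqxx.
rewrite [X in _ +i* X](_ : _ = 0); last first.
  rewrite (_ : imdot _ _ = fun _ _ _ => 0); last by apply: fext => n x w; rewrite /imdot E.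
  by rewrite (fint_ge0 fpos0) ftot0.
rewrite fint_supp0; last by move=> n x w; rewrite /redot E mulr0.
rewrite [RHS](_ : _ = (\int[@lebI R]_x psi l x [::] [::]) +i* 0)//; congr (_ +i* _).
rewrite -(@Rintegral_cube1 (fun x => psi l x [::] [::])).
- apply: eq_Rintegral => x _; rewrite /redot E mulr1 /=.
  by case/tupleP: x => a x; rewrite tuple0.
- by move=> x; exact: psi_ge0.
- exact: (measurable_psi l [tuple] [tuple]).
Qed.

End Eta.

(** * Gaussian moments *)

Section Density.
Context d (T : measurableType d) (R : realType).
Variables (mu nu : {measure set T -> \bar R}) (g : T -> R).
Hypotheses (mg : measurable_fun setT g) (g0 : forall x, 0 <= g x).
Hypothesis nuE : forall A, measurable A -> nu A = (\int[mu]_(x in A) (g x)%:E)%E.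

Import HBNNSimple.

(** On indicators this is [nuE]; linearity gives simple functions and monotone convergence the
    rest. *)
Lemma ge0_integral_density (f : T -> \bar R) : (forall x, 0 <= f x)%E ->
  measurable_fun setT f ->
  (\int[nu]_x f x = \int[mu]_x (f x * (g x)%:E))%E.
Proof.
move=> f0 mf; pose h := nnsfun_approx measurableT mf.
have mgE : measurable_fun setT (EFin \o g) by apply/measurable_EFinP.
have -> : (\int[nu]_x f x = lim (\int[nu]_x (EFin \o h n) x @[n --> \oo]))%E.
  have fE x : f x = lim ((EFin \o h n) x @[n --> \oo]).
    by apply/esym/cvg_lim => //; exact: cvg_nnsfun_approx.
  under eq_integral => x _ do rewrite fE.
  apply: monotone_convergence => //.
  - by move=> n; apply/measurable_EFinP; exact/measurable_funP.
  - by move=> n x _ /=; rewrite lee_fin.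
  - by move=> x _ a b ab; rewrite lee_fin; exact/lefP/nd_nnsfun_approx.
have -> : (\int[mu]_x (f x * (g x)%:E) =
    lim (\int[mu]_x ((EFin \o h n) x * (g x)%:E) @[n --> \oo]))%E.
  have fg x : (f x * (g x)%:E = lim ((EFin \o h n) x * (g x)%:E @[n --> \oo]))%E.
    by apply/esym/cvg_lim => //; apply: cvgeZr => //; exact: cvg_nnsfun_approx.
  under eq_integral => x _ do rewrite fg.
  apply: monotone_convergence => //.
  - move=> n; apply: emeasurable_funM => //.
    by apply/measurable_EFinP; exact/measurable_funP.
  - by move=> n x _ /=; rewrite mule_ge0 ?lee_fin.
  - by move=> x _ a b ab; rewrite lee_wpmul2r ?lee_fin//; exact/lefP/nd_nnsfun_approx.
suff suf n : (\int[mu]_x ((EFin \o h n) x * (g x)%:E) = \int[nu]_x (EFin \o h n) x)%E.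
  by under [in RHS]eq_fun do rewrite suf.
have sE x : ((EFin \o h n) x =
    \sum_(y \in range (h n)) (y * \1_(h n @^-1` [set y]) x)%:E)%E.
  by rewrite /= fimfunE -fsumEFin.
have indich r : measurable_fun setT (fun x => (r * \1_(h n @^-1` [set r]) x)%:E).
  by apply/measurable_EFinP; exact: measurable_funM.
under [RHS]eq_integral do rewrite sE.
rewrite ge0_integral_fsum//; last by move=> y x _; exact: nnfun_muleindic_ge0.
transitivity (\int[mu]_x (\sum_(y \in range (h n))
    (y * \1_(h n @^-1` [set y]) x)%:E * (g x)%:E))%E.
  apply: eq_integral => x _; rewrite sE ge0_mule_fsuml// => y.
  exact: nnfun_muleindic_ge0.
rewrite ge0_integral_fsum//; last 2 first.
- by move=> y; apply: emeasurable_funM.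
- by move=> y x _; rewrite mule_ge0 ?lee_fin// -lee_fin nnfun_muleindic_ge0.
apply: eq_fsbigr => r /[!inE] -[t _ tr].
have r0 : 0 <= r by rewrite -tr.
have mA : measurable (h n @^-1` [set r]) by exact: measurable_sfunP.
under [RHS]eq_integral do rewrite EFinM.
rewrite ge0_integralZl//=; last by apply/measurable_EFinP.
rewrite integral_indic// setIT nuE//.
under eq_integral do rewrite EFinM -muleA.
rewrite ge0_integralZl//=.
- congr (_ * _)%E; rewrite [RHS]integral_mkcond; apply: eq_integral => x _.
  by rewrite patchE indicE; case: ifPn; rewrite ?mul1e ?mul0e.
- by apply: emeasurable_funM => //; apply/measurable_EFinP.
- by move=> x _; rewrite mule_ge0 ?lee_fin.
Qed.

End Density.

Section GaussianMoments.
Context d (T : measurableType d) (R : realType) (P : probability T R).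
Local Notation mu := (@lebesgue_measure R).

Lemma ge0_integral_gaussian (m s : R) (X : T -> R) (f : R -> R) :
  measurable_fun setT X ->
  (forall A : set R, measurable A -> P (X @^-1` A) = normal_prob m s A) ->
  measurable_fun setT f -> (forall x, 0 <= f x) ->
  (\int[P]_t (f (X t))%:E = \int[mu]_x (f x * normal_pdf m s x)%:E)%E.
Proof.
move=> mX XE mf f0.
have mX1 : measurable_fun setT (X : T -> measurableTypeR R) := mX.
pose X' : {mfun T >-> measurableTypeR R} :=
  HB.pack (X : T -> measurableTypeR R) (isMeasurableFun.Build _ _ _ _ _ mX1).
have mfE : measurable_fun setT (EFin \o f : measurableTypeR R -> \bar R).
  by apply/measurable_EFinP.
have f0E (x : measurableTypeR R) : (0 <= (EFin \o f) x)%E by rewrite lee_fin.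
rewrite -[LHS](@ge0_integral_distribution _ _ _ _ _ P X' _ mfE f0E).
have nuE (A : set (measurableTypeR R)) : measurable A ->
  distribution P X' A = (\int[mu]_(x in A) (normal_pdf m s x)%:E)%E by exact: XE.
have mp : measurable_fun setT (normal_pdf m s : measurableTypeR R -> R).
  exact: measurable_normal_pdf.
by rewrite [LHS](ge0_integral_density mp (normal_pdf_ge0 m s) nuE f0E mfE).
Qed.

Variables (s : R) (X : T -> R).
Hypotheses (s0 : 0 < s) (mX : measurable_fun setT X).
Hypothesis XE : forall A : set R, measurable A -> P (X @^-1` A) = normal_prob 0 s A.

(** If [f] turns the density of X into c times another normal density, its expectation is c, because
    normal densities integrate to 1. The moments below are all drawn from this identity, without
    evaluating an integral. *)
Let integral_ratio (m' s' : R) (f : R -> R) (c : R) : 0 < s' ->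
  measurable_fun setT f -> (forall x, 0 <= f x) -> 0 <= c ->
  (forall x, f x * normal_pdf 0 s x = c * normal_pdf m' s' x) ->
  (\int[P]_t (f (X t))%:E = c%:E)%E.
Proof.
move=> s'0 mf f0 c0 fE; rewrite (ge0_integral_gaussian mX XE mf f0).
under eq_integral do rewrite fE EFinM.
rewrite ge0_integralZl//.
- by rewrite integral_normal_pdf mule1.
- by apply/measurable_EFinP; exact: measurable_normal_pdf.
- by move=> x _; rewrite lee_fin normal_pdf_ge0.
Qed.

Let peakE (c : R) : 0 < c -> normal_peak (c * s) = c^-1 * normal_peak s.
Proof.
move=> c0; rewrite /normal_peak -invfM; congr (_^-1).
by rewrite exprMn -mulrnAr -mulrA sqrtrM ?sqr_ge0// sqrtr_sqr gtr0_norm// mulrnAr.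
Qed.

(** Adding x^2/(4 s^2) to the exponent -x^2/(2 s^2) gives the exponent of variance 2 s^2; the ratio
    of the peaks is the square root of 2. *)
Lemma gaussian_exp_moment : (\int[P]_t (expR (X t ^+ 2 / (s ^+ 2 *+ 4)))%:E = (Num.sqrt 2)%:E)%E.
Proof.
have r0 : 0 < Num.sqrt 2 :> R by rewrite sqrtr_gt0.
apply: (@integral_ratio 0 (Num.sqrt 2 * s) (fun x => expR (x ^+ 2 / (s ^+ 2 *+ 4)))) => //.
- by rewrite mulr_gt0.
- by apply: measurableT_comp => //; apply: measurable_funM => //; exact: measurable_funX.
move=> x; rewrite !normal_pdfE ?gt_eqF ?mulr_gt0//= peakE// !mulrA divff ?gt_eqF// mul1r.
rewrite (mulrC (expR _)) -mulrA; congr (_ * _); rewrite /normal_fun -expRD; congr expR.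
rewrite subr0 exprMn sqr_sqrtr//; field.
by rewrite gt_eqF.
Qed.

(** y^k / k! <= exp y at y = X^2/(4 s^2), integrated by [gaussian_exp_moment]. Only the order s^(2k)
    matters later. *)
Lemma gaussian_even_moment k :
  (\int[P]_t (X t ^+ k.*2)%:E <= (k`!%:R * Num.sqrt 2 * (s ^+ 2 *+ 4) ^+ k)%:E)%E.
Proof.
have s4 : 0 < s ^+ 2 *+ 4 by rewrite pmulrn_lgt0// exprn_gt0.
have -> : (k`!%:R * Num.sqrt 2 * (s ^+ 2 *+ 4) ^+ k)%:E =
  (\int[P]_t ((k`!%:R * (s ^+ 2 *+ 4) ^+ k)%:E * (expR (X t ^+ 2 / (s ^+ 2 *+ 4)))%:E))%E.
  rewrite ge0_integralZl//.
  - by rewrite gaussian_exp_moment -EFinM; congr EFin; ring.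
  - apply/measurable_EFinP; apply: measurableT_comp => //; apply: measurable_funM => //.
    exact: measurable_funX.
  - by rewrite lee_fin mulr_ge0// exprn_ge0// ltW.
apply: ge0_le_integral => //.
- by move=> t _; rewrite lee_fin -muln2 mulnC exprM exprn_ge0 ?sqr_ge0.
- by apply/measurable_EFinP; exact: measurable_funX.
- apply: emeasurable_funM => //; apply/measurable_EFinP; apply: measurableT_comp => //.
  by apply: measurable_funM => //; exact: measurable_funX.
move=> t _; rewrite -EFinM lee_fin.
have a0 : 0 <= X t ^+ 2 / (s ^+ 2 *+ 4) by rewrite divr_ge0 ?sqr_ge0// ltW.
have xE : X t ^+ k.*2 = (X t ^+ 2 / (s ^+ 2 *+ 4)) ^+ k * (s ^+ 2 *+ 4) ^+ k.
  by rewrite -exprMn divfK ?gt_eqF// -exprM mul2n.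
rewrite xE [leRHS]mulrAC ler_wpM2r ?exprn_ge0 ?(ltW s4)//.
have f0 : 0 < k`!%:R :> R by rewrite ltr0n fact_gt0.
rewrite [leRHS]mulrC -ler_pdivrMr//; case: k {xE} f0 => [|k] f0.
  by rewrite expr0 fact0 divr1 (le_trans _ (expR_ge1Dx _))// lerDl.
by apply: le_trans (expR_ge1Dxn k a0); rewrite lerDr.
Qed.

Lemma integrable_gaussianX k : P.-integrable setT (EFin \o (fun t => X t ^+ k)).
Proof.
have i2 : P.-integrable setT (EFin \o (fun t => X t ^+ k.*2)).
  apply/integrableP; split; first by apply/measurable_EFinP; exact: measurable_funX.
  apply: le_lt_trans (ltry (k`!%:R * Num.sqrt 2 * (s ^+ 2 *+ 4) ^+ k)).
  apply: le_trans (gaussian_even_moment k); rewrite le_eqVlt; apply/orP; left; apply/eqP.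
  apply: eq_integral => t _; rewrite gee0_abs//= lee_fin -mul2n exprM exprn_ge0//.
  exact: sqr_ge0.
have i1 : P.-integrable setT (EFin \o (fun=> 1 : R)) by exact: finite_measure_integrable_cst.
apply: le_integrable (integrableD measurableT i2 i1) => //.
  by apply/measurable_EFinP; exact: measurable_funX.
move=> t _; rewrite /= lee_fin -muln2 exprM.
move: (X t ^+ k) => a; rewrite [leRHS]ger0_norm ?addr_ge0 ?sqr_ge0//.
by rewrite ler_norml; apply/andP; split;
  have := sqr_ge0 (a + 1); have := sqr_ge0 (a - 1); nra.
Qed.

Let integrable_affine k c c' :
  P.-integrable setT (EFin \o (fun t => c * X t ^+ k + c')).
Proof.
have i1 : P.-integrable setT (EFin \o (fun=> c')) by exact: finite_measure_integrable_cst.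
exact: (integrableD measurableT (integrableZl measurableT c (integrable_gaussianX k)) i1).
Qed.

Let Rintegral_affine k c c' :
  \int[P]_t (c * X t ^+ k + c') = c * \int[P]_t (X t ^+ k) + c'.
Proof.
rewrite RintegralD//; last 2 first.
- exact: (integrableZl measurableT c (integrable_gaussianX k)).
- exact: finite_measure_integrable_cst.
rewrite RintegralZl//; last exact: integrable_gaussianX.
rewrite Rintegral_cst//; congr (_ + _).
by rewrite (congr1 (@fine R) (probability_setT P)) mulr1.
Qed.

Let affine_le k c c' (f : R -> R) : measurable_fun setT f ->
  (forall x, c * x ^+ k + c' <= f x) -> (forall x, 0 <= f x) ->
  (\int[P]_t (f (X t))%:E = 1%:E)%E -> c * \int[P]_t (X t ^+ k) + c' <= 1.
Proof.
move=> mf cf f0 f1; rewrite -Rintegral_affine -lee_fin -f1.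
have mfX : measurable_fun setT (fun t => (f (X t))%:E).
  by apply/measurable_EFinP; exact: (measurableT_comp mf mX).
have iF : P.-integrable setT (fun t => (f (X t))%:E).
  apply/integrableP; split => //.
  by under eq_integral do rewrite gee0_abs ?lee_fin//; rewrite f1 ltry.
have := integrable_fin_num measurableT (integrable_affine k c c').
rewrite /Rintegral /= => /fineK ->.
by apply: (le_integral measurableT (integrable_affine k c c') iF) => t _; rewrite lee_fin.
Qed.

(* Integrating 1 + z <= exp z, with exp z the ratio of the shifted density to the density,
   gives t E[X] <= t^2 s^2 / 2 for all t. *)
Lemma gaussian_mean : \int[P]_t X t = 0.
Proof.
set M := \int[P]_t X t.
have ME : M = \int[P]_t (X t ^+ 1) by apply: eq_Rintegral => t _; rewrite expr1.
suff H t : t * M <= t ^+ 2 * s ^+ 2 / 2.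
  have s20 : 0 < s ^+ 2 by rewrite exprn_gt0.
  (* This t gives M^2/s^2 <= M^2/(2 s^2), hence M = 0. *)
  have := H (M / s ^+ 2).
  rewrite (_ : (M / s ^+ 2) ^+ 2 * s ^+ 2 / 2 = M ^+ 2 / s ^+ 2 / 2); last first.
    by field; rewrite gt_eqF.
  rewrite mulrAC -expr2 => h; apply/eqP; rewrite -sqrf_eq0 eq_le sqr_ge0 andbT.
  have : M ^+ 2 / s ^+ 2 <= 0 by move: h; lra.
  by rewrite pmulr_lle0// invr_gt0.
pose f x := expR (t * x - t ^+ 2 * s ^+ 2 / 2).
suff : t * M + (1 - t ^+ 2 * s ^+ 2 / 2) <= 1 by lra.
rewrite ME; apply: (affine_le (f := f)) => [|x|x|].
- by apply: measurableT_comp => //; apply: measurable_funB => //; exact: measurable_funM.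
- by rewrite expr1 addrCA; exact: expR_ge1Dx.
- exact: expR_ge0.
apply: (@integral_ratio (t * s ^+ 2) s f) => //.
- by apply: measurableT_comp => //; apply: measurable_funB => //; exact: measurable_funM.
- by move=> x; exact: expR_ge0.
move=> x; rewrite !normal_pdfE ?gt_eqF// mul1r mulrCA; congr (_ * _).
rewrite /f /normal_fun -expRD; congr expR; field.
by rewrite gt_eqF.
Qed.

(* The same argument, with the density of variance (s / a)^2 for a close to 1. *)
Lemma gaussian_variance : \int[P]_t (X t ^+ 2) = s ^+ 2.
Proof.
set V := \int[P]_t _.
have s20 : 0 < s ^+ 2 by rewrite exprn_gt0.
have V0 : 0 <= V by apply: Rintegral_ge0 => t _; exact: sqr_ge0.
have H a : 0 < a -> a * (1 - (a ^+ 2 - 1) / (s ^+ 2 *+ 2) * V) <= 1.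
  move=> a0.
  pose f x := a * expR (- ((a ^+ 2 - 1) / (s ^+ 2 *+ 2)) * x ^+ 2).
  rewrite (_ : a * _ = (- (a * ((a ^+ 2 - 1) / (s ^+ 2 *+ 2)))) * V + a); last by ring.
  apply: (affine_le (f := f)) => [|x|x|].
  - apply: measurable_funM => //; apply: measurableT_comp => //; apply: measurable_funM => //.
  - rewrite /f -mulrN -mulrA -[in X in _ + X](mulr1 a) -mulrDr ler_wpM2l ?(ltW a0)// addrC.
    exact: expR_ge1Dx.
  - by rewrite mulr_ge0 ?expR_ge0// ltW.
  apply: (@integral_ratio 0 (a^-1 * s) f) => //.
  - by rewrite mulr_gt0 ?invr_gt0.
  - apply: measurable_funM => //; apply: measurableT_comp => //; apply: measurable_funM => //.
  - by move=> x; rewrite mulr_ge0 ?expR_ge0// ltW.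
  move=> x; rewrite !normal_pdfE ?gt_eqF ?mulr_gt0 ?invr_gt0//= peakE ?invr_gt0// invrK mul1r.
  have -> : normal_fun 0 (a^-1 * s) x =
      expR (- ((a ^+ 2 - 1) / (s ^+ 2 *+ 2)) * x ^+ 2) * normal_fun 0 s x.
    rewrite /normal_fun -expRD; congr expR; field.
    by rewrite !gt_eqF.
  by rewrite /f; ring.
pose N := V / s ^+ 2.
have NE : V = N * s ^+ 2 by rewrite divfK// gt_eqF.
have N0 : 0 <= N by rewrite divr_ge0// ltW.
have H' b : 0 < 1 + b -> b <= (1 + b) * (b + b ^+ 2 / 2) * N.
  move=> b0; have := H (1 + b) b0; rewrite NE.
  rewrite (_ : _ / _ * _ = (b + b ^+ 2 / 2) * N); last by field; rewrite gt_eqF.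
  by rewrite mulrBr mulr1 mulrA; lra.
(* Dividing [H'] by b and letting b tend to 0 from either side would give N = 1. Explicit values
   replace the limits: b = -(N - 1)/(4 N) if N > 1, and b = (1 - N)/4 if N < 1. *)
rewrite NE -[RHS]mul1r; congr (_ * _); apply/eqP; rewrite eq_le; apply/andP; split.
  rewrite leNgt; apply/negP => N1.
  pose c := (N - 1) / (N *+ 4).
  have Np : 0 < N by lra.
  have c0 : 0 < c by rewrite divr_gt0 ?pmulrn_lgt0//; lra.
  have cN : c * (N *+ 4) = N - 1 by rewrite divfK// gt_eqF// pmulrn_lgt0.
  have c1 : c < 1 by rewrite ltr_pdivrMr ?pmulrn_lgt0//; lra.
  have := H' (- c); nra.
rewrite leNgt; apply/negP => N1.
pose b := (1 - N) / 4; have b0 : 0 < b by rewrite divr_gt0//; lra.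
have Nb : N = 1 - 4 * b by rewrite /b; field.
have b2 : 0 < b ^+ 2 by rewrite exprn_gt0.
have b3 : 0 < b ^+ 3 by rewrite exprn_gt0.
have b4 : 0 < b ^+ 4 by rewrite exprn_gt0.
have b1 : 0 < 1 + b by lra.
have := H' b b1; rewrite Nb; lra.
Qed.

End GaussianMoments.

(** * Products of independent random variables *)

Section IndependentProduct.
Context d (T : measurableType d) (R : realType) (P : probability T R).

(** Agreement on rectangles identifies the joint law with the product of the laws. Tonelli on |xy|
    gives integrability, then Fubini factors the integral. *)
Lemma expectation_indep_prod (X Z : T -> R) :
  P.-integrable setT (EFin \o X) -> P.-integrable setT (EFin \o Z) ->
  (forall A B : set R, measurable A -> measurable B ->
    P (X @^-1` A `&` Z @^-1` B) = (P (X @^-1` A) * P (Z @^-1` B))%E) ->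
  P.-integrable setT (EFin \o (fun t => X t * Z t)) /\
  \int[P]_t (X t * Z t) = \int[P]_t X t * \int[P]_t Z t.
Proof.
move=> iX iZ XZ.
have mX : measurable_fun setT X by apply/measurable_EFinP; exact: measurable_int iX.
have mZ : measurable_fun setT Z by apply/measurable_EFinP; exact: measurable_int iZ.
have mV : measurable_fun setT (fun t => (X t, Z t)) by apply/measurable_fun_pair.
pose X' : {mfun T >-> R} := HB.pack X (isMeasurableFun.Build _ _ _ _ _ mX).
pose Z' : {mfun T >-> R} := HB.pack Z (isMeasurableFun.Build _ _ _ _ _ mZ).
pose V' : {mfun T >-> (R * R)%type} :=
  HB.pack (fun t => (X t, Z t)) (isMeasurableFun.Build _ _ _ _ _ mV).
have jointE (A : set (R * R)) : measurable A ->
    (distribution P X' \x distribution P Z')%E A = distribution P V' A.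
  apply: product_measure_unique => B C mB mC.
  by rewrite -[RHS](XZ B C mB mC).
pose h (p : R * R) := (p.1 * p.2)%:E.
have mh : measurable_fun setT h.
  by apply/measurable_EFinP; apply: measurable_funM; [exact: measurable_fst|exact: measurable_snd].
have mha : measurable_fun setT (fun p => `|h p|%E) by apply: measurableT_comp.
have fX : (\int[P]_t `|X t|%:E < +oo)%E by have /integrableP[] := iX.
have fZ : (\int[P]_t `|Z t|%:E < +oo)%E by have /integrableP[] := iZ.
have mn : measurable_fun setT (fun x : R => `|x|%:E).
  by apply/measurable_EFinP; exact: normr_measurable.
have EX : (\int[distribution P X']_x `|x|%:E = \int[P]_t `|X t|%:E)%E.
  by rewrite ge0_integral_distribution.
have EZ : (\int[distribution P Z']_x `|x|%:E = \int[P]_t `|Z t|%:E)%E.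
  by rewrite ge0_integral_distribution.
have ih : (distribution P X' \x distribution P Z')%E.-integrable setT h.
  apply/integrable12ltyP => //.
  under eq_integral => x _.
    under eq_integral => y _ do rewrite /h /= normrM EFinM.
    rewrite ge0_integralZl// EZ.
    over.
  rewrite /= ge0_integralZr//; last by apply: integral_ge0.
  by rewrite EX lte_mul_pinfty// ?integral_ge0// ge0_fin_numE// integral_ge0.
have iV : P.-integrable setT (EFin \o (fun t => X t * Z t)).
  apply/integrableP; split; first by apply/measurable_EFinP; exact: measurable_funM.
  have /integrableP[_] := ih.
  rewrite (eq_measure_integral (distribution P V')) => [|A mA _]; last exact: jointE.
  by rewrite ge0_integral_distribution.
split=> //; rewrite /Rintegral.
transitivity (fine (\int[distribution P V']_p h p)).
  by rewrite integral_distribution.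
have <- : (\int[distribution P X' \x distribution P Z']_p h p =
    \int[distribution P V']_p h p)%E.
  by apply: eq_measure_integral => A mA _; exact: jointE.
rewrite -integral12_prod_meas1//.
have iZ' : (distribution P Z').-integrable setT (EFin \o id).
  apply/integrableP; split; first exact/measurable_EFinP.
  by rewrite [ltLHS]EZ.
have iX' : (distribution P X').-integrable setT (EFin \o id).
  apply/integrableP; split; first exact/measurable_EFinP.
  by rewrite [ltLHS]EX.
have E1 : (\int[distribution P X']_x x%:E = \int[P]_t (X t)%:E)%E.
  by rewrite integral_distribution//; exact/measurable_EFinP.
have E2 : (\int[distribution P Z']_x x%:E = \int[P]_t (Z t)%:E)%E.
  by rewrite integral_distribution//; exact/measurable_EFinP.
have fin2 := integrable_fin_num measurableT iZ.
have fin1 := integrable_fin_num measurableT iX.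
transitivity (fine (\int[distribution P X']_x (x%:E * (fine (\int[P]_t (Z t)%:E))%:E)))%E.
  congr fine; apply: eq_integral => x _; rewrite /fubini_F /h /=.
  under eq_integral do rewrite EFinM.
  by rewrite integralZl// E2 fineK.
by rewrite integralZr// E1 fineM.
Qed.

Variables (K : choiceType) (X : K -> T -> R).
Hypothesis mX : forall k, measurable_fun setT (X k).
Hypothesis indX : forall (s : seq K) (A : K -> set R), uniq s ->
  (forall k, measurable (A k)) ->
  P (\bigcap_(k in [set` s]) X k @^-1` A k) = (\prod_(k <- s) P (X k @^-1` A k))%E.

Definition cylinders (s : seq K) : set (set T) :=
  [set C | exists2 A : K -> set R, (forall k, measurable (A k)) &
     C = \bigcap_(k in [set` s]) X k @^-1` A k].

Lemma measurable_preimageX k (A : set R) : measurable A -> measurable (X k @^-1` A).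
Proof. by move=> mA; rewrite -[X in measurable X]setTI; exact: mX. Qed.

Lemma measurable_cylinder (s : seq K) (A : K -> set R) : (forall k, measurable (A k)) ->
  measurable (\bigcap_(k in [set` s]) X k @^-1` A k).
Proof.
move=> mA; rewrite bigcap_seq; apply: bigsetI_measurable => k _.
exact: measurable_preimageX.
Qed.

Lemma cylinder_sub_measurable s : cylinders s `<=` measurable.
Proof. by move=> C [A mA ->]; exact: measurable_cylinder. Qed.

Lemma cylinders_setI s : setI_closed (cylinders s).
Proof.
move=> C D [A mA ->] [B mB ->]; exists (fun k => A k `&` B k).
  by move=> k; exact: measurableI.
apply/seteqP; split => [t [h1 h2] k ks|t h].
  by split; [exact: h1|exact: h2].
by split => k ks; have [] := h k ks.
Qed.

Lemma cylinders_setT s : cylinders s setT.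
Proof. by exists (fun=> setT) => //; apply/seteqP; split. Qed.

(** The finite measures P(B0 [&] B) and P(B0) P(B) of B agree on cylinders, which are stable under
    intersection, hence on the generated sigma-algebra. *)
Lemma indep_cylinders (k0 : K) (s : seq K) (A0 : set R) (B : set T) :
  k0 \notin s -> measurable A0 -> <<s cylinders s >> B ->
  P (X k0 @^-1` A0 `&` B) = (P (X k0 @^-1` A0) * P B)%E.
Proof.
move=> k0s mA0 sB; set B0 := X k0 @^-1` A0.
have mB0 : measurable B0 := measurable_preimageX k0 mA0.
have p0 : 0 <= fine (P B0) by rewrite fine_ge0.
pose m1 := mrestr P mB0.
pose m2 := mscale (NngNum p0) P.
have m2E C : m2 C = (P B0 * P C)%E by rewrite /m2 /mscale /= fineK// fin_num_measure.
suff : m1 B = m2 B by rewrite m2E /m1 /mrestr setIC.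
apply: (@g_sigma_algebra_measure_unique _ R T (cylinders s) (@cylinder_sub_measurable s)
  (fun=> setT)) => //.
- by move=> _; exact: cylinders_setT.
- by rewrite bigcup_const//; exists 0%N.
- exact: cylinders_setI.
- move=> C [A mA ->]; rewrite [RHS]m2E.
  rewrite -[LHS]/(P (\bigcap_(k in [set` s]) X k @^-1` A k `&` B0)).
  have su : [set` s] = [set` undup s] by apply/seteqP; split=> k /=; rewrite mem_undup.
  pose A' k := if k == k0 then A0 else A k.
  have mA' k : measurable (A' k) by rewrite /A'; case: eqP.
  have k0u : k0 \notin undup s by rewrite mem_undup.
  have A'E k : k \in undup s -> A' k = A k.
    by rewrite /A'; case: eqP => // -> ; rewrite (negbTE k0u).
  have -> : \bigcap_(k in [set` s]) X k @^-1` A k `&` B0 =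
      \bigcap_(k in [set` k0 :: undup s]) X k @^-1` A' k.
    rewrite su; apply/seteqP; split => [t [h1 h2] k /=|t h].
      rewrite inE => /orP[/eqP ->|ks]; first by rewrite /A' eqxx.
      by rewrite A'E//; exact: h1.
    split=> [k ks|].
      by rewrite -A'E//; apply: h; rewrite /= inE; apply/orP; right.
    by have := h k0; rewrite /A' eqxx; apply; rewrite /= inE eqxx.
  rewrite indX//; last by rewrite /= k0u undup_uniq.
  rewrite big_cons {1}/A' eqxx; congr (_ * _)%E.
  rewrite su indX ?undup_uniq//.
  by apply: eq_big_seq => k ks; rewrite A'E.
- move=> _; rewrite -[X in (X < _)%E]/(P (setT `&` B0)) setTI.
  by rewrite -ge0_fin_numE// fin_num_measure.
Qed.

Lemma measurable_cylinders_fun s k (A : set R) : k \in s -> measurable A ->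
  <<s cylinders s >> (X k @^-1` A).
Proof.
move=> ks mA; apply: sub_sigma_algebra.
exists (fun k' => if k' == k then A else setT); first by move=> k'; case: eqP.
apply/seteqP; split => [t h k' _|t /(_ k ks)] /=; last by rewrite eqxx.
by case: eqP => // ->.
Qed.

Lemma measurable_cylinders_prod s (B : set R) : measurable B ->
  <<s cylinders s >> ((fun t => \prod_(k <- s) X k t) @^-1` B).
Proof.
move=> mB.
have mk k : k \in s -> measurable_fun setT (X k : g_sigma_algebraType (cylinders s) -> R).
  by move=> ks _ A mA; rewrite setTI; exact: measurable_cylinders_fun.
have := @measurable_prod _ (g_sigma_algebraType (cylinders s)) R setT K s X mk measurableT B mB.
by rewrite setTI.
Qed.

Lemma expectation_prod_indep k0 (s : seq K) (f : R -> R) : k0 \notin s ->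
  measurable_fun setT f -> P.-integrable setT (EFin \o (fun t => f (X k0 t))) ->
  P.-integrable setT (EFin \o (fun t => \prod_(k <- s) X k t)) ->
  \int[P]_t (f (X k0 t) * \prod_(k <- s) X k t) =
  \int[P]_t f (X k0 t) * \int[P]_t (\prod_(k <- s) X k t).
Proof.
move=> k0s mf i1 i2; apply: (expectation_indep_prod i1 i2 _).2 => A B mA mB.
rewrite (_ : (fun t => f (X k0 t)) @^-1` A = X k0 @^-1` (f @^-1` A))//.
apply: (@indep_cylinders _ s); first exact: k0s.
  by rewrite -[X in measurable X]setTI; exact: mf.
exact: measurable_cylinders_prod.
Qed.

End IndependentProduct.

(** * Traces as sums over walks *)

Section PathSum.
Variable n : nat.

(** The sum over all sequences of length m, as iterated sums over lists: splitting off the first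
    vertex is then a computation step, as the recursions on walks require. *)
Fixpoint psum (V : nmodType) (m : nat) (F : seq 'I_n -> V) : V :=
  match m with
  | 0 => F [::]
  | m'.+1 => \sum_(y < n) psum m' (fun ys => F (y :: ys))
  end.

Lemma eq_psum (V : nmodType) m (F G : seq 'I_n -> V) : F =1 G -> psum m F = psum m G.
Proof. by move=> /funext ->. Qed.

Lemma psumZ (A : pzRingType) m c (F : seq 'I_n -> A) :
  psum m (fun ys => c * F ys) = c * psum m F.
Proof.
elim: m F => // m IH F /=; rewrite mulr_sumr.
by apply: eq_bigr => y _; rewrite IH.
Qed.

Lemma psum_additive (V W : nmodType) (f : {additive V -> W}) m (F : seq 'I_n -> V) :
  f (psum m F) = psum m (fun ys => f (F ys)).
Proof.
elim: m F => // m IH F /=; rewrite raddf_sum.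
by apply: eq_bigr => y _; rewrite IH.
Qed.

Lemma psumD (V : nmodType) m (F G : seq 'I_n -> V) :
  psum m (fun ys => F ys + G ys) = psum m F + psum m G.
Proof.
elim: m F G => // m IH F G /=; rewrite -big_split.
by apply: eq_bigr => y _; rewrite IH.
Qed.

Lemma le_psum (A : numDomainType) m (F G : seq 'I_n -> A) :
  (forall ys, size ys = m -> F ys <= G ys) -> psum m F <= psum m G.
Proof.
elim: m F G => [|m IH] F G FG /=; first exact: FG.
by apply: ler_sum => y _; apply: IH => ys sy; apply: FG; rewrite /= sy.
Qed.

End PathSum.

(** * Expectations of words in the matrix entries *)

Section MatrixEntries.
Context (R : realType) (d : measure_display) (T : measurableType d) (P : probability T R).
Context (U : countType) (n : nat) (Y : U -> T -> 'M[R[i]]_n).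
Hypothesis n0 : (0 < n)%N.
Hypothesis HY : independent_sut_gaussian P Y.

Definition matkey : Type := (U * entry_index n)%type.
HB.instance Definition _ := Choice.on matkey.

Definition matvar (k : matkey) : T -> R := entry (Y k.1) k.2.

Lemma measurable_matvar k : measurable_fun setT (matvar k).
Proof. by case: HY => _ + _ _ => /(_ k.1 k.2) []. Qed.

Definition all_entries : seq (entry_index n) :=
  enum {: {p : 'I_n * 'I_n | (p.1 < p.2)%N} * bool}.

Lemma mem_all_entries k : k \in all_entries.
Proof. exact: (@mem_enum {: {p : 'I_n * 'I_n | (p.1 < p.2)%N} * bool}). Qed.

Lemma all_entries_uniq : uniq all_entries.
Proof. exact: enum_uniq. Qed.

Lemma sigma_of_preimage (K : Type) (X : K -> T -> R) k (A : set R) : measurable A ->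
  sigma_of X (X k @^-1` A).
Proof.
move=> mA; apply: sub_sigma_algebra; exists k => //.
by exists A => //; rewrite setTI.
Qed.

Lemma sigma_algebra_bigsetI (G : set (set T)) I (r : seq I) (F : I -> set T) :
  (forall i, <<s G >> (F i)) -> <<s G >> (\big[setI/setT]_(i <- r) F i).
Proof.
move=> GF; elim/big_ind : _ => //.
- exact: (@measurableT _ (g_sigma_algebraType G)).
- by move=> A B; exact: (@measurableI _ (g_sigma_algebraType G)).
Qed.

(** Independence is given on two levels, between the families and inside each of them. To combine
    them, the list is completed to all entries of every [u] that occurs, with the full set as
    condition on the added ones. *)
Lemma matvar_indep (s : seq matkey) (A : matkey -> set R) : uniq s ->
  (forall k, measurable (A k)) ->
  P (\bigcap_(k in [set` s]) matvar k @^-1` A k) = (\prod_(k <- s) P (matvar k @^-1` A k))%E.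
Proof.
move=> us mA; case: HY => _ _ H3 H4.
pose A' k := if k \in s then A k else setT.
have mA' k : measurable (A' k) by rewrite /A'; case: ifP.
pose vs := undup [seq k.1 | k <- s].
pose C u := \bigcap_(k in [set` all_entries]) entry (Y u) k @^-1` A' (u, k).
have -> : \bigcap_(k in [set` s]) matvar k @^-1` A k = \bigcap_(u in [set` vs]) C u.
  apply/seteqP; split=> [t h u _ k _|t h [u k] ks].
    by rewrite /A' /=; case: ifPn => // ks; exact: (h (u, k) ks).
  have uv : u \in vs by rewrite mem_undup; apply/mapP; exists (u, k).
  by have := h u uv k (mem_all_entries k); rewrite /A' ks.
rewrite H4 ?undup_uniq//; last first.
  move=> u _.
  rewrite /C bigcap_seq; apply: sigma_algebra_bigsetI => k.
  exact: (@sigma_of_preimage _ (entry (Y u)) k).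
transitivity (\prod_(u <- vs) \prod_(k <- all_entries) P (matvar (u, k) @^-1` A' (u, k)))%E.
  apply: eq_bigr => u _; apply: H3; first exact: all_entries_uniq.
  by move=> k _; exact: (@sigma_of_preimage unit (fun=> entry (Y u) k) tt).
transitivity (\prod_(k <- [seq (u, k) | u <- vs, k <- all_entries])
    P (matvar k @^-1` A' k))%E.
  by rewrite big_allpairs.
transitivity (\prod_(k <- [seq (u, k) | u <- vs, k <- all_entries] | k \in s)
    P (matvar k @^-1` A k))%E.
  rewrite [RHS]big_mkcond; apply: eq_bigr => k _; rewrite /A'; case: ifP => // _.
  by rewrite preimage_setT probability_setT.
rewrite -big_filter; apply: perm_big; apply: uniq_perm => //.
  apply: filter_uniq; apply: allpairs_uniq; rewrite ?undup_uniq ?all_entries_uniq//.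
  by move=> [? ?] [? ?] _ _ [-> ->].
move=> [u k]; rewrite mem_filter andb_idr// => ks.
apply/allpairsP; exists (u, k); split=> //=; last exact: mem_all_entries.
by rewrite mem_undup; apply/mapP; exists (u, k).
Qed.

Local Notation sd := (Num.sqrt (2 * n)%:R^-1 : R).

Lemma sd_gt0 : 0 < sd.
Proof. by rewrite sqrtr_gt0 invr_gt0 ltr0n muln_gt0. Qed.

Lemma sqr_sd : sd ^+ 2 = (2 * n)%:R^-1.
Proof. by rewrite sqr_sqrtr// invr_ge0 ler0n. Qed.

Lemma matvar_law k (A : set R) : measurable A -> P (matvar k @^-1` A) = normal_prob 0 sd A.
Proof. by case: HY => _ + _ _ => /(_ k.1 k.2) [_]; apply. Qed.

Definition absmom m : R := 1 + m`!%:R * Num.sqrt 2 * 4 ^+ m.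

Lemma absmom_ge0 m : 0 <= absmom m.
Proof. by rewrite addr_ge0// mulr_ge0 ?mulr_ge0 ?exprn_ge0 ?sqrtr_ge0. Qed.

Lemma integrable_absX k m : P.-integrable setT (EFin \o (fun t => `|matvar k t| ^+ m)).
Proof.
have := integrable_gaussianX sd_gt0 (measurable_matvar k) (@matvar_law k) m.
move=> /integrable_norm; apply: eq_integrable => // t _ /=.
by rewrite normrX.
Qed.

(** |x|^m <= s^m + s^(-m) x^(2m) passes to even moments; the two summands of [absmom] come from
    these two terms. *)
Lemma abs_moment_le k m : \int[P]_t (`|matvar k t| ^+ m) <= absmom m * sd ^+ m.
Proof.
have s0 := sd_gt0.
have mX := measurable_matvar k.
have i2 := integrable_gaussianX s0 mX (@matvar_law k) m.*2.
have i1 : P.-integrable setT (EFin \o (fun=> sd ^+ m)) by exact: finite_measure_integrable_cst.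
have i3 := integrableD measurableT i1 (integrableZl measurableT (sd ^+ m)^-1 i2).
apply: (@le_trans _ _ (\int[P]_t (sd ^+ m + (sd ^+ m)^-1 * matvar k t ^+ m.*2))).
  apply: le_Rintegral => //; first exact: integrable_absX.
  move=> t _; have sm : 0 < sd ^+ m by rewrite exprn_gt0.
  have -> : matvar k t ^+ m.*2 = `|matvar k t ^+ m| ^+ 2.
    by rewrite real_normK ?num_real// -exprM muln2.
  rewrite -normrX.
  move: `|matvar k t ^+ m| (normr_ge0 (matvar k t ^+ m)) => a a0.
  rewrite -(ler_pM2l sm) mulrDr mulrA mulfV ?gt_eqF// mul1r.
  have := sqr_ge0 (sd ^+ m - a); have := sqr_ge0 (sd ^+ m + a); nra.
rewrite RintegralD//; last exact: (integrableZl measurableT (sd ^+ m)^-1 i2).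
rewrite Rintegral_cst// (congr1 (@fine R) (probability_setT P)) mulr1 RintegralZl//.
rewrite /absmom mulrDl mul1r lerD2l.
have := gaussian_even_moment s0 mX (@matvar_law k) m.
have := integrable_fin_num measurableT i2.
rewrite /Rintegral /= => /fineK <-; rewrite lee_fin => /= h.
apply: le_trans (ler_wpM2l _ h) _; first by rewrite invr_ge0 exprn_ge0// ltW.
have -> : (sd ^+ 2 *+ 4) ^+ m = 4 ^+ m * (sd ^+ m) ^+ 2.
  by rewrite -(mulr_natl (sd ^+ 2) 4) exprMn -!exprM (mulnC 2 m).
have sm : sd ^+ m != 0 by rewrite expf_neq0// gt_eqF.
by rewrite le_eqVlt; apply/orP; left; apply/eqP; field.
Qed.

Definition mono (l : seq matkey) (t : T) : R := \prod_(k <- l) matvar k t.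

Lemma measurable_mono l : measurable_fun setT (mono l).
Proof. by apply: measurable_prod => k _; exact: measurable_matvar. Qed.

(** The factor of largest modulus serves. This takes the place of Hölder's inequality: the factors
    of a monomial may repeat, so they need not be independent. *)
Lemma prod_norm_le_max (l : seq matkey) t : l != [::] ->
  exists2 k, k \in l & `|mono l t| <= `|matvar k t| ^+ size l.
Proof.
elim: l => // k l IH _; have [->|l0] := eqVneq l [::].
  by exists k; rewrite ?mem_head// /mono big_seq1 expr1.
have [k' k'l h] := IH l0; rewrite /mono big_cons normrM.
have [kk|kk] := leP `|matvar k t| `|matvar k' t|.
  by exists k'; rewrite ?inE ?k'l ?orbT//= exprS ler_pM.
exists k; rewrite ?mem_head//= exprS ler_wpM2l//.
by apply: le_trans h _; rewrite lerXn2r ?nnegrE// ltW.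
Qed.

Lemma mono_le_sum (l : seq matkey) t : l != [::] ->
  `|mono l t| <= \sum_(k <- l) `|matvar k t| ^+ size l.
Proof.
move=> l0; have [k kl h] := prod_norm_le_max t l0; apply: le_trans h _.
by rewrite (big_rem k)//= lerDl sumr_ge0.
Qed.

Lemma integrable_mono l : P.-integrable setT (EFin \o mono l).
Proof.
have [->|l0] := eqVneq l [::].
  rewrite (_ : mono [::] = fun=> 1); first exact: finite_measure_integrable_cst.
  by apply/funext => t; rewrite /mono big_nil.
have := @integrable_sum _ _ _ P setT measurableT _ l xpredT
  (fun k t => (`|matvar k t| ^+ size l)%:E) (fun k _ => integrable_absX k (size l)).
apply: le_integrable => //; first by apply/measurable_EFinP; exact: measurable_mono.
move=> t _ /=; rewrite sumEFin gee0_abs ?lee_fin; first exact: mono_le_sum.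
by rewrite sumr_ge0.
Qed.

(** The summand 1 covers the empty monomial, where the sum over the factors is 0 but the expectation
    is 1. *)
Definition momC m : R := 1 + m%:R * absmom m.

Lemma abs_mono_le l : `|\int[P]_t mono l t| <= momC (size l) * sd ^+ size l.
Proof.
apply: le_trans (le_normr_Rintegral measurableT (integrable_mono l)) _.
have [->|l0] := eqVneq l [::].
  rewrite (_ : \int[P]_t _ = \int[P]_t 1); last first.
    by apply: eq_Rintegral => t _; rewrite /mono big_nil normr1.
  rewrite Rintegral_cst// (congr1 (@fine R) (probability_setT P)) mulr1.
  by rewrite /momC mul0r addr0 expr0 mulr1.
have si (r : seq matkey) : P.-integrable setT
    (EFin \o (fun t => \sum_(k <- r) `|matvar k t| ^+ size l)).
  have := @integrable_sum _ _ _ P setT measurableT _ r xpredT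
    (fun k t => (`|matvar k t| ^+ size l)%:E) (fun k _ => integrable_absX k (size l)).
  by apply: eq_integrable => // t _ /=; rewrite sumEFin.
apply: (@le_trans _ _ (\int[P]_t (\sum_(k <- l) `|matvar k t| ^+ size l))).
  apply: le_Rintegral => //; first by apply: integrable_norm; exact: integrable_mono.
  by move=> t _; exact: mono_le_sum.
have : forall r : seq matkey, \int[P]_t (\sum_(k <- r) `|matvar k t| ^+ size l) <=
    (size r)%:R * absmom (size l) * sd ^+ size l.
  elim=> [|k r IH].
    rewrite (_ : \int[P]_t _ = \int[P]_t 0); last by apply: eq_Rintegral => t _; rewrite big_nil.
    by rewrite Rintegral_cst// !mul0r.
  rewrite (_ : \int[P]_t _ = \int[P]_t (`|matvar k t| ^+ size l +
    \sum_(k <- r) `|matvar k t| ^+ size l)); last by apply: eq_Rintegral => t _; rewrite big_cons.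
  rewrite RintegralD//; last exact: integrable_absX.
  rewrite /= -natr1 -mulrA mulrDl mul1r addrC lerD ?abs_moment_le//.
  by rewrite mulrA.
move=> /(_ l) h; apply: le_trans h _.
by rewrite ler_wpM2r ?exprn_ge0 ?(ltW sd_gt0)// /momC lerDr.
Qed.

Definition cE (f : T -> R[i]) : R[i] :=
  (\int[P]_t Re (f t)) +i* (\int[P]_t Im (f t)).

Definition cintegrable (f : T -> R[i]) : Prop :=
  P.-integrable setT (EFin \o (fun t => Re (f t))) /\
  P.-integrable setT (EFin \o (fun t => Im (f t))).

Lemma cintegrableD f g : cintegrable f -> cintegrable g -> cintegrable (fun t => f t + g t).
Proof.
move=> [f1 f2] [g1 g2]; split.
- by apply: eq_integrable (integrableD measurableT f1 g1) => // t _; rewrite /= raddfD.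
- by apply: eq_integrable (integrableD measurableT f2 g2) => // t _; rewrite /= raddfD.
Qed.

Lemma cED f g : cintegrable f -> cintegrable g -> cE (fun t => f t + g t) = cE f + cE g.
Proof.
move=> [f1 f2] [g1 g2]; rewrite /cE.
apply/eqP; rewrite eq_complex; apply/andP; split; apply/eqP => /=.
- by rewrite -RintegralD//; apply: eq_Rintegral => t _; rewrite raddfD.
- by rewrite -RintegralD//; apply: eq_Rintegral => t _; rewrite raddfD.
Qed.

Lemma cintegrableZ c f : cintegrable f -> cintegrable (fun t => c * f t).
Proof.
move=> [f1 f2]; split.
- apply: eq_integrable (integrableB measurableT (integrableZl measurableT (Re c) f1)
    (integrableZl measurableT (Im c) f2)) => // t _ /=.
  by case: c (f t) => a b [x y].
- apply: eq_integrable (integrableD measurableT (integrableZl measurableT (Re c) f2)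
    (integrableZl measurableT (Im c) f1)) => // t _ /=.
  by case: c (f t) => a b [x y].
Qed.

Lemma cEZ c f : cintegrable f -> cE (fun t => c * f t) = c * cE f.
Proof.
move=> [f1 f2]; case: c => a b; rewrite /cE.
apply/eqP; rewrite eq_complex; apply/andP; split; apply/eqP => /=.
- rewrite -!RintegralZl// -RintegralB//; last 2 first.
  + exact: (integrableZl measurableT a f1).
  + exact: (integrableZl measurableT b f2).
  by apply: eq_Rintegral => t _; case: (f t).
- rewrite -!RintegralZl// -RintegralD//; last 2 first.
  + exact: (integrableZl measurableT a f2).
  + exact: (integrableZl measurableT b f1).
  by apply: eq_Rintegral => t _; case: (f t).
Qed.

Lemma cintegrable0 : cintegrable (fun _ => 0).
Proof.
by split; rewrite (_ : _ \o _ = cst 0%E) ?integrable0//; apply/funext => t.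
Qed.

Lemma cE0 : cE (fun _ => 0) = 0.
Proof. by rewrite /cE !Rintegral_cst// !mul0r. Qed.

Lemma cintegrable_sum (I : Type) (r : seq I) (F : I -> T -> R[i]) :
  (forall i, cintegrable (F i)) -> cintegrable (fun t => \sum_(i <- r) F i t).
Proof.
move=> iF; elim: r => [|i r IH].
  rewrite (_ : (fun t => _) = fun _ => 0); first exact: cintegrable0.
  by apply/funext => t; rewrite big_nil.
rewrite (_ : (fun t => _) = fun t => F i t + \sum_(i <- r) F i t); first exact: cintegrableD.
by apply/funext => t; rewrite big_cons.
Qed.

Lemma cE_sum (I : Type) (r : seq I) (F : I -> T -> R[i]) :
  (forall i, cintegrable (F i)) ->
  cE (fun t => \sum_(i <- r) F i t) = \sum_(i <- r) cE (F i).
Proof.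
move=> iF; elim: r => [|i r IH].
  rewrite (_ : (fun t => _) = fun _ => 0) ?cE0 ?big_nil//.
  by apply/funext => t; rewrite big_nil.
rewrite big_cons -IH -cED//; last exact: cintegrable_sum.
by congr cE; apply/funext => t; rewrite big_cons.
Qed.

Lemma cintegrable_real (h : T -> R) : P.-integrable setT (EFin \o h) ->
  cintegrable (fun t => (h t)%:C).
Proof.
move=> ih; split=> //=.
by rewrite (_ : _ \o _ = cst 0%E) ?integrable0//; apply/funext => t.
Qed.

Lemma cE_real (h : T -> R) : cE (fun t => (h t)%:C) = (\int[P]_t h t)%:C.
Proof. by rewrite /cE Rintegral_cst// mul0r. Qed.

Definition evpol (r : seq (R[i] * seq matkey)) (t : T) : R[i] :=
  \sum_(x <- r) x.1 * (mono x.2 t)%:C.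

Lemma cintegrable_evpol r : cintegrable (evpol r).
Proof.
apply: cintegrable_sum => x; apply: cintegrableZ; apply: cintegrable_real.
exact: integrable_mono.
Qed.

Lemma cE_evpol r : cE (evpol r) = \sum_(x <- r) x.1 * (\int[P]_t mono x.2 t)%:C.
Proof.
rewrite cE_sum; last first.
  by move=> x; apply: cintegrableZ; apply: cintegrable_real; exact: integrable_mono.
apply: eq_bigr => x _; rewrite cEZ ?cE_real//.
by apply: cintegrable_real; exact: integrable_mono.
Qed.

(** A variable absent from all monomials splits off by independence. It is applied with j = 1 to a
    letter that stands alone and with j = 2 to a dual pair. *)
Lemma cE_mul_evpol k0 j r : all (fun x => k0 \notin x.2) r ->
  cintegrable (fun t => (matvar k0 t ^+ j)%:C * evpol r t) /\
  cE (fun t => (matvar k0 t ^+ j)%:C * evpol r t) =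
  (\int[P]_t (matvar k0 t ^+ j))%:C * cE (evpol r).
Proof.
move=> /allP k0r.
have iX := integrable_gaussianX sd_gt0 (measurable_matvar k0) (@matvar_law k0) j.
have mf : measurable_fun setT (fun x : R => x ^+ j) by exact: measurable_funX.
have E x : x \in r -> P.-integrable setT (EFin \o (fun t => matvar k0 t ^+ j * mono x.2 t)) /\
    \int[P]_t (matvar k0 t ^+ j * mono x.2 t) =
    \int[P]_t (matvar k0 t ^+ j) * \int[P]_t mono x.2 t.
  move=> xr; split; last exact: (expectation_prod_indep measurable_matvar matvar_indep
    (k0r x xr) mf iX (integrable_mono x.2)).
  have := integrable_mono (nseq j k0 ++ x.2).
  apply: eq_integrable => // t _ /=; rewrite /mono big_cat /= big_nseq -Monoid.iteropE.
  by rewrite -/(GRing.exp _ _).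
elim: r k0r E => [|x r IH] k0r E.
  rewrite (_ : evpol [::] = fun _ => 0); last by apply/funext => t; rewrite /evpol big_nil.
  rewrite (_ : (fun t => _) = fun _ => 0); last by apply/funext => t; rewrite mulr0.
  by rewrite cE0 mulr0; split=> //; exact: cintegrable0.
have rs y : y \in r -> y \in x :: r by rewrite inE orbC => ->.
have [i1 e1] := IH (fun y yr => k0r y (rs y yr)) (fun y yr => E y (rs y yr)).
have [i2 e2] := E x (mem_head _ _).
have -> : (fun t => (matvar k0 t ^+ j)%:C * evpol (x :: r) t) = (fun t =>
   x.1 * (matvar k0 t ^+ j * mono x.2 t)%:C + (matvar k0 t ^+ j)%:C * evpol r t).
  by apply/funext => t; rewrite /evpol big_cons mulrDr rmorphM /=; congr (_ + _); ring.
have i3 := cintegrableZ x.1 (cintegrable_real i2).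
split; first exact: cintegrableD.
rewrite cED// cEZ; last exact: cintegrable_real.
by rewrite cE_real e2 e1 !cE_evpol big_cons mulrDr rmorphM /=; congr (_ + _); ring.
Qed.

(* [((e, u), (i, j))] stands for the entry (i, j) of Y(u)^e, which is the entry [opos] of
   Y(u), or its conjugate. *)
Definition wletter : Type := (bool * U * ('I_n * 'I_n))%type.
HB.instance Definition _ := Choice.on wletter.

Implicit Types (a : wletter) (s : seq wletter).

Definition ent a (t : T) : R[i] := mx_exp a.1.1 (Y a.1.2 t) a.2.1 a.2.2.

Definition opos a : 'I_n * 'I_n := if a.1.1 then (a.2.2, a.2.1) else a.2.

Definition ordered a : bool := ((opos a).1 < (opos a).2)%N.

(** [lpos] says which random variable is read, [opos] only which edge is used; one edge may be
    crossed with different, hence independent, variables. *)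
Definition lpos a : U * ('I_n * 'I_n) := (a.1.2, opos a).

Definition dual a : wletter := (~~ a.1.1, a.1.2, (a.2.2, a.2.1)).

Lemma ent_unordered a t : ~~ ordered a -> ent a t = 0.
Proof.
case: HY => Y0 _ _ _; case: a => [[[] u] [i j]]; rewrite /ordered /opos /= -leqNgt => ij.
  by rewrite /ent /mx_exp /= !mxE Y0// conjC0.
by rewrite /ent /mx_exp /= Y0.
Qed.

Lemma ent_dual a t : ent (dual a) t = (ent a t)^*.
Proof.
case: a => [[[] u] [i j]]; rewrite /ent /dual /mx_exp /= !mxE//.
exact: (esym (conjCK _)).
Qed.

Definition imunit (e : bool) : R[i] := if e then 0 -i* 1 else 0 +i* 1.

Definition akey a (o : ordered a) b : matkey :=
  (a.1.2, (exist (fun p : 'I_n * 'I_n => (p.1 < p.2)%N) (opos a) o, b)).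

Lemma ent_ordered a (o : ordered a) t : ent a t =
  (matvar (akey o false) t)%:C + imunit a.1.1 * (matvar (akey o true) t)%:C.
Proof.
case: a o => [[[] u] [i j]] o; rewrite /ent /mx_exp /matvar /entry /opos /= ?mxE.
  by case: (Y u t j i) => x y; apply/eqP; rewrite eq_complex /=; apply/andP; split; apply/eqP; ring.
by case: (Y u t i j) => x y; apply/eqP; rewrite eq_complex /=; apply/andP; split; apply/eqP; ring.
Qed.

Definition wprod s (t : T) : R[i] := \prod_(a <- s) ent a t.

Lemma wprod_unordered s t : ~~ all ordered s -> wprod s t = 0.
Proof.
rewrite -has_predC => /hasP[a al /= na]; rewrite /wprod (big_rem a)//=.
by rewrite ent_unordered// mul0r.
Qed.

Definition kpos (k : matkey) : U * ('I_n * 'I_n) := (k.1, val k.2.1).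

Definition goodterm s (x : R[i] * seq matkey) : Prop :=
  [/\ size x.2 = size s, (forall k, k \in x.2 -> kpos k \in [seq lpos a | a <- s]),
      `|Re x.1| <= 1 & `|Im x.1| <= 1].

(** Each entry is x + iy or x - iy with two real variables, so m letters expand into 2^m monomials
    whose coefficients are powers of i. *)
Lemma wprod_evpol s : all ordered s -> exists r,
  [/\ wprod s = evpol r, (forall x, x \in r -> goodterm s x) & size r = (2 ^ size s)%N].
Proof.
elim: s => [_|a s IH oas].
  exists [:: (1, [::])]; split=> //.
    apply/funext => t; rewrite /wprod /evpol big_nil big_seq1 mul1r /mono big_nil//.
  by move=> x; rewrite inE => /eqP ->; split=> //=; rewrite ?normr1 ?normr0.
have /andP[oa os] : ordered a && all ordered s by exact: oas.
have [r [er gr sr]] := IH os.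
exists ([seq (x.1, akey oa false :: x.2) | x <- r] ++
        [seq (imunit a.1.1 * x.1, akey oa true :: x.2) | x <- r]); split.
- apply/funext => t; rewrite /wprod big_cons -/(wprod s t) er /evpol big_cat !big_map /=.
  rewrite (ent_ordered oa) mulrDl !mulr_sumr; congr (_ + _); apply: eq_bigr => x _;
    by rewrite /mono big_cons rmorphM /=; ring.
- move=> x; rewrite mem_cat => /orP[] /mapP[y yr ->]; have [h1 h2 h3 h4] := gr y yr.
    split=> //=; first by rewrite h1.
    move=> k; rewrite inE => /orP[/eqP ->|ky]; first by rewrite inE eqxx.
    by rewrite inE h2 ?orbT.
  split=> /=; first by rewrite h1.
  - move=> k; rewrite inE => /orP[/eqP ->|ky]; first by rewrite inE eqxx.
    by rewrite inE h2 ?orbT.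
  - case: y {yr h1 h2} h3 h4 => [[p q] l] /=; rewrite /imunit.
    by case: a.1.1 => /=; rewrite !mul0r !(mulN1r, mul1r) ?opprK ?add0r ?sub0r ?opprK ?normrN.
  - case: y {yr h1 h2} h3 h4 => [[p q] l] /=; rewrite /imunit.
    by case: a.1.1 => /=; rewrite !mul0r !(mulN1r, mul1r) ?opprK ?add0r ?sub0r ?opprK ?normrN.
- by rewrite size_cat !size_map sr expnS mul2n addnn.
Qed.

Definition mon s : R[i] := cE (wprod s).

Lemma cintegrable_wprod s : cintegrable (wprod s).
Proof.
have [os|os] := boolP (all ordered s).
  by have [r [-> _ _]] := wprod_evpol os; exact: cintegrable_evpol.
rewrite (_ : wprod s = fun _ => 0); first exact: cintegrable0.
by apply/funext => t; rewrite wprod_unordered.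
Qed.

Lemma mon_unordered s : ~~ all ordered s -> mon s = 0.
Proof.
move=> os; rewrite /mon (_ : wprod s = fun _ => 0) ?cE0//.
by apply/funext => t; rewrite wprod_unordered.
Qed.

Lemma mon_perm s s' : perm_eq s s' -> mon s = mon s'.
Proof. by move=> ss; congr cE; apply/funext => t; exact: perm_big. Qed.

Lemma mon_nil : mon [::] = 1.
Proof.
rewrite /mon (_ : wprod [::] = fun _ => 1%:C).
  by rewrite cE_real Rintegral_cst// (congr1 (@fine R) (probability_setT P)) mulr1.
by apply/funext => t; rewrite /wprod big_nil.
Qed.

(** Real and imaginary part of the isolated entry are each independent of the remaining word and
    centred. *)
Lemma mon_single a s : lpos a \notin [seq lpos b | b <- s] -> mon (a :: s) = 0.
Proof.
move=> na; have [oas|os] := boolP (all ordered (a :: s)); last exact: mon_unordered.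
have /andP[oa os] : ordered a && all ordered s by exact: oas.
have [r [er gr _]] := wprod_evpol os.
have kr b : all (fun x => akey oa b \notin x.2) r.
  apply/allP => x xr; apply/negP => kx; have [_ h _ _] := gr x xr.
  by move: na; rewrite (h _ kx : lpos a \in _).
have [i1 e1] := cE_mul_evpol 1 (kr false).
have [i2 e2] := cE_mul_evpol 1 (kr true).
have m0 k : \int[P]_t (matvar k t ^+ 1) = 0.
  rewrite -[RHS](gaussian_mean sd_gt0 (measurable_matvar k) (@matvar_law k)).
  by apply: eq_Rintegral => t _; rewrite expr1.
rewrite /mon (_ : wprod (a :: s) = fun t => (matvar (akey oa false) t ^+ 1)%:C * evpol r t +
  imunit a.1.1 * ((matvar (akey oa true) t ^+ 1)%:C * evpol r t)); last first.
  apply/funext => t; rewrite /wprod big_cons -/(wprod s t) er (ent_ordered oa) !expr1.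
  by rewrite mulrDl mulrA.
rewrite cED//; last exact: cintegrableZ.
by rewrite cEZ// e1 e2 !m0 !mul0r mulr0 addr0.
Qed.

(** An entry times its conjugate is x^2 + y^2; both squares have mean 1/(2n) and are independent of
    the rest. *)
Lemma mon_pair a s : ordered a -> lpos a \notin [seq lpos b | b <- s] ->
  mon (a :: dual a :: s) = n%:R^-1%:C * mon s.
Proof.
move=> o na; have [os|os] := boolP (all ordered s); last first.
  by rewrite !mon_unordered ?mulr0//= !negb_and os !orbT.
have [r [er gr _]] := wprod_evpol os.
have kr b : all (fun x => akey o b \notin x.2) r.
  apply/allP => x xr; apply/negP => kx; have [_ h _ _] := gr x xr.
  by move: na; rewrite (h _ kx : lpos a \in _).
have [i1 e1] := cE_mul_evpol 2 (kr false).
have [i2 e2] := cE_mul_evpol 2 (kr true).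
have m2 k : \int[P]_t (matvar k t ^+ 2) = (2 * n)%:R^-1.
  by rewrite (gaussian_variance sd_gt0 (measurable_matvar k) (@matvar_law k)) sqr_sd.
rewrite /mon (_ : wprod (a :: _) = fun t => (matvar (akey o false) t ^+ 2)%:C * evpol r t +
  (matvar (akey o true) t ^+ 2)%:C * evpol r t); last first.
  apply/funext => t; rewrite /wprod !big_cons -/(wprod s t) er ent_dual (ent_ordered o).
  rewrite mulrA -mulrDl; congr (_ * _).
  move: (matvar _ t) (matvar _ t) => x y; rewrite /imunit.
  by case: a.1.1; apply/eqP; rewrite eq_complex /=; apply/andP; split; apply/eqP; ring.
rewrite cED// e1 e2 !m2 -mulrDl er; congr (_ * _); rewrite -rmorphD /=; congr (_%:C).
have nn : n%:R != 0 :> R by rewrite pnatr_eq0 -lt0n.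
by rewrite natrM; field.
Qed.

Definition monC m : R := (2 ^ m)%:R * momC m.

Lemma momC_ge0 m : 0 <= momC m.
Proof. by rewrite addr_ge0// mulr_ge0// absmom_ge0. Qed.

Lemma mon_le s : `|Re (mon s)| <= monC (size s) * sd ^+ size s /\
  `|Im (mon s)| <= monC (size s) * sd ^+ size s.
Proof.
have B0 : 0 <= momC (size s) * sd ^+ size s.
  by rewrite mulr_ge0 ?momC_ge0// exprn_ge0// ltW// sd_gt0.
have [os|os] := boolP (all ordered s); last first.
  by rewrite mon_unordered//= normr0 /monC -mulrA mulr_ge0.
have [r [er gr sr]] := wprod_evpol os.
rewrite /mon er cE_evpol /monC -sr -mulrA.
elim: r gr {er sr} => [|x r IH] gr.
  by rewrite big_nil /= normr0 mul0r.
have rs y : y \in r -> y \in x :: r by rewrite inE orbC => ->.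
have [h1 h2] := IH (fun y yr => gr y (rs y yr)).
have [sx _ p q] := gr x (mem_head _ _).
have mb := abs_mono_le x.2; rewrite sx in mb.
rewrite big_cons -natr1 mulrDl mul1r addrC.
case: x {gr rs sx} p q mb => [[c1 c2] l] /= p q mb.
move: (\int[P]_t mono l t) (\sum_(_ <- r) _) h1 h2 mb => M [z1 z2] /= h1 h2 mb.
have k c : `|c| <= 1 -> `|c * M| <= momC (size s) * sd ^+ size s.
  by move=> c01; rewrite normrM (le_trans _ mb)// ler_piMl.
split; apply: (le_trans (ler_normD _ _)); apply: lerD => //.
- by rewrite mulr0 subr0 k.
- by rewrite mulr0 add0r k.
Qed.

Fixpoint wl (L : seq (bool * U)) (i : 'I_n) (ys : seq 'I_n) : seq wletter :=
  match L, ys with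
  | l :: L', y :: ys' => (l, (i, y)) :: wl L' y ys'
  | _, _ => [::]
  end.

Definition mprod (L : seq (bool * U)) t : 'M[R[i]]_n :=
  foldr (fun l A => mx_exp l.1 (Y l.2 t) *m A) 1%:M L.

Lemma mprodE (L : seq (bool * U)) t i j : mprod L t i j =
  psum (size L) (fun ys => (last i ys == j)%:R * wprod (wl L i ys) t).
Proof.
elim: L i => [|l L IH] i; first by rewrite /= mxE /wprod big_nil mulr1.
rewrite /= mxE; apply: eq_bigr => y _; rewrite IH -psumZ; apply: eq_psum => ys /=.
by rewrite /wprod big_cons /ent /=; ring.
Qed.

Lemma big_mprod m (eps : 'I_m -> bool) (u : 'I_m -> U) t :
  \big[mulmx/1%:M]_(k < m) mx_exp (eps k) (Y (u k) t) =
  mprod [seq (eps k, u k) | k <- enum 'I_m] t.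
Proof.
elim: m eps u => [|m IH] eps u; first by rewrite big_ord0 enum_ord0.
by rewrite big_ord_recl IH enum_ordSl /= -map_comp.
Qed.

Lemma cexpectationE (f : T -> R[i]) : cexpectation P f = cE f.
Proof. by rewrite /cexpectation unlock. Qed.

Lemma cE_psum m (F : seq 'I_n -> T -> R[i]) : (forall ys, cintegrable (F ys)) ->
  cintegrable (fun t => psum m (F^~ t)) /\
  cE (fun t => psum m (F^~ t)) = psum m (fun ys => cE (F ys)).
Proof.
elim: m F => [|m IH] F iF; first by split=> //; exact: iF.
have h y := IH (fun ys => F (y :: ys)) (fun ys => iF (y :: ys)).
split; first by apply: cintegrable_sum => y; have [] := h y.
rewrite /= cE_sum => [|y]; last by have [] := h y.
by apply: eq_bigr => y _; have [] := h y.
Qed.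

Lemma tau_psum m (eps : 'I_m -> bool) (u : 'I_m -> U) :
  tau P (fun t => \big[mulmx/1%:M]_(k < m) mx_exp (eps k) (Y (u k) t)) =
  n%:R^-1 * \sum_(i < n) psum m (fun ys =>
    (last i ys == i)%:R * mon (wl [seq (eps k, u k) | k <- enum 'I_m] i ys)).
Proof.
set L := [seq _ | _ <- _]; have sL : size L = m by rewrite size_map size_enum_ord.
rewrite /tau cexpectationE.
have iF i ys : cintegrable (fun t => (last i ys == i)%:R * wprod (wl L i ys) t).
  by apply: cintegrableZ; exact: cintegrable_wprod.
have E := fun i => cE_psum m (iF i).
rewrite (_ : (fun t => _) = fun t => n%:R^-1 * \sum_(i < n) psum m (fun ys =>
    (last i ys == i)%:R * wprod (wl L i ys) t)); last first.
  apply/funext => t; rewrite big_mprod -/L; congr (_ * _); apply: eq_bigr => i _.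
  by rewrite mprodE sL.
rewrite cEZ; last by apply: cintegrable_sum => i; have [] := E i.
rewrite cE_sum; last by move=> i; have [] := E i.
congr (_ * _); apply: eq_bigr => i _; have [_ ->] := E i; apply: eq_psum => ys.
by rewrite cEZ//; exact: cintegrable_wprod.
Qed.

End MatrixEntries.

(** * Walks on trees *)

Section Counting.
Local Open Scope nat_scope.
Variable T : eqType.
Implicit Types s t : seq T.

(** The multiplicities of the distinct elements add up to the size; all being at least 2, equality
    in the bound forces each to be 2. *)
Lemma size_undup_count s : (forall x, x \in s -> 2 <= count_mem x s) ->
  2 * size (undup s) <= size s /\
  (size s <= 2 * size (undup s) -> forall x, x \in s -> count_mem x s = 2).
Proof.
move=> s2; have := perm_size (perm_count_undup s).
rewrite size_flatten /shape -map_comp.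
rewrite (eq_map (g := fun x => count_mem x s)); last by move=> x /=; rewrite size_nseq.
move=> <-.
have : {subset undup s <= s} by move=> x; rewrite mem_undup.
have -> : (forall x, x \in s -> count_mem x s = 2) <-> (forall x, x \in undup s -> count_mem x s = 2).
  by split=> h x xs; apply: h; move: xs; rewrite mem_undup.
elim: (undup s) => [|x r IH] rs; first by [].
have rs' : {subset r <= s} by move=> y yr; apply: rs; rewrite inE yr orbT.
have [h1 h2] := IH rs'.
have x2 := s2 x (rs x (mem_head _ _)).
have h3 : 2 * size r <= sumn [seq count_mem x s | x <- r] := h1.
split=> /=; first by lia.
move=> h4 y; rewrite inE => /orP[/eqP ->|yr]; first by lia.
by apply: h2 => //; lia.
Qed.

Fixpoint fresh (past s : seq T) : nat :=
  if s is x :: s' then (x \notin past) + fresh (x :: past) s' else 0.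

Lemma fresh_undup past s : size (undup past) + fresh past s = size (undup (s ++ past)).
Proof.
elim: s past => [|x s IH] past /=; first by rewrite addn0.
have := IH (x :: past); rewrite /= [size (if _ then _ else _)]fun_if /=.
rewrite -(perm_size (_ : perm_eq (undup (x :: s ++ past)) (undup (s ++ x :: past)))); last first.
  by apply: perm_undup => y; rewrite !inE !mem_cat inE orbCA.
by move=> /= <-; case: (x \in past) => /=; lia.
Qed.

Lemma fresh_seen s1 s2 t : s1 =i s2 -> fresh s1 t = fresh s2 t.
Proof.
elim: t s1 s2 => //= x t IH s1 s2 s12; rewrite s12; congr (_ + _).
by apply: IH => z; rewrite !inE s12.
Qed.

End Counting.

Section Walk.
Local Open Scope nat_scope.
Variables (U : countType) (n : nat).
Implicit Types (L : seq (bool * U)) (x y : 'I_n) (xs ys seen : seq 'I_n).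
Implicit Types (w : seq (U + U)) (a b : wletter U n) (s : seq (wletter U n)).

Definition ord_rel (e : bool) x y : bool := if e then y < x else x < y.

(* A pushdown automaton reading the walk [x :: ys]: the stack [xs], with its letters [w], is
   the path from the current vertex [x] back to the root, as in the argument of [psi]. *)
Fixpoint treewalk L ys x xs w seen : bool :=
  match L, ys with
  | [::], _ => w == [::]
  | (e, u) :: L', y :: ys' => ord_rel e x y &&
      (if y \in seen then
         match xs, w with
         | x1 :: xs', v :: w' => [&& y == x1, v == copy e u & treewalk L' ys' x1 xs' w' seen]
         | _, _ => false
         end
       else treewalk L' ys' y (x :: xs) (copy (~~ e) u :: w) (y :: seen))
  | _, _ => false
  end.

Definition uncopy (v : U + U) : bool * U :=
  match v with inl u => (false, u) | inr u => (true, u) end.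

Lemma uncopyK e u : uncopy (copy e u) = (e, u).
Proof. by case: e. Qed.

Lemma copyK v : copy (uncopy v).1 (uncopy v).2 = v.
Proof. by case: v. Qed.

(** The stack stores the letter that will pop its top vertex; the dual of that letter is the one
    read when the vertex was pushed. This is the list of letters still waiting for their
    partners. *)
Fixpoint stack_letters x xs w : seq (wletter U n) :=
  match xs, w with
  | x1 :: xs', v :: w' => dual (uncopy v, (x, x1)) :: stack_letters x1 xs' w'
  | _, _ => [::]
  end.

Lemma opos_dual a : opos (dual a) = opos a.
Proof. by case: a => [[[] u] [i j]]. Qed.

Lemma stack_letters_push x xs w y e u :
  stack_letters y (x :: xs) (copy (~~ e) u :: w) = ((e, u), (x, y)) :: stack_letters x xs w.
Proof. by rewrite /= uncopyK /dual /= negbK. Qed.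

Lemma orderedE e u x y : @ordered U n ((e, u), (x, y)) = ord_rel e x y.
Proof. by case: e. Qed.

Lemma treewalk_last L ys x xs w seen : size ys = size L -> size xs = size w ->
  treewalk L ys x xs w seen -> last x ys = last x xs.
Proof.
elim: L ys x xs w seen => [|[e u] L IH] [|y ys] x xs w seen //=.
  by case: w xs => // -[].
move=> [sy] sx /andP[_]; case: ifPn => _.
  case: xs w sx => [|x1 xs] [|v w] //= [sx] /and3P[/eqP -> _ h].
  by rewrite (IH _ _ _ _ _ _ _ h).
by move=> h; rewrite (IH _ _ _ _ _ _ _ h)//= sx.
Qed.

(** New vertices are pushes and old ones are pops, and the stack ends empty: pops exceed pushes by
    its present height. *)
Lemma treewalk_fresh L ys x xs w seen : size ys = size L -> size xs = size w ->
  treewalk L ys x xs w seen -> size xs + 2 * fresh seen ys = size L.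
Proof.
elim: L ys x xs w seen => [|[e u] L IH] [|y ys] x xs w seen //=.
  by case: w xs => // -[].
move=> [sy] sx /andP[_]; case: ifPn => yseen.
  case: xs w sx => [|x1 xs] [|v w] //= [sx] /and3P[_ _ h].
  rewrite -(IH _ _ _ _ _ sy sx h) add0n addSn; congr (_ + 2 * _).+1.
  by apply: fresh_seen => z; rewrite inE; case: eqP => // ->.
move=> h; have sx' : size (x :: xs) = size (copy (~~ e) u :: w) by rewrite /= sx.
by rewrite -(IH _ _ _ _ _ sy sx' h) mulnDr /=; lia.
Qed.

(* A letter still to be read whose vertices are both in [seen] joins vertices of the stack:
   a popped vertex is never visited again. *)
Lemma treewalk_letters L ys x xs w seen : size ys = size L -> size xs = size w ->
  treewalk L ys x xs w seen -> {subset x :: xs <= seen} ->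
  forall b, b \in wl L x ys ->
  [|| b.2.1 \notin seen, b.2.2 \notin seen |
      (b.2.1 \in x :: xs) && (b.2.2 \in x :: xs)].
Proof.
elim: L ys x xs w seen => [|[e u] L IH] [|y ys] x xs w seen //= [sy] sx /andP[_].
case: ifPn => yseen.
  case: xs w sx => [|x1 xs] [|v w] //= [sx] /and3P[/eqP yx1 _ h] sub b; subst y.
  rewrite inE => /orP[/eqP ->|bl] /=; first by rewrite !inE !eqxx !orbT.
  have sub' : {subset x1 :: xs <= seen} by move=> z zx; apply: sub; rewrite inE zx orbT.
  have := IH _ _ _ _ _ sy sx h sub' b bl.
  have xx z : z \in x1 :: xs -> z \in [:: x, x1 & xs] by move=> zx; rewrite inE zx orbT.
  by case/or3P => [->|->|/andP[/xx -> /xx ->]]; rewrite ?orbT.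
move=> h sub b; rewrite inE => /orP[/eqP ->|bl] /=; first by rewrite yseen orbT.
have sub' : {subset y :: x :: xs <= y :: seen}.
  by move=> z; rewrite !inE => /orP[->//|zx]; rewrite (sub z) ?inE ?zx ?orbT.
have := IH _ _ _ _ _ sy _ h sub' b bl; rewrite /= sx => /(_ erefl).
rewrite !inE; case/or3P; rewrite ?negb_or.
- by case/andP => _ ->.
- by case/andP => _ ->; rewrite orbT.
case/andP=> /orP[/eqP -> _|h1]; first by rewrite yseen.
by case/orP=> [/eqP ->|h2]; [rewrite yseen orbT|rewrite h1 h2 !orbT].
Qed.

(** * Tree walks against the expectation, which enters through five properties *)

Section Value.
Variables (C : comNzRingType) (mon : seq (wletter U n) -> C) (nu : C).
Hypothesis mon_perm : forall s s', perm_eq s s' -> mon s = mon s'.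
Hypothesis mon_nil : mon [::] = 1%R.
Hypothesis mon_unordered : forall s, ~~ all (@ordered U n) s -> mon s = 0%R.
Hypothesis mon_single : forall a s, lpos a \notin [seq lpos b | b <- s] -> mon (a :: s) = 0%R.
Hypothesis mon_pair : forall a s, ordered a -> lpos a \notin [seq lpos b | b <- s] ->
  mon (a :: dual a :: s) = (nu * mon s)%R.

Lemma opos_verts a b : opos a = opos b -> (a.2.1 == b.2.1) && (a.2.2 == b.2.2) ||
  (a.2.1 == b.2.2) && (a.2.2 == b.2.1).
Proof.
by case: a b => [[[] u] [i j]] [[[] v] [k l]]; rewrite /opos /= => -[-> ->]; rewrite !eqxx ?orbT.
Qed.

Lemma stack_verts x xs w b : b \in stack_letters x xs w ->
  (b.2.1 \in x :: xs) && (b.2.2 \in x :: xs).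
Proof.
elim: xs x w => [|x1 xs IH] x [|v w] //=; rewrite inE => /orP[/eqP ->|h] /=.
  by rewrite !inE !eqxx !orbT.
by have /andP[h1 h2] := IH _ _ h; rewrite ![_ \in x :: _]inE h1 h2 !orbT.
Qed.

(** Each pop pairs the letter read with the one on top of the stack and yields a factor [nu]. No
    other letter lies on that edge: the popped vertex is off the remaining stack, and by
    [treewalk_letters] it is not visited again. *)
Lemma treewalk_mon L ys x xs w seen : size ys = size L -> size xs = size w ->
  treewalk L ys x xs w seen -> {subset x :: xs <= seen} -> uniq (x :: xs) ->
  mon (stack_letters x xs w ++ wl L x ys) = (nu ^+ ((size xs + size L)./2))%R.
Proof.
elim: L ys x xs w seen => [|[e u] L IH] [|y ys] x xs w seen //=.
  by case: w xs => // -[].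
move=> [sy] sx /andP[oxy]; case: ifPn => yseen.
  case: xs w sx => [|x1 xs] [|v w] //= [sx] /and3P[/eqP yx1 /eqP vE h] sub /andP[xnin uxs].
  subst y v; rewrite uncopyK.
  set a : wletter U n := ((e, u), (x, x1)).
  have sub' : {subset x1 :: xs <= seen} by move=> z zx; apply: sub; rewrite inE zx orbT.
  rewrite (mon_perm (s' := a :: dual a :: stack_letters x1 xs w ++ wl L x1 ys)); last first.
    by apply/permP => p; rewrite /= !count_cat /=; lia.
  rewrite mon_pair ?orderedE//; last first.
    apply/negP => /mapP[b]; rewrite mem_cat => bin [_ /opos_verts /= eab].
    have xb : x \in [:: b.2.1; b.2.2].
      by case/orP: eab => /andP[xb _]; rewrite !inE xb ?orbT.
    have bs : (b.2.1 \in seen) && (b.2.2 \in seen).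
      case/orP: eab => /andP[/eqP <- /eqP <-].
        by rewrite !sub ?inE ?eqxx ?orbT.
      by rewrite !sub ?inE ?eqxx ?orbT.
    have bx : (b.2.1 \in x1 :: xs) && (b.2.2 \in x1 :: xs).
      case/orP: bin; first exact: stack_verts.
      move=> bl; have := treewalk_letters sy sx h sub' bl.
      by case/andP: bs => -> ->.
    have /andP[bx1 bx2] := bx.
    by move: xb; rewrite !inE => /orP[] /eqP xb; move: xnin; rewrite xb ?bx1 ?bx2.
  by rewrite (IH _ _ _ _ _ sy sx h sub' uxs) -exprS addnS.
move=> h sub uxs.
rewrite (mon_perm (s' := stack_letters y (x :: xs) (copy (~~ e) u :: w) ++ wl L y ys)); last first.
  by rewrite stack_letters_push; apply/permP => p; rewrite /= !count_cat /=; lia.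
have sub' : {subset y :: x :: xs <= y :: seen}.
  by move=> z; rewrite !inE => /orP[->//|zx]; rewrite (sub z) ?inE ?zx ?orbT.
have sx' : size (x :: xs) = size (copy (~~ e) u :: w) by rewrite /= sx.
have uy : uniq (y :: x :: xs).
  by rewrite cons_uniq [uniq (x :: xs)]uxs andbT; apply: contra yseen; exact: sub.
by rewrite (IH _ _ _ _ _ sy sx' h sub' uy) /= addnS.
Qed.

Lemma notin_opos past x y e u seen :
  (forall b, b \in past -> (b.2.1 \in seen) && (b.2.2 \in seen)) -> y \notin seen ->
  opos (((e, u), (x, y)) : wletter U n) \notin [seq opos b | b <- past].
Proof.
move=> hv yseen; apply/negP => /mapP[b bp /opos_verts /= eab].
have /andP[h1 h2] := hv b bp.
by case/orP: eab => /andP[_ /eqP yb]; move: yseen; rewrite yb ?h1 ?h2.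
Qed.

(** A new vertex is entered along a new edge. This is V <= E + 1 for the rest of a walk, the form in
    which equality can be exploited step by step. *)
Lemma fresh_le L ys x seen past : size ys = size L -> x \in seen ->
  (forall b, b \in past -> (b.2.1 \in seen) && (b.2.2 \in seen)) ->
  fresh seen ys <= fresh [seq opos b | b <- past] [seq opos b | b <- wl L x ys].
Proof.
elim: L ys x seen past => [|[e u] L IH] [|y ys] x seen past //= [sy] xs hv.
apply: leq_add.
  case: (boolP (y \in seen)) => // yseen.
  by rewrite (notin_opos _ _ _ hv yseen).
apply: (IH _ _ _ (((e, u), (x, y)) :: past)) => //; first by rewrite mem_head.
move=> b; rewrite inE => /orP[/eqP ->|bp] /=; first by rewrite !inE xs eqxx orbT.
by have /andP[h1 h2] := hv b bp; rewrite !inE h1 h2 !orbT.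
Qed.

(** The vertices of the stack are distinct, so only its top edge touches x. *)
Lemma stack_top x xs w b : uniq (x :: xs) -> b \in stack_letters x xs w ->
  (b.2.1 == x) || (b.2.2 == x) -> exists x1 xs' v w',
  [/\ xs = x1 :: xs', w = v :: w' & b = dual (uncopy v, (x, x1))].
Proof.
case: xs w => [|x1 xs] [|v w] //= /andP[xn _]; rewrite inE => /orP[/eqP -> _|h bx].
  by exists x1, xs, v, w.
have /andP[h1 h2] := stack_verts h.
by case/orP: bx => /eqP bx; move: xn; rewrite -bx ?h1 ?h2.
Qed.

(* [past] is the part of the word already read.  The letters of the stack are exactly those
   used once so far; as there is no room for an edge between old vertices, a step to an old
   vertex must reuse the only such edge at [x], the top of the stack. *)
Lemma treewalk_complete (F : seq (wletter U n)) L ys x xs w seen past :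
  all (@ordered U n) F ->
  (forall b, b \in F -> count_mem (opos b) [seq opos b | b <- F] = 2) ->
  (forall b, b \in F -> 2 <= count_mem (lpos b) [seq lpos b | b <- F]) ->
  size ys = size L -> size xs = size w -> uniq (x :: xs) ->
  {subset x :: xs <= seen} ->
  (forall b, b \in past -> (b.2.1 \in seen) && (b.2.2 \in seen)) ->
  perm_eq F (past ++ wl L x ys) ->
  (forall b, b \in stack_letters x xs w -> b \in past /\
    count_mem (opos b) [seq opos b | b <- past] = 1) ->
  (forall b, b \in past -> count_mem (opos b) [seq opos b | b <- past] = 1 ->
    b \in stack_letters x xs w) ->
  fresh [seq opos b | b <- past] [seq opos b | b <- wl L x ys] <= fresh seen ys ->
  treewalk L ys x xs w seen.
Proof.
move=> Fo Fc Fl.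
elim: L ys x xs w seen past => [|[e u] L IH] [|y ys] x xs w seen past //.
  (* The word is exhausted: a letter left on the stack would have an edge used once, whereas every
     edge of [F] is used twice. *)
  move=> _ sx ux sub hv FP hst hdead _ /=.
  case: xs w sx {ux sub hdead} hst => [|x1 xs] [|v w] //= sx hst.
  have [bp b1] := hst _ (mem_head _ _).
  rewrite cats0 in FP; move: bp; rewrite -(perm_mem FP) => /Fc.
  by have /permP -> := perm_map (@opos U n) FP; rewrite b1.
move=> [sy] sx ux sub hv FP hst hdead hnew.
set a : wletter U n := ((e, u), (x, y)).
have aF : a \in F by rewrite (perm_mem FP) /= mem_cat mem_head orbT.
have oa : ord_rel e x y by have := allP Fo a aF; rewrite orderedE.
have xy : x != y by apply/eqP => xy; move: oa; rewrite xy /ord_rel; case: e {a aF hnew FP}; rewrite ltnn.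
have xseen : x \in seen by apply: sub; rewrite mem_head.
have FP' : perm_eq F ((a :: past) ++ wl L y ys).
  by rewrite (perm_trans FP)//= -cat1s perm_catCA.
have hv' seen' : {subset seen <= seen'} -> y \in seen' ->
    forall b, b \in a :: past -> (b.2.1 \in seen') && (b.2.2 \in seen').
  move=> ss ys' b; rewrite inE => /orP[/eqP ->|bp] /=; first by rewrite ys' ss.
  by have /andP[h1 h2] := hv b bp; rewrite !ss.
have g' := fresh_le (seen := y :: seen) (past := a :: past) sy (mem_head _ _)
  (hv' (y :: seen) (fun z zs => mem_behead (s := y :: seen) zs) (mem_head _ _)).
have hnew1 : (opos a \notin [seq opos b | b <- past]) + fresh [seq opos b | b <- a :: past]
    [seq opos b | b <- wl L y ys] <= (y \notin seen) + fresh (y :: seen) ys := hnew.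
have ca : count_mem (opos a) [seq opos b | b <- past] +
    count_mem (opos a) [seq opos b | b <- wl L y ys] = 1.
  have := Fc a aF; have /permP -> := perm_map (@opos U n) FP'.
  rewrite cat_cons map_cons map_cat /= count_cat eqxx add1n => /eqP.
  by rewrite eqSS => /eqP.
rewrite /= oa /=; case: ifPn => yseen.
  (* A new edge to an old vertex would leave fewer new edges than new vertices for the rest of the
     walk, against [fresh_le]. *)
  have ap : opos a \in [seq opos b | b <- past].
    apply/negPn/negP => na; move: hnew1; rewrite yseen na add1n add0n => h.
    by have := leq_trans h g'; rewrite ltnn.
  have cp : count_mem (opos a) [seq opos b | b <- past] = 1.
    move: ap ca; rewrite -has_pred1 has_count.
    by case: (count_mem (opos a) [seq opos b | b <- past]) => [|[|k]].
  have cw : count_mem (opos a) [seq opos b | b <- wl L y ys] = 0.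
    by move: ca; rewrite cp add1n => -[].
  (* The variable of [a] occurs at least twice, but its edge does not recur in the unread part; so
     the partner [c] has been read already. *)
  have [c cpast cl] : exists2 c, c \in past & lpos a = lpos c.
    apply/mapP; rewrite -has_pred1 has_count.
    have := Fl a aF; have /permP -> := perm_map (@lpos U n) FP'.
    rewrite map_cat count_cat /= eqxx.
    suff : count_mem (lpos a) [seq lpos b | b <- wl L y ys] <= 0.
      by rewrite leqn0 => /eqP ->; rewrite addn0 add1n ltnS.
    rewrite -cw !count_map; apply: sub_count => b /= /eqP /(congr1 snd) /= ->.
    exact: eqxx.
  have co : opos c = opos a by rewrite -[LHS]/((lpos c).2) -cl.
  have cst : c \in stack_letters x xs w by apply: hdead => //; rewrite co.
  have cx : (c.2.1 == x) || (c.2.2 == x).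
    by have := opos_verts co; case/orP=> /andP[/= h1 h2]; rewrite ?h1 ?h2 ?orbT.
  have [x1 [xs' [v [w' [exs ew ec]]]]] := stack_top ux cst cx; subst xs w.
  have yx1 : y = x1.
    have := opos_verts co; rewrite ec /= => /orP[]/andP[/eqP h1 /eqP h2] //.
    by move: xy; rewrite -h2 eqxx.
  subst x1; rewrite eqxx /=.
  (* The letter stored and the letter read both go from x to y and have the same position above the
     diagonal; as x and y differ, the exponents agree. *)
  have vE : v = copy e u.
    have cu : (uncopy v).2 = u by have := congr1 fst cl; rewrite ec /= => <-.
    have ce : (uncopy v).1 = e.
      move: co; rewrite ec opos_dual /opos /=.
      by case: (uncopy v).1; case: e {a aF oa FP hnew FP' hv' g' hnew1 ca ap cp cw cl cpast cst cx ec} => //= -[h1 h2]; move: xy; rewrite h1 eqxx.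
    by rewrite -[LHS]copyK cu ce.
  rewrite vE eqxx /=.
  have ux' : uniq (y :: xs') by move: ux; rewrite /= => /andP[].
  have xn : x \notin y :: xs' by move: ux; rewrite cons_uniq => /andP[].
  have npx b : b \in stack_letters y xs' w' -> opos b != opos a.
    move=> bs; apply/eqP => /opos_verts /= eab; have /andP[h1 h2] := stack_verts bs.
    by case/orP: eab => /andP[/eqP e1 /eqP e2]; case/negP: xn;
      [rewrite -e1|rewrite -e2].
  have ea : c = dual ((e, u), (x, y)) by rewrite ec vE uncopyK.
  apply: (IH _ _ _ _ _ (a :: past)) => //.
  - by case: sx.
  - by move=> z zs; apply: sub; rewrite inE zs orbT.
  - exact: hv'.
  - move=> b bs; have [bp b1] := hst b (mem_behead (s := _ :: _) bs).
    split; first by rewrite inE bp orbT.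
    by rewrite /= eq_sym (negbTE (npx b bs)).
  - move=> b; rewrite inE => /orP[/eqP ->|bp] /=; first by rewrite eqxx cp.
    have [ab|nb] := eqVneq (opos a) (opos b); first by rewrite -ab cp.
    rewrite add0n => b1; have := hdead b bp b1; rewrite /= inE => /orP[/eqP eb|//].
    by move: nb; rewrite eb opos_dual vE uncopyK eqxx.
  - rewrite (fresh_seen (s2 := y :: seen)); last by move=> z; rewrite inE; case: eqP => // ->.
    by move: hnew1; rewrite yseen ap.
have an := notin_opos x e u hv yseen; rewrite -/a in an.
have npa b : b \in past -> opos b != opos a.
  by move=> bp; apply/eqP => ob; move: an; rewrite -ob map_f.
have an0 : count_mem (opos a) [seq opos b | b <- past] = 0 by apply/count_memPn.
apply: (IH _ _ _ _ _ (a :: past)) => //.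
- by rewrite /= sx.
- by rewrite cons_uniq ux andbT; apply: contra yseen; exact: sub.
- by move=> z; rewrite inE => /orP[/eqP ->|zs]; rewrite inE ?eqxx// (sub _ zs) orbT.
- by apply: hv'; [move=> z zs; rewrite inE zs orbT|rewrite mem_head].
- move=> b; rewrite stack_letters_push inE => /orP[/eqP ->|bs].
    by rewrite mem_head /= eqxx an0.
  have [bp b1] := hst b bs; split; first by rewrite inE bp orbT.
  by rewrite /= eq_sym (negbTE (npa b bp)).
- move=> b; rewrite stack_letters_push inE => /orP[/eqP ->|bp]; first by rewrite mem_head.
  rewrite /= eq_sym (negbTE (npa b bp)) add0n => b1.
  by rewrite inE (hdead b bp b1) orbT.
- by move: hnew1; rewrite yseen an.
Qed.

(* With E distinct edges and V vertices, 2 E <= m as each edge is used twice, and V <= E + 1;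
   the hypothesis m + 2 <= 2 V forces equality in both. *)
Lemma mon_treewalk L ys i : size ys = size L ->
  size L + 2 <= 2 * (1 + fresh [:: i] ys) -> mon (wl L i ys) != 0%R ->
  treewalk L ys i [::] [::] [:: i].
Proof.
move=> sy sD m0; set F := wl L i ys.
have sF : size F = size L.
  by rewrite /F; elim: L ys i sy {sD m0 F} => [|l L IH] [|y ys] i //= [sy]; rewrite IH.
have Fo : all (@ordered U n) F by apply: contraNT m0 => /mon_unordered ->.
have Fl b : b \in F -> 2 <= count_mem (lpos b) [seq lpos b | b <- F].
  move=> bF; have PF := perm_to_rem bF.
  have /permP -> := perm_map (@lpos U n) PF; rewrite /= eqxx.
  rewrite ltnS -has_count has_pred1; apply: contraNT m0 => nb.
  by rewrite (mon_perm PF) mon_single.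
have Fc b : b \in F -> 2 <= count_mem (opos b) [seq opos b | b <- F].
  move=> bF; apply: leq_trans (Fl b bF) _; rewrite !count_map.
  by apply: sub_count => c /= /eqP /(congr1 snd) /= ->; exact: eqxx.
have [h1 h2] := @size_undup_count _ [seq opos b | b <- F] (fun p =>
   ltac:(by move=> /mapP[b bF ->]; exact: Fc)).
have g := fresh_le (seen := [:: i]) (past := [::]) sy (mem_head _ _) (fun b => ltac:(by [])).
have := fresh_undup [::] [seq opos b | b <- F]; rewrite cats0 /= add0n => fE.
rewrite size_map sF in h1 h2; rewrite -/F fE in g.
rewrite mulnDr muln1 addnC leq_add2l in sD.
apply: (@treewalk_complete F _ _ _ _ _ _ [::]) => //.
- by move=> b bF; apply: h2; [apply: leq_trans sD _; rewrite leq_mul2l|rewrite map_f].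
- by rewrite -/F fE -(@leq_pmul2l 2)//; exact: leq_trans h1 sD.
Qed.

End Value.

(** Each step goes to an old vertex, with at most |seen| + m - 1 choices, or to a new one, with at
    most n choices; the latter happens at most k times. *)
Lemma psum_fresh_le (R : numDomainType) m seen k : 0 < n ->
  (psum m (fun ys : seq 'I_n => (fresh seen ys <= k)%:R) <= ((size seen + m) ^ m * n ^ k)%:R :> R)%R.
Proof.
move=> n0; elim: m seen k => [|m IH] seen k /=.
  by rewrite expn0 mul1n ler_nat expn_gt0 n0.
pose c := ((size seen + m.+1) ^ m)%N.
rewrite (bigID (fun y => y \in seen)) /=.
apply: (@le_trans _ _ ((size seen * (c * n ^ k))%:R + (c * n ^ k)%:R)%R); last first.
  rewrite -natrD ler_nat [(size seen * _ + _)%N]addnC -mulSn mulnA leq_mul2r; apply/orP; right.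
  by rewrite expnS leq_mul2r; apply/orP; right; rewrite addnS ltnS leq_addr.
have cle (s : seq 'I_n) j : size s <= (size seen).+1 -> ((size s + m) ^ m * n ^ j <= c * n ^ j)%N.
  move=> ss; rewrite leq_mul2r /c; apply/orP; right.
  by case: (m) => // m'; rewrite leq_exp2r// [leqRHS]addnS -addSn leq_add2r.
apply: lerD.
  apply: (@le_trans _ _ (\sum_(y < n | y \in seen) (c * n ^ k)%:R)%R).
    apply: ler_sum => y ys; rewrite (eq_psum _ (G := fun t => (fresh (y :: seen) t <= k)%:R%R)).
      by apply: le_trans (IH _ _) _; rewrite ler_nat cle.
    by move=> t; rewrite ys.
  rewrite sumr_const -mulrnA ler_nat mulnC leq_mul2r; apply/orP; right.
  exact: card_size.
case: k => [|k].
  rewrite big1 ?ler0n// => y yn; rewrite (eq_psum _ (G := fun t => 0 * 0)%R).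
    by rewrite psumZ mul0r.
  by move=> t; rewrite yn mul0r.
apply: (@le_trans _ _ (\sum_(y < n) (c * n ^ k)%:R)%R).
  rewrite big_mkcond; apply: ler_sum => y _; case: ifPn => yn; last by rewrite ler0n.
  rewrite (eq_psum _ (G := fun t => (fresh (y :: seen) t <= k)%:R%R)).
    by apply: le_trans (IH _ _) _; rewrite ler_nat cle.
  by move=> t; rewrite yn add1n ltnS.
by rewrite sumr_const card_ord -mulrnA ler_nat expnS; lia.
Qed.

End Walk.

(** * The limit of the sum over tree walks *)

Section TreeSum.
Variables (R : realType) (U : countType) (n : nat).
Implicit Types (L : seq (bool * U)) (x y : 'I_n) (xs ys seen : seq 'I_n) (w : seq (U + U)).

(* [psi] with the Lebesgue measure replaced by the normalized counting measure *)
Fixpoint gwalk L x xs w : R :=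
  match L with
  | [::] => (w == [::])%:R
  | (e, u) :: L' =>
      match xs, w with
      | y :: xs', v :: w' =>
          if v == copy e u then (ord_rel e x y)%:R * gwalk L' y xs' w' else 0
      | _, _ => 0
      end + n%:R^-1 * \sum_(y < n) (ord_rel e x y)%:R * gwalk L' y (x :: xs) (copy (~~ e) u :: w)
  end.

(** Each letter adds a pop term and a mean over pushes, both under the previous bound, which
    therefore doubles. This constant is the dominating function in the limit. *)
Lemma gwalk_bound L x xs w : 0 <= gwalk L x xs w <= 2 ^+ size L.
Proof.
elim: L x xs w => [|[e u] L IH] x xs w /=; first by case: (w == _); rewrite ?ler01 ?lexx.
have h (b : bool) y xs' w' : 0 <= b%:R * gwalk L y xs' w' <= 2 ^+ size L.
  have /andP[g0 g1] := IH y xs' w'.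
  by case: b; rewrite ?mul1r ?mul0r ?g0 ?g1 ?lexx ?exprn_ge0.
have n_gt0 : (0 < n)%N by case: x => k; case: (n).
have n_gt0' : 0 < n%:R :> R by rewrite ltr0n.
rewrite exprS [2 * _](_ : _ = 2 ^+ size L + 2 ^+ size L); last by ring.
set a := match xs with [::] => _ | _ => _ end; set b := n%:R^-1 * _.
suff [/andP[a0 a1] /andP[b0 b1]] : 0 <= a <= 2 ^+ size L /\ 0 <= b <= 2 ^+ size L.
  by rewrite addr_ge0//= lerD.
split.
  rewrite {}/a {}/b; case: xs w => [|y xs] [|v w]; rewrite ?lexx ?exprn_ge0//.
  by case: eqP => // _; rewrite lexx exprn_ge0.
rewrite /b mulr_ge0 ?invr_ge0 ?ler0n ?sumr_ge0//=; last by move=> y _; case/andP: (h (ord_rel e x y) y (x :: xs) (copy (~~ e) u :: w)).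
rewrite mulrC ler_pdivrMr// mulr_natr.
apply: (@le_trans _ _ (\sum_(y < n) 2 ^+ size L)).
  by apply: ler_sum => y _; case/andP: (h (ord_rel e x y) y (x :: xs) (copy (~~ e) u :: w)).
by rewrite sumr_const card_ord.
Qed.

Definition treesum L x xs w seen : R :=
  psum (size L) (fun ys => (treewalk L ys x xs w seen)%:R).

(** A step to an old vertex can only be the pop, whose target is forced, so the sum over old y
    collapses to one term. Compared with [gwalk], the push ranges over unseen y only. *)
Lemma treesum_cons e u L x xs w seen : {subset xs <= seen} ->
  treesum ((e, u) :: L) x xs w seen =
  match xs, w with
  | y :: xs', v :: w' =>
      if v == copy e u then (ord_rel e x y)%:R * treesum L y xs' w' seen else 0
  | _, _ => 0
  end + \sum_(y < n | y \notin seen)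
     (ord_rel e x y)%:R * treesum L y (x :: xs) (copy (~~ e) u :: w) (y :: seen).
Proof.
move=> sub; rewrite /treesum /= (bigID (fun y => y \in seen)) /=; congr (_ + _); last first.
  by apply: eq_bigr => y /negbTE yseen; rewrite -psumZ; apply: eq_psum => ys;
    rewrite yseen -natrM mulnb.
have z0 (F : 'I_n -> seq 'I_n -> R) : (forall y ys, y \in seen -> F y ys = 0) ->
    \sum_(y < n | y \in seen) psum (size L) (F y) = 0.
  move=> F0; rewrite big1// => y yseen; rewrite (eq_psum _ (G := fun _ => 0 * 0)).
    by rewrite psumZ mul0r.
  by move=> ys; rewrite F0 ?mul0r.
case: xs w sub => [|x1 xs] [|v w] sub; try by apply: z0 => y ys ->; rewrite andbF.
rewrite (bigD1 x1) ?sub ?mem_head//= big1 ?addr0; last first.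
  move=> y /andP[ys yx]; rewrite (eq_psum _ (G := fun _ => 0 * 0)).
    by rewrite psumZ mul0r.
  by move=> t; rewrite ys (negbTE yx) andbF mul0r.
case: ifPn => [vE|vE].
  by rewrite -psumZ; apply: eq_psum => ys; rewrite eqxx -natrM mulnb.
rewrite (eq_psum _ (G := fun _ => 0 * 0)); first by rewrite psumZ mul0r.
by move=> ys; rewrite eqxx andbF mul0r.
Qed.

(** The recursion of the error: the push, which enlarges [seen], the pop, which does not, and the at
    most k seen vertices that [gwalk] admits in excess, each under the bound of [gwalk_bound]. *)
Fixpoint tree_err m k : nat :=
  if m is m'.+1 then tree_err m' k.+1 + tree_err m' k + k * 2 ^ m' else 0.

(** By [treewalk_fresh] there remain (size L - size xs)/2 pushes, each owing a factor 1/n; powers of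
    r, the square root of n, express this without halving. *)
Lemma treesum_gwalk (r : R) L x xs w seen : 0 < r -> r ^+ 2 = n%:R -> size xs = size w ->
  {subset xs <= seen} -> x \in seen ->
  `|r ^- size L * r ^+ size xs * treesum L x xs w seen - gwalk L x xs w|
    <= (tree_err (size L) (size seen))%:R / n%:R.
Proof.
move=> r0 rn; have r00 : r != 0 by rewrite gt_eqF.
have n_gt0 : 0 < n%:R :> R by rewrite -rn exprn_gt0.
elim: L x xs w seen => [|[e u] L IH] x xs w seen sx sub xseen.
  rewrite /treesum /= expr0 invr1 mul1r mul0r.
  by case: w xs sx {sub} => [|v w] [|x1 xs] //= _; rewrite ?mulr0 ?mul1r subrr normr0.
rewrite treesum_cons// mulrDr [gwalk _ _ _ _]/= opprD addrACA.
set E := (tree_err _ _)%:R.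
have -> : E / n%:R = (tree_err (size L) (size seen))%:R / n%:R +
    ((tree_err (size L) (size seen).+1)%:R + (size seen * 2 ^ size L)%:R) / n%:R.
  by rewrite -mulrDl /E /= -!natrD; congr (_%:R / _); lia.
have errge0 k j : 0 <= (tree_err k j)%:R / n%:R :> R by rewrite divr_ge0 ?ler0n.
apply: (le_trans (ler_normD _ _)); apply: lerD.
  case: xs w sx sub => [|x1 xs] [|v w] //= sx sub; rewrite ?mulr0 ?subrr ?normr0//.
  case: sx => sx; case: ifPn => _; last by rewrite mulr0 subrr normr0.
  rewrite (_ : r ^- _ * r ^+ _ * _ - _ = (ord_rel e x x1)%:R *
    (r ^- size L * r ^+ size xs * treesum L x1 xs w seen - gwalk L x1 xs w)); last first.
    by rewrite mulrBr; congr (_ - _); rewrite !exprS; field; rewrite expf_neq0.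
  rewrite normrM normr_nat; apply: (@le_trans _ _ (1 * ((tree_err (size L) (size seen))%:R / n%:R))).
    apply: ler_pM => //; first by rewrite lern1 leq_b1.
    apply: IH => //; last by rewrite sub ?mem_head.
    by move=> z zx; apply: sub; rewrite inE zx orbT.
  by rewrite mul1r.
set w' := copy _ _ :: w; set xs' := x :: xs.
have sub' y : {subset xs' <= y :: seen}.
  by move=> z; rewrite !inE => /orP[/eqP ->|/sub ->]; rewrite ?xseen orbT.
have sx' : size xs' = size w' by rewrite /= sx.
have -> : r ^- size ((e, u) :: L) * r ^+ size xs =
    n%:R^-1 * (r ^- size L * r ^+ size xs').
  by rewrite -rn /= !exprS expr0; field; rewrite r00 expf_neq0.
rewrite -mulrA -mulrBr normrM ger0_norm ?invr_ge0 ?ler0n// [leLHS]mulrC ler_pM2r ?invr_gt0//.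
(* Unseen y are compared by induction; for seen y only [gwalk] contributes, and it is bounded. *)
rewrite [X in _ - X](bigID (fun y => y \notin seen)) /= opprD addrA mulr_sumr -sumrB.
apply: (le_trans (ler_normB _ _)); apply: lerD.
  apply: (le_trans (ler_norm_sum _ _ _)).
  apply: (@le_trans _ _ (\sum_(y < n) (tree_err (size L) (size seen).+1)%:R / n%:R)).
    rewrite [leLHS]big_mkcond; apply: ler_sum => y _; case: ifPn => // yseen.
    rewrite mulrCA -mulrBr normrM normr_nat.
    apply: (@le_trans _ _ (1 * ((tree_err (size L) (size (y :: seen)))%:R / n%:R))).
      by apply: ler_pM => //; [rewrite lern1 leq_b1|exact: (IH y xs' w' (y :: seen) sx' (sub' y) (mem_head _ _))].
    by rewrite mul1r.
  by rewrite sumr_const card_ord -[_ *+ n]mulr_natr divfK// gt_eqF.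
apply: (le_trans (ler_norm_sum _ _ _)).
apply: (@le_trans _ _ (\sum_(y < n | y \in seen) (2 ^ size L)%:R)).
  rewrite big_mkcond [leRHS]big_mkcond; apply: ler_sum => y _; rewrite negbK.
  case: ifPn => // _; have /andP[g0 g1] := gwalk_bound L y xs' w'.
  rewrite normrM normr_nat ger0_norm// natrX -[leRHS]mul1r.
  by apply: ler_pM => //; rewrite lern1 leq_b1.
rewrite sumr_const -mulrnA ler_nat mulnC leq_mul2r; apply/orP; right.
exact: card_size.
Qed.

End TreeSum.

Lemma ler_norm_psum (R : numDomainType) n m (F : seq 'I_n -> R) :
  `|psum m F| <= psum m (fun ys => `|F ys|).
Proof.
elim: m F => //= m IH F; apply: (le_trans (ler_norm_sum _ _ _)).
by apply: ler_sum => y _; exact: IH.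
Qed.

(** * The normalized trace compared with the sum over tree walks *)

Section MainTerm.
Context (R : realType) (d : measure_display) (T : measurableType d) (P : probability T R).
Context (U : countType) (n : nat) (Y : U -> T -> 'M[R[i]]_n).
Hypothesis n0 : (0 < n)%N.
Hypothesis HY : independent_sut_gaussian P Y.
Local Notation r := (Num.sqrt n%:R : R).

Let n_gt0 : 0 < n%:R :> R. Proof. by rewrite ltr0n. Qed.
Let r0 : 0 < r. Proof. by rewrite sqrtr_gt0. Qed.
Let rn : r ^+ 2 = n%:R. Proof. by rewrite sqr_sqrtr ?ler0n. Qed.

Definition walk_err (L : seq (bool * U)) i ys : R[i] :=
  (last i ys == i)%:R * mon P Y (wl L i ys) -
  (r ^- size L * (treewalk L ys i [::] [::] [:: i])%:R)%:C.

(** Tree walks cancel exactly, contributing r^(-m) on both sides. Any other walk with at least m/2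
    new vertices has expectation 0 by [mon_treewalk]. Only walks with few vertices remain. *)
Lemma walk_errE (L : seq (bool * U)) i ys : size ys = size L ->
  walk_err L i ys =
  if (2 * fresh [:: i] ys < size L)%N then (last i ys == i)%:R * mon P Y (wl L i ys) else 0.
Proof.
move=> sy; rewrite /walk_err; have [tw|ntw] := boolP (treewalk L ys i [::] [::] [:: i]).
  have fE := treewalk_fresh sy (erefl 0%N : size [::] = size [::]) tw.
  rewrite add0n in fE; rewrite -{2}fE ltnn.
  have := treewalk_last sy (erefl 0%N : size [::] = size [::]) tw => /= ->.
  rewrite eqxx mul1r.
  have := treewalk_mon (@mon_perm _ _ _ P _ _ Y) (mon_nil P Y) (mon_pair n0 HY) sy
    (erefl 0%N : size [::] = size [::]) tw (fun z zi => zi) isT.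
  rewrite /= => ->; rewrite add0n -fE mul2n doubleK -mul2n exprM rn mulr1.
  by rewrite -rmorphXn /= exprVn subrr.
rewrite mulr0 subr0; case: ltnP => // fL.
have [->|m0] := eqVneq (mon P Y (wl L i ys)) 0; first by rewrite mulr0.
case/negP: ntw.
apply: (mon_treewalk (@mon_perm _ _ _ P _ _ Y) (mon_unordered HY) (mon_single n0 HY)) => //.
by lia.
Qed.

(** [f] stands for the real or the imaginary part. For m > 0 the number (m - 1)/2, rounded down, is
    the largest k with 2k < m; the factor [0 < size L] settles the empty word, which has no
    error. *)
Lemma walk_err_le (L : seq (bool * U)) i ys (f : {additive R[i] -> R}) :
  (forall s, `|f (mon P Y s)| <= monC R (size s) * Num.sqrt ((2 * n)%:R^-1) ^+ size s) ->
  size ys = size L ->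
  `|f (walk_err L i ys)| <= monC R (size L) * (0 < size L)%N%:R * r ^- size L *
    (fresh [:: i] ys <= (size L).-1./2)%N%:R.
Proof.
move=> fle sy; rewrite walk_errE//.
have C0 : 0 <= monC R (size L) by rewrite mulr_ge0 ?ler0n ?momC_ge0.
have r1 : 0 <= r ^- size L by rewrite invr_ge0 exprn_ge0// ltW.
case: ifPn => [lt|_]; last first.
  by rewrite raddf0 normr0; exact: mulr_ge0 (mulr_ge0 (mulr_ge0 C0 (ler0n _ _)) r1) (ler0n _ _).
rewrite (leq_trans _ lt)// (_ : (fresh _ _ <= _)%N = true); last by lia.
rewrite !mulr1; case: (last i ys == i); last by rewrite mul0r raddf0 normr0 mulr_ge0.
rewrite mul1r; apply: (le_trans (fle _)).
have -> : size (wl L i ys) = size L.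
  by elim: L ys i sy {lt C0 r1 fle} => [|l L IH] [|y ys] i //= [sy]; rewrite IH.
rewrite ler_wpM2l// -exprVn lerXn2r ?nnegrE ?invr_ge0 ?sqrtr_ge0//.
rewrite -sqrtrV ?ler0n// ler_sqrt ?invr_ge0 ?ler0n// lef_pV2 ?posrE ?ltr0n ?muln_gt0//.
by rewrite ler_nat leq_pmull.
Qed.

(** The rounded value satisfies 2 ((m - 1)/2) + 1 <= m, so at least one factor 1/r is left over. *)
Lemma scaled_walk_count m : (0 < m)%N ->
  r ^- m * ((1 + m) ^ m * n ^ m.-1./2)%:R <= ((1 + m) ^ m)%:R / r.
Proof.
move=> m0; rewrite natrM mulrCA ler_wpM2l ?ler0n//.
have -> : (n ^ m.-1./2)%:R = r ^+ (2 * m.-1./2) by rewrite exprM rn natrX.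
rewrite ler_pdivrMl ?exprn_gt0// ler_pdivlMr// -exprSr.
apply: ler_weXn2l; last by lia.
by rewrite -[leLHS](sqrtr1 R) ler_sqrt ?ler1n.
Qed.

Lemma sum_walk_err_le (L : seq (bool * U)) (f : {additive R[i] -> R}) :
  (forall s, `|f (mon P Y s)| <= monC R (size s) * Num.sqrt ((2 * n)%:R^-1) ^+ size s) ->
  `|n%:R^-1 * \sum_(i < n) psum (size L) (fun ys => f (walk_err L i ys))| <=
    monC R (size L) * ((1 + size L) ^ size L)%:R / r.
Proof.
move=> fle; set m := size L.
have C0 : 0 <= monC R m by rewrite mulr_ge0 ?ler0n ?momC_ge0.
rewrite normrM ger0_norm ?invr_ge0 ?ler0n// ler_pdivrMl//.
apply: (le_trans (ler_norm_sum _ _ _)).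
set B := _ / r; apply: (@le_trans _ _ (\sum_(i < n) B)); last first.
  by rewrite sumr_const card_ord mulr_natl.
apply: ler_sum => i _.
apply: (le_trans (ler_norm_psum _ _)).
apply: (@le_trans _ _ (psum m (fun ys => monC R m * (0 < m)%N%:R * r ^- m *
    (fresh [:: i] ys <= m.-1./2)%N%:R))).
  by apply: le_psum => ys sy; exact: walk_err_le.
rewrite psumZ; case: (posnP m) => [_|m0].
  rewrite mulr0 !mul0r; apply: mulr_ge0; last by rewrite invr_ge0 ltW.
  exact: mulr_ge0 C0 (ler0n _ _).
rewrite mulr1 /B -[leLHS]mulrA -[leRHS]mulrA; apply: (ler_wpM2l C0).
apply: le_trans (scaled_walk_count m0).
apply: ler_wpM2l; last exact: (psum_fresh_le R m [:: i] _ n0).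
by rewrite invr_ge0 exprn_ge0// ltW.
Qed.

(** The error [C / r] comes from walks with few vertices, the other from replacing tree walks by
    [gwalk]. The sum over tree walks is real, so the imaginary part has only the first. *)
Lemma tau_gwalk m (eps : 'I_m -> bool) (u : 'I_m -> U) :
  let L := [seq (eps k, u k) | k <- enum 'I_m] in
  let t := tau P (fun t => \big[mulmx/1%:M]_(k < m) mx_exp (eps k) (Y (u k) t)) in
  let C := monC R m * ((1 + m) ^ m)%:R in
  `|Re t - n%:R^-1 * \sum_(i < n) gwalk R L i [::] [::]| <= C / r + (tree_err m 1)%:R / n%:R /\
  `|Im t| <= C / r.
Proof.
move=> L; have sL : size L = m by rewrite size_map size_enum_ord.
rewrite tau_psum// -/L => t C.
pose G := n%:R^-1 * \sum_(i < n) (r ^- m * treesum R L i [::] [::] [:: i]).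
have tE : t = (n%:R^-1)%:C * \sum_(i < n) psum m (walk_err L i) + G%:C.
  rewrite /t /G rmorphM /= fmorphV /= rmorph_nat -mulrDr; congr (_ * _).
  rewrite rmorph_sum -big_split; apply: eq_bigr => i _ /=.
  rewrite rmorphM /= /treesum sL.
  rewrite (psum_additive (real_complex R)) -psumZ -psumD; apply: eq_psum => ys.
  by rewrite /walk_err sL rmorphM /= subrK.
have ReC (c : R) z : Re (c%:C * z) = c * Re z by case: z => a b /=; rewrite mul0r subr0.
have ImC (c : R) z : Im (c%:C * z) = c * Im z by case: z => a b /=; rewrite mul0r addr0.
have ReE : Re t = n%:R^-1 * \sum_(i < n) psum m (fun ys => Re (walk_err L i ys)) + G.
  rewrite tE raddfD /= ReC raddf_sum; congr (_ * _ + _); apply: eq_bigr => i _.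
  exact: psum_additive.
have ImE : Im t = n%:R^-1 * \sum_(i < n) psum m (fun ys => Im (walk_err L i ys)).
  rewrite tE raddfD /= addr0 ImC raddf_sum; congr (_ * _); apply: eq_bigr => i _.
  exact: psum_additive.
have := @sum_walk_err_le L (@complex.Re R : {additive R[i] -> R}) (fun s => (mon_le n0 HY s).1).
have := @sum_walk_err_le L (@complex.Im R : {additive R[i] -> R}) (fun s => (mon_le n0 HY s).2).
rewrite sL -ImE => hI hR; split=> //.
rewrite ReE -addrA; apply: (le_trans (ler_normD _ _)); apply: lerD => //.
rewrite /G -mulrBr -sumrB normrM ger0_norm ?invr_ge0 ?ler0n// ler_pdivrMl//.
rewrite mulrC divfK ?gt_eqF//.
apply: (le_trans (ler_norm_sum _ _ _)).
apply: (@le_trans _ _ (\sum_(i < n) (tree_err m 1)%:R / n%:R)).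
  apply: ler_sum => i _.
  have := @treesum_gwalk R U n r L i [::] [::] [:: i] r0 rn erefl (fun _ => ltac:(by []))
    (mem_head _ _).
  by rewrite sL expr0 mulr1.
by rewrite sumr_const card_ord -[_ *+ n]mulr_natr divfK// gt_eqF.
Qed.

End MainTerm.

(** * Means over n points as integrals of step functions *)

Section RiemannSums.
Variable R : realType.
Local Notation pt := (measurableTypeR R).

Definition cell n (j : nat) : set pt := `[j%:R / n.+1%:R, j.+1%:R / n.+1%:R[.

(** Meant for y in [0,1), where it is the index of the cell containing y; for y >= 1 [inord]
    supplies the default 0. *)
Definition cell_idx n (y : R) : 'I_n.+1 := inord (Num.truncn (n.+1%:R * y)).

Lemma measurable_cell n j : measurable (cell n j).
Proof. exact: measurable_itv. Qed.

Lemma truncn_cell n (y : R) : 0 <= y < 1 -> (Num.truncn (n.+1%:R * y) < n.+1)%N.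
Proof.
move=> /andP[y0 y1]; rewrite -(ltr_nat R).
have /truncn_itv /andP[h _] : 0 <= n.+1%:R * y by rewrite mulr_ge0.
by apply: (le_lt_trans h); rewrite gtr_pMr.
Qed.

Lemma cell_idxE n (y : R) : 0 <= y < 1 -> cell_idx n y = Num.truncn (n.+1%:R * y) :> nat.
Proof. by move=> /truncn_cell h; rewrite /cell_idx inordK. Qed.

Lemma mem_cell n (j : 'I_n.+1) (y : R) : 0 <= y < 1 -> (y \in cell n j) = (cell_idx n y == j).
Proof.
move=> y01; rewrite -val_eqE /= cell_idxE//.
have n0 : 0 < n.+1%:R :> R by [].
have ny : 0 <= n.+1%:R * y by rewrite mulr_ge0//; case/andP: y01.
apply/idP/eqP => [|<-].
  rewrite inE /cell /= in_itv /= ler_pdivrMr// ltr_pdivlMr// mulrC.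
  exact: truncn_def.
rewrite inE /cell /= in_itv /= ler_pdivrMr// ltr_pdivlMr// [y * _]mulrC.
exact: truncn_itv.
Qed.

Lemma lebI_cell n (j : 'I_n.+1) : @lebI R (cell n j) = (n.+1%:R^-1)%:E.
Proof.
have n0 : 0 < n.+1%:R :> R by [].
rewrite /lebI /mfrestr /mrestr setIidl; last first.
  move=> y; rewrite /cell /= !in_itv /= => /andP[h1 h2]; apply/andP; split.
    by apply: le_trans h1; rewrite divr_ge0.
  by apply: (le_trans (ltW h2)); rewrite ler_pdivrMr// mul1r ler_nat.
rewrite lebesgue_measure_itv /= lte_fin ltr_pM2r ?invr_gt0// ltr_nat leqnn.
by rewrite -EFinD -mulrBl -natrB// subSnn mul1r.
Qed.

Lemma lebI_null (s : seq R) : @lebI R (~` `[0, 1] `|` [set` s]) = 0%E.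
Proof.
rewrite /lebI /mfrestr /mrestr.
rewrite (_ : _ `&` _ = [set` s] `&` `[0, 1]); last first.
  by rewrite setIUl setICl set0U.
rewrite countable_lebesgue_measure0//.
by apply/finite_set_countable/finite_setIl; exact: finite_seq.
Qed.

(** The mean is the integral of the step function with value [F n j] on cell j, and dominated
    convergence with the constant [B] applies. The summand may vary with n, and the finite set [s]
    leaves room for the points where the order relation is not settled. *)
Lemma riemann_sum (F : forall n, 'I_n.+1 -> R) (B : R) (phi : pt -> R) (s : seq R) :
  (forall n j, 0 <= F n j <= B) -> measurable_fun setT phi ->
  (forall y, 0 <= y < 1 -> y \notin s -> (fun n => F n (cell_idx n y)) @ \oo --> phi y) ->
  (fun n => n.+1%:R^-1 * \sum_(j < n.+1) F n j) @ \oo --> \int[@lebI R]_y phi y.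
Proof.
move=> F01 mphi cF.
pose f n (y : pt) := \sum_(j < n.+1) F n j * \1_(cell n j) y.
have mf n : measurable_fun setT (f n).
  apply: measurable_sum => j; apply: measurable_funM => //.
  by apply: measurable_indic; exact: measurable_cell.
have fE n y : 0 <= y < 1 -> f n y = F n (cell_idx n y).
  move=> y01; rewrite /f (bigD1 (cell_idx n y)) //= indicE mem_cell// eqxx mulr1.
  rewrite big1 ?addr0// => j /negbTE ji; rewrite indicE mem_cell// eq_sym ji mulr0 //.
have intf n : (\int[@lebI R]_y (f n y)%:E = (n.+1%:R^-1 * \sum_(j < n.+1) F n j)%:E)%E.
  under eq_integral do rewrite /f -sumEFin.
  rewrite ge0_integral_sum//.
  - rewrite mulr_sumr -sumEFin; apply: eq_bigr => j _.
    under eq_integral do rewrite EFinM.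
    rewrite ge0_integralZl_EFin//.
    + rewrite integral_indic//; last exact: measurable_cell.
      transitivity ((F n j)%:E * (n.+1%:R^-1)%:E)%E; last by rewrite -EFinM mulrC.
      by congr (_ * _)%E; rewrite setIT; exact: lebI_cell.
    + by apply/measurable_EFinP/measurable_indic; exact: measurable_cell.
    + by case/andP: (F01 n j).
  - move=> j; apply/measurable_EFinP; apply: measurable_funM => //.
    by apply: measurable_indic; exact: measurable_cell.
  - by move=> j y _; rewrite lee_fin mulr_ge0//; case/andP: (F01 n j).
have good (Q : pt -> Prop) : (forall y, 0 <= y < 1 -> y \notin s -> Q y) ->
    {ae @lebI R, forall y, Q y}.
  (* The point 1 joins the exceptional set because the cells are half-open. *)
  move=> h; exists (~` `[0, 1] `|` [set` 1 :: s]); split.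
  - apply: measurableU; first by apply: measurableC; exact: measurable_itv.
    exact/countable_measurable/finite_set_countable/finite_seq.
  - exact: lebI_null.
  - move=> y /= nQ; apply: contrapT => /not_orP[/contrapT y01 ys]; apply: nQ.
    move: y01 ys; rewrite /= in_itv /= inE => /andP[y0 y1] /negP.
    rewrite negb_or => /andP[yn1 ys]; apply: h => //.
    by rewrite y0 lt_neqAle yn1.
have [] := @dominated_convergence _ pt R (@lebI R) setT measurableT
  (fun n y => (f n y)%:E) (fun y => (phi y)%:E) (cst B%:E).
- by move=> n; exact/measurable_EFinP.
- exact/measurable_EFinP.
- apply: good => y y01 ys _; apply: cvg_EFin; first exact: nearW.
  by under eq_fun do rewrite /= fE//; exact: cF.
- exact: finite_measure_integrable_cst.
- apply: good => y y01 _ n _; rewrite /= fE// lee_fin ger0_norm.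
    by case/andP: (F01 n (cell_idx n y)).
  by case/andP: (F01 n (cell_idx n y)).
move=> iphi _; under eq_fun do rewrite /= intf.
rewrite -[X in _ --> X]fineK; last exact: integrable_fin_num.
exact: fine_cvg.
Qed.

End RiemannSums.

(** * Passage to the limit *)

Section Limit.
Variables (R : realType) (U : countType).
Local Notation pt := (measurableTypeR R).
Implicit Types (L : seq (bool * U)) (w : seq (U + U)).

Lemma triE e (x y : R) : 0 <= x < 1 -> 0 <= y < 1 ->
  tri e x y = (if e then y < x else x < y)%R%:R.
Proof.
move=> /andP[x0 x1] /andP[y0 y1].
have D (a b : R) : 0 <= a -> b < 1 -> \1_(@Delta R) (a, b) = (a < b)%R%:R :> R.
  move=> a0 b1; rewrite indicE; congr (_%:R); congr nat_of_bool; apply/idP/idP.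
    by rewrite inE => -[].
  by move=> ab; rewrite inE; split=> //=; exact: ltW.
by rewrite /tri; case: e; rewrite D.
Qed.

Lemma measurable_tri e (x : R) : measurable_fun setT (fun y : pt => tri e x y).
Proof.
have [m _] := linf_measurable (tri_linf e : linfty R).
rewrite (_ : (fun y => _) = fun y : pt => Re (tri_linf e (x, y).1 (x, y).2)).
  by apply: (measurableT_comp m); exact: measurable_pair1.
by apply/funext => y; rewrite tri_linfE.
Qed.

(** The indices separate as soon as (n+1)(y - x) >= 1. *)
Lemma near_lt_cell_idx (x y : R) : 0 <= x < 1 -> 0 <= y < 1 -> x < y ->
  \forall n \near \oo, (cell_idx n x < cell_idx n y)%N.
Proof.
move=> x01 y01 xy.
have yx : 0 < y - x by rewrite subr_gt0.
near=> n; rewrite !cell_idxE// truncn_gt_nat -natr1.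
have nn : 0 <= n.+1%:R * x by rewrite mulr_ge0//; case/andP: x01.
have /truncn_itv /andP[h _] := nn.
apply: (@le_trans _ _ (n.+1%:R * x + 1)); first by rewrite lerD2r.
rewrite -lerBrDl -mulrBr mulrC -ler_pdivrMr// mul1r ltW//.
by near: n; exact: (near_infty_natSinv_lt (PosNum yx)).
Unshelve. all: by end_near. Qed.

Lemma cvg_ord_rel e (x y : R) : 0 <= x < 1 -> 0 <= y < 1 -> x != y ->
  (fun n => (ord_rel e (cell_idx n x) (cell_idx n y))%:R : R) @ \oo --> (tri e x y : R).
Proof.
move=> x01 y01 xy; apply: cvg_near_cst; rewrite triE//.
have [lt|gt|/eqP] := ltgtP x y; last by rewrite (negbTE xy).
  near=> n; have h : (cell_idx n x < cell_idx n y)%N.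
    by near: n; exact: near_lt_cell_idx.
  by rewrite /ord_rel; case: e; rewrite ?h// ltnNge (ltnW h).
near=> n; have h : (cell_idx n y < cell_idx n x)%N.
  by near: n; exact: near_lt_cell_idx.
by rewrite /ord_rel; case: e; rewrite ?h// ltnNge (ltnW h).
Unshelve. all: by end_near. Qed.

(** Distinctness of the points makes every order relation between their cells eventually constant.
    In the integral the new point avoids the finite set [x :: xs], so the hypothesis survives the
    induction. *)
Lemma cvg_gwalk L (x : R) (xs : seq R) w : size xs = size w -> uniq (x :: xs) ->
  (forall y, y \in x :: xs -> 0 <= y < 1) ->
  (fun n => gwalk R L (cell_idx n x) [seq cell_idx n y | y <- xs] w) @ \oo --> (psi L x xs w : R).
Proof.
elim: L x xs w => [|[e u] L IH] x xs w sx ux xs01; first exact: cvg_cst.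
have x01 := xs01 x (mem_head _ _).
apply: cvgD.
  case: xs w sx ux xs01 => [|x1 xs] [|v w] //= sx ux xs01; try exact: cvg_cst.
  case: ifPn => _; last exact: cvg_cst.
  have x1in : x1 \in [:: x, x1 & xs] by rewrite !inE eqxx orbT.
  case: sx => sx; apply: cvgM.
    apply: cvg_ord_rel => //; first exact: xs01.
    by case/andP: ux; rewrite inE negb_or => /andP[].
  apply: IH => //; first by case/andP: ux.
  by move=> y yx; apply: xs01; rewrite inE yx orbT.
set w' := copy _ _ :: w.
have sx' : size (x :: xs) = size w' by rewrite /= sx.
apply: (@riemann_sum R (fun n y => (ord_rel e (cell_idx n x) y)%:R *
  gwalk R L y [seq cell_idx n y | y <- x :: xs] w') (2 ^+ size L) _ (x :: xs)).
- move=> n y; have /andP[g0 g1] := gwalk_bound R L y [seq cell_idx n y | y <- x :: xs] w'.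
  by case: ord_rel; rewrite ?mul1r ?mul0r ?g0 ?lexx ?exprn_ge0.
- apply: measurable_funM.
    exact: measurable_tri.
  have sw : size w' == (size xs).+1 by rewrite -sx'.
  exact: (measurable_psi L (in_tuple (x :: xs)) (Tuple sw)).
- move=> y y01 yx; apply: cvgM.
    by apply: cvg_ord_rel => //; apply: contra yx => /eqP ->; rewrite mem_head.
  apply: IH => //; first by rewrite cons_uniq yx.
  by move=> z; rewrite inE => /orP[/eqP -> //|]; exact: xs01.
Qed.

Lemma cvg_mean_gwalk L :
  (fun n => n.+1%:R^-1 * \sum_(i < n.+1) gwalk R L i [::] [::]) @ \oo -->
  (\int[@lebI R]_x psi L x [::] [::] : R).
Proof.
apply: (@riemann_sum R (fun n i => gwalk R L i [::] [::]) (2 ^+ size L) _ [::]).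
- by move=> n i; exact: gwalk_bound.
- exact: (measurable_psi L [tuple] [tuple]).
- move=> y y01 _; apply: (@cvg_gwalk L y [::] [::]) => // z.
  by rewrite inE => /eqP ->.
Qed.

End Limit.

Lemma cvg_complex (R : realType) (z : nat -> R[i]) (a : R) (g k : nat -> R) :
  (forall n, `|Re (z n) - g n| <= k n) -> (forall n, `|Im (z n)| <= k n) ->
  g @ \oo --> a -> k @ \oo --> 0 -> (z : nat -> R[i]^o) @ \oo --> (a%:C : R[i]^o).
Proof.
move=> hR hI ga k0; apply/cvgrPdist_lt => e e0.
(* A positive element of R[i] is a positive real number. *)
have e0' : 0 < Re e by move: e0; rewrite ltcE => /andP[].
have e0r : e = (Re e)%:C by move: e0; rewrite ltcE; case: e {e0'} => a' b' /= /andP[/eqP ->].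
near=> n.
have ga' : `|a - g n| < Re e / 3.
  by near: n; move/cvgrPdist_lt : ga; apply; rewrite divr_gt0.
have k0' : `|0 - k n| < Re e / 3.
  by near: n; move/cvgrPdist_lt : k0; apply; rewrite divr_gt0.
have kn : k n < Re e / 3.
  by apply: le_lt_trans k0'; rewrite sub0r normrN ler_norm.
rewrite e0r; have := hR n; have := hI n; case: (z n) => a' b' /= hb ha.
rewrite normc_def ltcR /= add0r.
apply: (@le_lt_trans _ _ (`|a - a'| + `|b'|)).
  rewrite -[leRHS]ger0_norm ?addr_ge0// -[leRHS]sqrtr_sqr ler_sqrt ?sqr_ge0//.
  rewrite sqrrN -(real_normK (num_real (a - a'))) -(real_normK (num_real b')) sqrrD.
  by rewrite lerD2r lerDl mulrn_wge0// mulr_ge0.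
have -> : Re e = Re e / 3 + Re e / 3 + Re e / 3 by field.
apply: ltrD; last exact: le_lt_trans kn.
rewrite -(subrK (g n) a) -addrA; apply: (le_lt_trans (ler_normD _ _)).
by apply: ltrD => //; rewrite distrC; exact: le_lt_trans kn.
Unshelve. all: by end_near. Qed.

Theorem theorem6p1 (R : realType) (U : countType)
  (d : nat -> measure_display) (T : forall n : nat, measurableType (d n))
  (P : forall n : nat, probability (T n) R)
  (Y : forall n : nat, U -> T n -> 'M[R[i]]_n)
  (HY : forall n : nat, (0 < n)%N -> independent_sut_gaussian (P n) (Y n))
  (m : nat) (eps : 'I_m -> bool) (u : 'I_m -> U) :
  (fun n : nat => tau (P n) (fun t : T n =>
     \big[mulmx/1%:M]_(k < m) mx_exp (eps k) (Y n (u k) t)) : R[i]^o)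
    @ \oo -->
  (vac_state (\big[(fun A B : fock R U -> fock R U => A \o B)/idfun]_(k < m)
     op_exp (eps k) (eta_op (u k))) : R[i]^o).
Proof.
(* The hypothesis on [Y] starts at n = 1; the shift to [n.+1] drops the index 0. *)
rewrite vac_state_word -cvg_shiftS.
have h n := tau_gwalk (ltn0Sn n) (HY _ (ltn0Sn n)) eps u.
set C := monC R m * ((1 + m) ^ m)%:R in h.
apply: (@cvg_complex _ _ _ _ (fun n => C / Num.sqrt n.+1%:R + (tree_err m 1)%:R / n.+1%:R)).
- by move=> n; have [hR _] := h n; exact: hR.
- move=> n; have [_ hI] := h n; apply: (le_trans hI).
  by rewrite lerDl divr_ge0.
- exact: cvg_mean_gwalk.
- rewrite -[X in _ --> X]addr0 -[X in _ --> X + _](mulr0 C) -[X in _ --> _ + X](mulr0 (tree_err m 1)%:R).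
  apply: cvgD; apply: cvgM; try exact: cvg_cst; last exact: cvg_harmonic.
  rewrite -[X in _ --> X](sqrtr0 R).
  under eq_fun do rewrite -sqrtrV//.
  exact: (continuous_cvg _ (@sqrt_continuous R 0) (@cvg_harmonic R)).
Qed.
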